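(* Let $C$ be an irreducible hypersurface over $\mathbb{Q}$, given by the projective equation $f(x_1,\dots,x_m)=0$ with $f\in\mathbb{Z}[x_1,\dots,x_m]$ irreducible and homogeneous and $m\ge 3$. There exists a finite set of positive integers $\mathcal E(C)$ such that \[ D(C)^{\mathrm{inf}} = G(C)\,\mathbb{Z}_{\ge 1}\setminus \mathcal E(C). \] Equivalently, the set $\{n\ge 1:\ G(C)\mid n \text{ and } n\notin D(C)^{\mathrm{inf}}\}$ is finite.
   Context: For a number field $L$, a point of $C$ with coordinates in $L$ is called a new point over $L$ if it is non-singular (not all partial derivatives $\partial f/\partial x_j$ vanish at it) and it is not defined over any proper subfield of $L$. Let $\mathcal F(C)$ be the set of number fields $L$ over which $C$ has a new point. Define $D(C)=\{[L:\mathbb{Q}]: L\in\mathcal F(C)\}$, let $D(C)^{\mathrm{inf}}$ be the set of integers $n$ for which there are infinitely many $L\in\mathcal F(C)$ with $[L:\mathbb{Q}]=n$, and let $G(C)=\gcd_{n\in D(C)} n$ (the index of $C$). *)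

(* Defs.v *)
From HB Require Import structures.
From mathcomp Require Import all_boot all_order all_algebra all_field.
From mathcomp Require Import mpoly.
Set Implicit Arguments. Unset Strict Implicit. Unset Printing Implicit Defensive.
Import Order.TTheory GRing.Theory Num.Theory.
Local Open Scope ring_scope.

Definition is_subfield (L : pred algC) : Prop := divring_closed L.

Definition has_degree (L : pred algC) (n : nat) : Prop :=
  exists b : n.-tuple algC,
    (forall i : 'I_n, tnth b i \in L) /\
    (forall x, x \in L -> exists c : 'I_n -> rat, x = \sum_(i < n) ratr (c i) * tnth b i) /\
    (forall c : 'I_n -> rat, \sum_(i < n) ratr (c i) * tnth b i = 0 -> forall i, c i = 0).

Definition is_number_field (L : pred algC) : Prop :=
  is_subfield L /\ exists n, has_degree L n.

(* Irreducible element of Z[x_1..x_m] (units of Z[x] are +1 and -1). *)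
Definition mirreducible (m : nat) (f : {mpoly int[m]}) : Prop :=
  f <> 0 /\ f <> 1 /\ f <> -1 /\
  forall g h : {mpoly int[m]}, f = g * h -> g = 1 \/ g = -1 \/ h = 1 \/ h = -1.

Definition fC (m : nat) (f : {mpoly int[m]}) : {mpoly algC[m]} :=
  map_mpoly (fun z : int => z%:~R) f.

(* x is a (representative of a) projective point of C : f = 0, with
   coordinates in the field L *)
Definition point_in (m : nat) (f : {mpoly int[m]}) (L : pred algC)
    (x : 'I_m -> algC) : Prop :=
  (exists i, x i != 0) /\ (forall i, x i \in L) /\ meval x (fC f) = 0.

Definition nonsingular (m : nat) (f : {mpoly int[m]}) (x : 'I_m -> algC) : Prop :=
  exists j : 'I_m, meval x (mderiv j (fC f)) != 0.

Definition defined_over (m : nat) (K : pred algC) (x : 'I_m -> algC) : Prop :=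
  exists lam : algC, lam != 0 /\ forall i, lam * x i \in K.

Definition new_point (m : nat) (f : {mpoly int[m]}) (L : pred algC)
    (x : 'I_m -> algC) : Prop :=
  point_in f L x /\ nonsingular f x /\
  forall K : pred algC, is_subfield K -> {subset K <= L} -> ~ (K =i L) ->
    ~ defined_over K x.

Definition in_F (m : nat) (f : {mpoly int[m]}) (L : pred algC) : Prop :=
  is_number_field L /\ exists x, new_point f L x.

Definition D (m : nat) (f : {mpoly int[m]}) (n : nat) : Prop :=
  exists L, in_F f L /\ has_degree L n.

Definition infinitely_many_fields (P : pred algC -> Prop) : Prop :=
  forall k : nat, exists s : seq (pred algC),
    size s = k /\ (forall i, (i < k)%N -> P (nth (fun _ => false) s i)) /\
    (forall i j, (i < k)%N -> (j < k)%N -> i <> j ->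
       ~ (nth (fun _ => false) s i =i nth (fun _ => false) s j)).

Definition Dinf (m : nat) (f : {mpoly int[m]}) (n : nat) : Prop :=
  infinitely_many_fields (fun L => in_F f L /\ has_degree L n).

Definition is_gcd_of (S : nat -> Prop) (g : nat) : Prop :=
  (forall n, S n -> (g %| n)%N) /\
  (forall d, (forall n, S n -> (d %| n)%N) -> (d %| g)%N).

(* Main.v *)
Require Import Defs.
From HB Require Import structures.
From mathcomp Require Import all_boot all_order all_algebra all_field.
From mathcomp Require Import mpoly ring lra zify.
From Stdlib Require Import Classical.
Set Implicit Arguments. Unset Strict Implicit. Unset Printing Implicit Defensive.
Import Order.TTheory GRing.Theory Num.Theory.
Local Open Scope ring_scope.

(* Let Xi be a Galois-stable set of a nonsingular algebraic points of C: the
   empty set, a closed point, or two closed points of different degrees.  In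
   suitable rational coordinates take the curves
     t |-> (1 : t : c(t) + A(t) (t^q eta + u)),
   where A vanishes at the second coordinates of the points of Xi, c interpolates
   their remaining coordinates, eta is a direction off C and u a rational
   parameter.  All these curves pass through Xi, so f restricted to them is
   A(t) B(u; t) with deg_t B = d (a + q) - a.

   Since t and u are rational functions of the point, a factorisation of B would
   give one of f, so B is irreducible over Q(u), and B has no polynomial root in
   u.  Hilbert irreducibility, in a form that also keeps the roots out of a
   prescribed number field, yields a rational u for which a root t0 of B has
   degree d (a + q) - a; the point with parameter t0 is new over Q(t0).  Hence
   all large n = -a mod d lie in D(C)^inf.  The residues mod d obtained in this
   way are closed under addition and contain all of D(C), hence all multiples
   of G(C).

   Hilbert irreducibility is proved by expanding the roots at u0 + b/T in powers
   of 1/T.  If a symmetric function of some of the roots were rational at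
   several multiples T = x_k N, a divided difference of its values would be an
   integer of absolute value less than 1, although it is equivalent to a nonzero
   multiple of 1/N. *)

(** The curves only give degrees congruent to [-a], where [a] is the size of a Galois-stable set.
    Using a large degree [n = -a] mod [d] as the size of a new closed point gives [-n = a], which
    repairs the sign. Adding two residues requires disjoint closed points. Different degrees
    guarantee this, and they can be arranged because every residue reached has arbitrarily large
    representatives.

    Since eta is off C, the top coefficient in t is a nonzero constant, so B is monic up to a
    scalar. Nonsingularity of Xi allows eta to be transversal to the tangent spaces; then f vanishes
    only simply at the points of Xi for generic u, and B has no constant root there.

    B may well split over the algebraic numbers. Hilbert irreducibility therefore also has to treat
    sets of roots whose symmetric functions are polynomials with irrational coefficients: an
    automorphism moves such a polynomial, so it takes rational values at few rational points.

    The prescribed number field is the one generated by the fields already found; avoiding it turns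
    one new field into infinitely many. *)

Local Notation ratC := (ratr : {rmorphism rat -> algC}).
Local Notation intC := (intr : {rmorphism int -> algC}).
Local Notation intQ := (intr : {rmorphism int -> rat}).
Local Notation pQtoC := (map_poly (ratr : rat -> algC)).

(** * Conjugates of algebraic numbers *)

Lemma map_in_alg_ratr (L : fieldExtType rat) (LC : {rmorphism L -> algC}) p :
  map_poly LC (map_poly (in_alg L) p) = pQtoC p.
Proof.
rewrite -map_poly_comp; apply: eq_map_poly => a /=.
by rewrite rmorphZ_num rmorph1 mulr1.
Qed.

(** The assignment of [w] to [z] extends to the splitting field of [minCpoly z], which is normal,
    and then to [algC] by [extend_algC_subfield_aut]. Ring endomorphisms of [algC] serve as the
    absolute Galois group from here on. *)
Lemma conj_aut (z w : algC) :
  root (minCpoly z) w -> exists nu : {rmorphism algC -> algC}, nu z = w.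
Proof.
have [p [Dp mon_p] pz] := minCpolyP z => pw.
have [r Dr] := closed_field_poly_normal (pQtoC p : {poly algC}).
rewrite lead_coef_map (monicP mon_p) rmorph1 scale1r in Dr.
have zr : z \in r by rewrite -root_prod_XsubC -Dr pz.
have wr : w \in r by rewrite -root_prod_XsubC -Dr -Dp.
have [Q [QC [rr Drr genQ]]] := num_field_exists r.
have [zz _ Dz] : exists2 zz, zz \in rr & z = QC zz by apply/mapP; rewrite Drr.
have [ww _ Dw] : exists2 ww, ww \in rr & w = QC ww by apply/mapP; rewrite Drr.
have homQ1: kHom 1 1 (\1%VF : 'End(Q)) by rewrite kHom1.
have mapid (q : {poly Q}) : map_poly (\1%VF : 'End(Q)) q = q.
  by rewrite map_polyE map_id_in ?polyseqK // => a _; rewrite id_lfunE.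
have rw : root (map_poly (\1%VF : 'End(Q)) (minPoly 1 zz)) ww.
  rewrite mapid.
  have [q1 Dq1] : exists q1, minPoly 1 zz = map_poly (in_alg Q) q1.
    have aP i: (minPoly 1 zz)`_i \in 1%VS by apply/polyOverP; apply: minPolyOver.
    have a_ i := sig_eqW (vlineP _ _ (aP i)).
    exists (\poly_(i < size (minPoly 1 zz)) sval (a_ i)).
    apply/polyP=> i; rewrite coef_map coef_poly /=.
    case: ifP => [_|/negbT]; first by case: (a_ i).
    by rewrite -leqNgt scale0r => /(nth_default 0).
  rewrite -(fmorph_root QC) -Dw Dq1 map_in_alg_ratr.
  have : root (pQtoC q1) z.
    by rewrite Dz -(map_in_alg_ratr QC) -Dq1 fmorph_root root_minPoly.
  rewrite pz => /dvdpP[q2 ->]; rewrite rmorphM rootM /= -Dp pw orbT //.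
have homf := kHomExtendP (sub1v _) homQ1 rw.
pose pr := map_poly (in_alg Q) p.
have Qpr : pr \is a polyOver 1%VS.
  by apply/polyOverP=> i; rewrite coef_map memvZ ?memv_line.
have split : splittingFieldFor <<1; zz>> pr fullv.
  apply: splittingFieldForS (sub1v _) (subvf _) _; exists rr => //.
  congr (_ %= _): (eqpxx pr); apply/(map_poly_inj QC).
  rewrite map_in_alg_ratr Dr -Drr big_map rmorph_prod /=; apply: eq_bigr => y _.
  by rewrite map_polyXsubC.
have [f1 hom1 Df1] := kHom_extends (sub1v _) homf Qpr split.
pose f1mM := GRing.isMonoidMorphism.Build _ _ f1 (kHom_monoid_morphism hom1).
pose phi : {rmorphism Q -> Q} := HB.pack (fun_of_lfun f1) f1mM.
have [nu Dnu] := extend_algC_subfield_aut QC phi.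
exists nu; rewrite Dz -Dnu /= -Df1 ?memv_adjoin //.
by rewrite (kHomExtend_val (K := 1%AS) (E := 1%AS)) ?Dw.
Qed.

Lemma deriv_neq0 (R : idomainType) (p : {poly R}) :
  (forall n, n.+1%:R != 0 :> R) -> (1 < size p)%N -> p^`() != 0.
Proof.
move=> char0 sp; apply/eqP=> /polyP/(_ (size p).-2).
rewrite coef_deriv coef0 => /eqP.
have -> : (size p).-2.+1 = (size p).-1 by case: (size p) sp => [|[]].
rewrite -mulr_natr mulf_eq0 -lead_coefE lead_coef_eq0 -size_poly_eq0.
by case: (size p) sp => [|[|k]] // _; rewrite orFb (negPf (char0 k)).
Qed.

Lemma minCpoly_separable z : separable_poly (minCpoly z).
Proof.
have [p [Dp mon_p] pz] := minCpolyP z.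
rewrite Dp separable_map unlock.
have irr q : root (pQtoC q) z -> p %| q by rewrite pz.
rewrite -(coprimep_map ratC) coprimep_def.
rewrite -gcdp_map size_map_poly.
set g := gcdp _ _.
have gp : g %| p by apply: dvdp_gcdl.
have p0 : p != 0 by apply: monic_neq0.
have sp : (1 < size p)%N by rewrite -(size_map_poly ratC) -Dp size_minCpoly.
case/dvdpP: gp => q Dq.
have q0 : q != 0 by apply: contraNneq p0 => q0; rewrite Dq q0 mul0r.
have g0 : g != 0 by apply: contraNneq p0 => g0; rewrite Dq g0 mulr0.
have : root (pQtoC (q * g)) z by rewrite -Dq pz.
rewrite rmorphM rootM => /orP[/irr pq|/irr pg].
  have := dvdp_leq q0 pq; rewrite {1}Dq size_mul // => le.
  rewrite eqn_leq size_poly_gt0 g0 andbT -(leq_add2l (size q)) addn1.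
  by rewrite -ltnS prednK // in le; rewrite addn_gt0 size_poly_gt0 q0.
have := dvdp_leq _ (dvdp_trans pg (dvdp_gcdr _ _)).
have dp0 : p^`() != 0.
  by apply: deriv_neq0 => // n; rewrite pnatr_eq0.
by move=> /(_ dp0); rewrite leqNgt lt_size_deriv.
Qed.

(** By [conj_aut] all roots of the minimal polynomial equal [z], and separability then leaves degree
    one. *)
Lemma fix_Crat (z : algC) :
  (forall nu : {rmorphism algC -> algC}, nu z = z) -> z \in Crat.
Proof.
move=> fixz.
have [r Dr] := closed_field_poly_normal (minCpoly z).
rewrite (monicP (minCpoly_monic z)) scale1r in Dr.
have allz y : y \in r -> y = z.
  rewrite -root_prod_XsubC -Dr => /conj_aut[nu <-]; exact: fixz.
have ur : uniq r by rewrite -separable_prod_XsubC -Dr minCpoly_separable.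
have [p [Dp mon_p] pz] := minCpolyP z.
have sr : (size r <= 1)%N.
  by apply: (@uniq_leq_size _ r [:: z]) => // y /allz ->; rewrite inE.
have : size (minCpoly z) = 2.
  apply/eqP; rewrite eqn_leq size_minCpoly andbT.
  by rewrite Dr size_prod_XsubC.
move=> s2; have Dr1 : r = [:: z].
  case: r Dr ur allz sr => [|y [|]] // Dr _ allz _.
    by move: s2; rewrite Dr big_nil size_poly1.
  by rewrite (allz y) ?inE.
rewrite Dr1 big_seq1 in Dr.
have : - z \in Crat.
  have -> : - z = (minCpoly z)`_0 by rewrite Dr coefB coefX coefC sub0r.
  by rewrite Dp coef_map Crat_rat.
by rewrite rpredN.
Qed.

(** The constant term of the minimal polynomial is an integer and, up to sign, the product of the
    conjugates, so it is 0. Hence 0 is a conjugate of [z]. *)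
Lemma Aint_small_conj (z : algC) : z \in Aint ->
  (forall nu : {rmorphism algC -> algC}, `|nu z| < 1) -> z = 0.
Proof.
move=> Az small.
have [r Dr] := closed_field_poly_normal (minCpoly z).
rewrite (monicP (minCpoly_monic z)) scale1r in Dr.
have sm y : y \in r -> `|y| < 1.
  by rewrite -root_prod_XsubC -Dr => /conj_aut[nu <-].
have Z0 : (minCpoly z)`_0 \in Num.int by move/polyOverP: Az; apply.
have r_gt0 : (0 < size r)%N.
  have := size_minCpoly z; rewrite Dr size_prod_XsubC.
  by case: (size r).
have C0 : `|(minCpoly z)`_0| < 1.
  rewrite Dr -horner_coef0 horner_prod normr_prod.
  rewrite (eq_big_seq (fun y => `|y|)) => [|y _]; last first.
    by rewrite hornerXsubC sub0r normrN.
  case: r r_gt0 sm {Dr} => [//|y r] _ sm; rewrite big_cons.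
  apply: le_lt_trans (sm y _); last by rewrite inE eqxx.
  rewrite ler_piMr // big_seq prodr_ile1 // => x xr.
  by rewrite normr_ge0 ltW // sm // inE xr orbT.
have z0 : (minCpoly z)`_0 = 0.
  by apply/eqP; apply: contraTT C0 => /(norm_intr_ge1 Z0) /le_gtF ->.
have : root (minCpoly z) 0 by rewrite rootE horner_coef0 z0.
by case/conj_aut=> nu /eqP; rewrite fmorph_eq0 => /eqP.
Qed.

(** * Unique factorisation in polynomial rings *)

Section Factorial.

Definition rdvd (R : comNzRingType) (a b : R) := exists c, b = c * a.

Definition prime_elt (R : comNzRingType) (p : R) :=
  [/\ p <> 0, ~ rdvd p 1 & forall a b, rdvd p (a * b) -> rdvd p a \/ rdvd p b].

Definition factorial_ring (R : comNzRingType) := forall x : R, x <> 0 ->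
  exists u s, [/\ rdvd u 1, forall p, p \in s -> prime_elt p & x = u * \prod_(p <- s) p].

Lemma rdvd_trans (R : comNzRingType) (a b c : R) : rdvd a b -> rdvd b c -> rdvd a c.
Proof. by move=> [x ->] [y ->]; exists (y * x); rewrite mulrA. Qed.

Lemma rdvd_mull (R : comNzRingType) (a b c : R) : rdvd a c -> rdvd a (b * c).
Proof. by move=> [x ->]; exists (b * x); rewrite mulrA. Qed.

Lemma rdvd_mulr (R : comNzRingType) (a b c : R) : rdvd a b -> rdvd a (b * c).
Proof. by rewrite mulrC; apply: rdvd_mull. Qed.

Lemma rdvd_add (R : comNzRingType) (a b c : R) : rdvd a b -> rdvd a c -> rdvd a (b + c).
Proof. by move=> [x ->] [y ->]; exists (x + y); rewrite mulrDl. Qed.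

Lemma rdvd_sub (R : comNzRingType) (a b c : R) : rdvd a b -> rdvd a c -> rdvd a (b - c).
Proof. by move=> [x ->] [y ->]; exists (x - y); rewrite mulrBl. Qed.

Lemma rdvd0 (R : comNzRingType) (a : R) : rdvd a 0.
Proof. by exists 0; rewrite mul0r. Qed.

Lemma rdvd_prime_prod (R : comNzRingType) (p : R) (s : seq R) : prime_elt p ->
  rdvd p (\prod_(q <- s) q) -> exists2 q, q \in s & rdvd p q.
Proof.
move=> pp; elim: s => [|q s IH]; first by rewrite big_nil; case: pp.
rewrite big_cons; case: (pp) => _ _ /[apply] -[pq|/IH[r rs pr]].
  by exists q; rewrite ?inE ?eqxx.
by exists r; rewrite ?inE ?rs ?orbT.
Qed.

Variable R : idomainType.
Implicit Types (p q a b : {poly R}) (x c : R).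

Lemma rdvd_polyC c a : rdvd c%:P a -> forall i, rdvd c a`_i.
Proof. by move=> [b ->] i; exists b`_i; rewrite coefMC. Qed.

(** Gauss's lemma without quotient rings: [x] divides the product of the leading coefficients, hence
    one of them, and that leading term can be subtracted. Induction on the total size. *)
Lemma prime_polyC x : prime_elt x -> prime_elt (x%:P : {poly R}).
Proof.
case=> x0 x1 xM; split.
- by move/eqP; rewrite polyC_eq0 => /eqP.
- by move/rdvd_polyC/(_ 0); rewrite coef1.
move=> a b; move: {2}(_ + _)%N (leqnn (size a + size b)) => n.
elim: n a b => [|n IH] a b.
  by rewrite leqn0 addn_eq0 size_poly_eq0 => /andP[/eqP-> _] _; left; apply: rdvd0.
move=> le xab.
have [->|a0] := eqVneq a 0; first by left; apply: rdvd0.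
have [->|b0] := eqVneq b 0; first by right; apply: rdvd0.
have trunc (u : {poly R}) : u != 0 -> rdvd x (lead_coef u) ->
    exists2 v : {poly R}, (size v < size u)%N & rdvd x%:P (u - v).
  move=> u0 [c Dc]; exists (u - lead_coef u *: 'X^((size u).-1)).
    have su : (0 < size u)%N by rewrite size_poly_gt0.
    rewrite -{2}(prednK su) ltnS; apply/leq_sizeP => j le_j.
    rewrite coefB coefZ coefXn; case: eqP => [->|/eqP ne]; first by rewrite mulr1 subrr.
    rewrite mulr0 subr0 nth_default // -(prednK su).
    by rewrite ltn_neqAle eq_sym ne.
  by rewrite opprB addrC subrK Dc; exists (c *: 'X^((size u).-1)); rewrite -mul_polyC polyCM -!mul_polyC; ring.
have : rdvd x (lead_coef a * lead_coef b) by rewrite -lead_coefM; apply: rdvd_polyC.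
case/xM=> /trunc[] // v sv dv.
  case: (IH v b).
  - by rewrite -ltnS (leq_trans _ le) // ltn_add2r.
  - by rewrite -[v](subKr a) mulrBl; apply: rdvd_sub => //; apply: rdvd_mulr.
  - by move=> dxv; left; rewrite -[a](subrK v); apply: rdvd_add.
  by right.
case: (IH a v).
- by rewrite -ltnS (leq_trans _ le) // ltn_add2l.
- by rewrite -[v](subKr b) mulrBr; apply: rdvd_sub => //; apply: rdvd_mull.
- by left.
by move=> dxv; right; rewrite -[b](subrK v); apply: rdvd_add.
Qed.

Hypothesis facR : factorial_ring R.

(** The primes of [c] are cancelled one at a time; each divides [q] or [r] by [prime_polyC]. A
    factorisation over the fraction field thus descends to [R] with the same degrees. *)
Lemma clear_content2 c p q r : c != 0 -> c *: p = q * r ->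
  exists q' r', [/\ p = q' * r', size q' = size q & size r' = size r].
Proof.
move/eqP/facR=> [u [s [[v uv] ps ->]]] {c}.
have u0 : u != 0.
  by apply: contra_eq_neq uv => ->; rewrite mulr0 oner_neq0.
have v0 : v != 0.
  by apply: contra_eq_neq uv => ->; rewrite mul0r oner_neq0.
elim: s ps q r => [|x s IH] ps q r.
  rewrite big_nil mulr1 => E; exists (v *: q), r; split=> //.
    by rewrite -scalerAl -E scalerA -uv scale1r.
  by rewrite size_scale.
have xp : prime_elt x by apply: ps; rewrite inE eqxx.
have {}IH := IH (fun y ys => ps y (mem_behead (s := x :: s) ys)).
have x0 : x%:P != 0 :> {poly R} by rewrite polyC_eq0; case: xp => /eqP.
rewrite big_cons mulrCA -scalerA => E.
have : rdvd x%:P (q * r) by exists ((u * \prod_(j <- s) j) *: p); rewrite -E -mul_polyC mulrC.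
case: (prime_polyC xp) => _ _ /[apply] -[[q1 Dq]|[r1 Dr]].
  have [|q' [r' [-> sq sr]]] := IH q1 r.
    by apply: (mulfI x0); rewrite mul_polyC E Dq; ring.
  exists q', r'; split=> //; rewrite sq Dq mulrC mul_polyC size_scale //.
  by rewrite -polyC_eq0.
have [|q' [r' [-> sq sr]]] := IH q r1.
  by apply: (mulfI x0); rewrite mul_polyC E Dr; ring.
exists q', r'; split=> //; rewrite sr Dr mulrC mul_polyC size_scale //.
by rewrite -polyC_eq0.
Qed.

Definition primitive p := forall x, prime_elt x -> ~ rdvd x%:P p.

Lemma primitive_rdvd c p a q : primitive p -> c != 0 -> c *: a = q * p -> rdvd p a.
Proof.
move=> prp /eqP/facR[u [s [[v uv] ps ->]]] {c}.
elim: s ps q => [|x s IH] ps q.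
  rewrite big_nil mulr1 => E; exists (v *: q).
  by rewrite -scalerAl -E scalerA -uv scale1r.
have xp : prime_elt x by apply: ps; rewrite inE eqxx.
have {}IH := IH (fun y ys => ps y (mem_behead (s := x :: s) ys)).
have x0 : x%:P != 0 :> {poly R} by rewrite polyC_eq0; case: xp => /eqP.
rewrite big_cons mulrCA -scalerA => E.
have : rdvd x%:P (q * p) by exists ((u * \prod_(j <- s) j) *: a); rewrite -E -mul_polyC mulrC.
case: (prime_polyC xp) => _ _ /[apply] -[[q1 Dq]|/(prp _ xp)//].
by apply: (IH q1); apply: (mulfI x0); rewrite mul_polyC E Dq; ring.
Qed.

(** A constant prime dividing [p] divides the leading coefficient and is associated to one of its
    finitely many prime factors, so extracting such primes stops. *)
Lemma primitive_part p : p != 0 -> exists c q, [/\ c != 0, p = c *: q & primitive q].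
Proof.
move=> p0; have /eqP/facR[u [s [u1 ps Dlc]]] : lead_coef p != 0 by rewrite lead_coef_eq0.
move: {2}(size s) (leqnn (size s)) => n.
elim: n u s p p0 u1 ps Dlc => [|n IH] u s p p0 u1 ps Dlc le_s.
all: case: (classic (exists2 x, prime_elt x & rdvd x%:P p)) => [[x px [p1 Dp]]|np].
2,4: by exists 1, p; rewrite scale1r oner_neq0; split=> // x px dx; apply: np; exists x.
all: have x0 : x != 0 by case: px => /eqP.
all: have Dlc1 : lead_coef p = lead_coef p1 * x by rewrite Dp lead_coefM lead_coefC.
all: have : rdvd x (u * \prod_(q <- s) q) by rewrite -Dlc Dlc1; exists (lead_coef p1).
all: case: (px) => _ x1 /[apply] -[xu|/(rdvd_prime_prod px)[y ys [w Dy]]].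
1,3: by case: x1; apply: rdvd_trans u1.
  by case: (s) le_s ys.
have py := ps _ ys.
have w1 : rdvd w 1.
  case: (py) => y0 y1 /(_ w x); rewrite -Dy => -[|[w' Dw]|[w' Dx]].
  - by exists 1; rewrite mul1r.
  - case: x1; exists w'; apply: (mulIf (x := w)); last by rewrite mul1r {1}Dw Dy; ring.
    by apply/eqP=> w0; apply: y0; rewrite Dy w0 mul0r.
  by exists w'; apply: (mulIf x0); rewrite mul1r {1}Dx Dy; ring.
have p10 : p1 != 0 by apply: contraNneq p0 => p10; rewrite Dp p10 mul0r.
have [| | | |c [q [c0 Dq pq]]] := IH (u * w) (rem y s) p1 p10.
- case: u1 w1 => [a Da] [b Db]; exists (a * b).
  by rewrite mulrACA -Da -Db mulr1.
- by move=> z /mem_rem /ps.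
- apply: (mulIf x0); rewrite -Dlc1 Dlc (big_rem y) //= {1}Dy; ring.
- by rewrite size_rem //; case: (s) ys le_s.
by exists (x * c), q; split=> //; rewrite ?mulf_neq0 // Dp Dq -scalerA -[in RHS]mul_polyC mulrC.
Qed.

(** [gcdp] is a gcd over the fraction field. By [clear_content2] it yields a factor of [p] over [R],
    so irreducibility makes it constant or of full degree; [primitive_rdvd] brings the resulting
    divisibility back to [R]. *)
Lemma primitive_prime p : primitive p -> (1 < size p)%N ->
  (forall a b, p = a * b -> (size p <= size a)%N \/ (size p <= size b)%N) ->
  prime_elt p.
Proof.
move=> prp sp irr.
have p0 : p != 0 by rewrite -size_poly_gt0 ltnW.
split; first exact/eqP.
  move=> [q /(congr1 (size : {poly R} -> nat))].
  have [->|q0] := eqVneq q 0; first by rewrite mul0r size_poly1 size_poly0.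
  rewrite size_mul // size_poly1; move: sp; rewrite -(size_poly_gt0 q) in q0.
  by case: (size q) (size p) q0 => [//|?] [|[|?]] //; rewrite !addnS.
move=> a b [k Dk].
have pab : p %| a * b by rewrite Dk dvdp_mull.
have : gcdp p a %| p by apply: dvdp_gcdl.
case/Pdiv.Idomain.dvdpP=> -[c q] /= c0 /(clear_content2 c0)[q' [g' [Dp sq sg]]].
have q0 : q' != 0 by apply: contraNneq p0 => q0; rewrite Dp q0 mul0r.
have g0 : g' != 0 by apply: contraNneq p0 => g0; rewrite Dp g0 mulr0.
have := congr1 (size : {poly R} -> nat) Dp; rewrite size_mul // => spq.
have fin (d : {poly R}) : p %| d -> rdvd p d.
  by case/Pdiv.Idomain.dvdpP=> -[e r] /= e0 /(primitive_rdvd prp e0).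
have q_gt0 : (0 < size q')%N by rewrite size_poly_gt0.
have g_gt0 : (0 < size g')%N by rewrite size_poly_gt0.
case: (irr _ _ Dp) => le.
  have : size g' = 1 by lia.
  by rewrite sg => /eqP cop; right; apply: fin; rewrite -(Gauss_dvdpr _ cop).
left; apply: fin; apply: dvdp_trans (dvdp_gcdr p a).
have : gcdp p a %= p.
  rewrite -dvdp_size_eqp ?dvdp_gcdl // eqn_leq -{2}sg le andbT.
  by rewrite dvdp_leq ?dvdp_gcdl.
by rewrite /eqp => /andP[].
Qed.

Lemma factorial_poly : factorial_ring {poly R}.
Proof.
move=> p; move: {2}(size p) (leqnn (size p)) => n.
elim: n p => [|n IH] p le /eqP p0.
  by move: le; rewrite leqn0 size_poly_eq0 (negPf p0).
have fC (c : R) : c != 0 -> exists u s, [/\ rdvd u 1, forall q, q \in s -> prime_elt q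
      & c%:P = u * \prod_(q <- s) q :> {poly R}].
  move/eqP/facR=> [u [s [[v uv] ps ->]]]; exists u%:P, [seq x%:P | x <- s]; split.
  - by exists v%:P; rewrite -polyCM -uv.
  - by move=> q /mapP[x /ps px ->]; apply: prime_polyC.
  by rewrite polyCM big_map rmorph_prod.
have fM (a b : {poly R}) :
    (exists u s, [/\ rdvd u 1, forall q, q \in s -> prime_elt q & a = u * \prod_(q <- s) q]) ->
    (exists u s, [/\ rdvd u 1, forall q, q \in s -> prime_elt q & b = u * \prod_(q <- s) q]) ->
    (exists u s, [/\ rdvd u 1, forall q, q \in s -> prime_elt q & a * b = u * \prod_(q <- s) q]).
  move=> [u [s [[u' Du] ps ->]]] [v [t [[v' Dv] pt ->]]].
  exists (u * v), (s ++ t); split.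
  - by exists (u' * v'); rewrite mulrACA -Du -Dv mulr1.
  - by move=> q; rewrite mem_cat => /orP[/ps|/pt].
  by rewrite big_cat mulrACA.
have [c [q [c0 Dp prq]]] := primitive_part p0.
have q0 : q != 0 by apply: contraNneq p0 => q0; rewrite Dp q0 scaler0.
rewrite Dp -mul_polyC; apply: (fM); first exact: fC.
rewrite Dp size_scale // in le.
have [sq|sq] := leqP (size q) 1.
  by rewrite (size1_polyC sq); apply: fC; rewrite -polyC_eq0 -size1_polyC.
case: (classic (exists a b, [/\ q = a * b, (size a < size q)%N & (size b < size q)%N])).
  move=> [a [b [Dq sa sb]]]; rewrite Dq; apply: fM.
    apply: IH; first by rewrite -ltnS (leq_trans sa).
    by apply/eqP; apply: contraNneq q0 => a0; rewrite Dq a0 mul0r.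
  apply: IH; first by rewrite -ltnS (leq_trans sb).
  by apply/eqP; apply: contraNneq q0 => a0; rewrite Dq a0 mulr0.
move=> nex; exists 1, [:: q]; split; first by exists 1; rewrite mulr1.
  move=> z; rewrite inE => /eqP->; apply: primitive_prime => // a b Dq.
  have [|sa] := leqP (size q) (size a); first by left.
  by right; rewrite leqNgt; apply/negP=> sb; apply: nex; exists a, b.
by rewrite big_seq1 mul1r.
Qed.

End Factorial.

Lemma mpoly_rmorph_ext n (R S : comNzRingType) (f g : {rmorphism {mpoly R[n]} -> S}) :
  (forall c, f c%:MP = g c%:MP) -> (forall i, f 'X_i = g 'X_i) -> f =1 g.
Proof.
move=> fgC fgX p; rewrite (mpolyE p) !rmorph_sum; apply: eq_bigr => m _.
rewrite -mul_mpolyC !rmorphM /= fgC; congr (_ * _).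
by rewrite mpolyXE_id !rmorph_prod; apply: eq_bigr => i _; rewrite !rmorphXn /= fgX.
Qed.

Lemma prime_elt_iso (R S : comNzRingType) (f : {rmorphism R -> S}) (g : {rmorphism S -> R}) p :
  cancel f g -> cancel g f -> prime_elt p -> prime_elt (f p).
Proof.
move=> fK gK [p0 p1 pM]; split.
- by move=> fp0; apply: p0; rewrite -(fK p) fp0 rmorph0.
- by move=> [c Dc]; apply: p1; exists (g c); rewrite -[X in _ * X]fK -rmorphM -Dc rmorph1.
have tr a : rdvd p (g a) -> rdvd (f p) a.
  by move=> [c Dc]; exists (f c); rewrite -rmorphM -Dc gK.
move=> a b [c Dc]; case: (pM (g a) (g b)) => [|/tr|/tr]; [|by left|by right].
by exists (g c); rewrite -rmorphM Dc rmorphM fK.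
Qed.

Lemma factorial_iso (R S : comNzRingType) (f : {rmorphism R -> S}) (g : {rmorphism S -> R}) :
  cancel f g -> cancel g f -> factorial_ring R -> factorial_ring S.
Proof.
move=> fK gK facR x /eqP x0.
have /eqP/facR[u [s [[v uv] ps Dx]]] : g x != 0.
  by apply: contraNneq x0 => gx0; rewrite -(gK x) gx0 rmorph0.
exists (f u), [seq f p | p <- s]; split.
- by exists (f v); rewrite -rmorphM -uv rmorph1.
- by move=> _ /mapP[p /ps pp ->]; apply: prime_elt_iso pp.
by rewrite big_map -rmorph_prod -rmorphM -Dx gK.
Qed.

Lemma muni_X_max n (R : comNzRingType) : muni ('X_ord_max : {mpoly R[n.+1]}) = 'X.
Proof.
rewrite muniE msuppX big_seq1 mcoeffX eqxx scale1r mnm1E eqxx.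
rewrite (_ : [multinom _ | i < n] = 0%MM) ?mpolyX0 ?scale1r //.
apply/mnmP=> i; rewrite mnmE mnm1E mnm0E.
by case: eqP => // /(congr1 val) /= /eqP; rewrite gtn_eqF.
Qed.

Lemma muni_X_widen n (R : comNzRingType) (i : 'I_n) :
  muni ('X_(widen_ord (leqnSn n) i) : {mpoly R[n.+1]}) = ('X_i)%:P.
Proof.
rewrite muniE msuppX big_seq1 mcoeffX eqxx scale1r mnm1E.
rewrite -val_eqE /= (ltn_eqF (ltn_ord i)) expr0 -mul_polyC mulr1.
congr ('X_[_])%:P; apply/mnmP=> j; rewrite mnmE !mnm1E -!val_eqE /=.
by [].
Qed.

Section Uni.
Variables (n : nat) (R : comNzRingType).

(** The inverse of [muni]; the pair carries factoriality from [{poly {mpoly R[n]}}] to one more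
    variable. *)
Definition multi (p : {poly {mpoly R[n]}}) : {mpoly R[n.+1]} :=
  (map_poly (@mwiden n R) p).['X_ord_max].

Lemma multi_is_zmod_morphism : zmod_morphism multi.
Proof. by move=> p q; rewrite /multi rmorphB hornerD hornerN. Qed.
Lemma multi_is_monoid_morphism : monoid_morphism multi.
Proof.
split=> [|p q]; first by rewrite /multi rmorph1 hornerC.
by rewrite /multi rmorphM hornerM.
Qed.
HB.instance Definition _ := GRing.isZmodMorphism.Build _ _ multi multi_is_zmod_morphism.
HB.instance Definition _ := GRing.isMonoidMorphism.Build _ _ multi multi_is_monoid_morphism.

Lemma mwiden_XU (i : 'I_n) : mwiden ('X_i : {mpoly R[n]}) = 'X_(widen_ord (leqnSn n) i).
Proof. by rewrite mwidenX mnmwiden1. Qed.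

Lemma muniK : cancel (@muni n R) multi.
Proof.
move=> p.
have := @mpoly_rmorph_ext n.+1 R _ (multi \o @muni n R) idfun _ _ p; apply.
  by move=> c /=; rewrite muniC /multi map_polyC hornerC /= mwidenC.
move=> i /=; case: (unliftP ord_max i) => [j ->|->].
  have -> : lift ord_max j = widen_ord (leqnSn n) j.
    by apply/val_inj; rewrite /= /bump leqNgt ltn_ord.
  by rewrite muni_X_widen /multi map_polyC hornerC /= mwiden_XU.
by rewrite muni_X_max /multi map_polyX hornerX.
Qed.

Lemma multiK : cancel multi (@muni n R).
Proof.
have muw c : muni (mwiden c) = c%:P :> {poly {mpoly R[n]}}.
  have := @mpoly_rmorph_ext n R _ (@muni n R \o @mwiden n R) polyC _ _ c; apply.
    by move=> a /=; rewrite mwidenC muniC.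
  by move=> i /=; rewrite mwiden_XU muni_X_widen.
elim/poly_ind => [|p c IH]; first by rewrite !rmorph0.
have -> : multi (p * 'X + c%:P) = multi p * 'X_ord_max + mwiden c.
  by rewrite /multi rmorphD rmorphM /= map_polyX map_polyC hornerD hornerMX hornerC.
by rewrite rmorphD rmorphM /= IH muni_X_max muw.
Qed.

End Uni.

Lemma factorial_mpoly n (R : idomainType) :
  factorial_ring R -> factorial_ring {mpoly R[n]}.
Proof.
move=> facR; elim: n => [|n IH].
  apply: (@factorial_iso _ _ (@mpolyC 0 R) (mcoeff 0%MM)) => // [c|p] /=.
    by rewrite mcoeffC eqxx mulr1.
  by rewrite [RHS]nvar0_mpolyC.
apply: (@factorial_iso _ _ (@multi n R) (@muni n R)).
- exact: multiK.
- exact: muniK.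
exact: factorial_poly.
Qed.

Lemma factorial_int : factorial_ring int.
Proof.
move=> x; move: {2}(absz x) (leqnn (absz x)) => n.
elim: n x => [|n IH] x le /eqP x0; first by move: le; rewrite leqn0 absz_eq0 (negPf x0).
have [x1|x1] := eqVneq `|x|%N 1%N.
  exists x, [::]; split=> //; last by rewrite big_nil mulr1.
  by exists x; move: (x) x1; case=> [[|[|k]]|[|k]].
have px : prime (pdiv `|x|) by apply: pdiv_prime; rewrite ltn_neqAle eq_sym x1 absz_gt0.
have pz : prime_elt (pdiv `|x| : int).
  split.
  - by case: (pdiv _) px.
  - move=> [c /(congr1 absz)]; rewrite abszM /= => /esym/eqP.
    by rewrite muln_eq1 => /andP[_ /eqP p1]; rewrite p1 in px.
  move=> a b [c Dc]; have : (pdiv `|x| %| `|(a * b)%R|)%N by rewrite Dc abszM /= dvdn_mull.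
  rewrite abszM Euclid_dvdM // => /orP[d|d].
    by have /dvdzP[q ->] : a \in dvdz (pdiv `|x|)%:Z by []; left; exists q.
  by have /dvdzP[q ->] : b \in dvdz (pdiv `|x|)%:Z by []; right; exists q.
have /dvdzP[y Dy] : x \in dvdz (pdiv `|x|)%:Z by rewrite dvdzE pdiv_dvd.
have y0 : y <> 0 by move=> y0; rewrite Dy y0 mul0r eqxx in x0.
have [|u [s [u1 ps Dys]]] := IH y _ y0.
  rewrite -ltnS (leq_trans _ le) // Dy abszM ltn_Pmulr ?prime_gt1 //.
  by rewrite absz_gt0; apply/eqP.
exists u, ((pdiv `|x|)%:Z :: s); split=> //.
  by move=> p; rewrite inE => /orP[/eqP->|/ps].
by rewrite big_cons {1}Dy Dys mulrCA mulrC.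
Qed.

Lemma clear_denominators m (p : {mpoly rat[m]}) : exists (k : int) (q : {mpoly int[m]}),
  k != 0 /\ k%:~R *: p = map_mpoly intr q.
Proof.
elim/mpolyind: p => [|c mm p _ _ [k [q [k0 Dq]]]].
  by exists 1, 0; rewrite scaler0 rmorph0.
exists (denq c * k), ((numq c * k) *: 'X_[mm] + denq c *: q).
rewrite mulf_neq0 ?denq_neq0 //; split=> //.
rewrite rmorphD /= !map_mpolyZ /= -Dq map_mpolyX scalerDr !scalerA.
rewrite !rmorphM /=; congr (_ *: _ + _).
by rewrite mulrAC [_ * c]mulrC -numqE.
Qed.

Lemma map_mpoly_inj n (R S : nzRingType) (f : {rmorphism R -> S}) :
  injective f -> injective (@map_mpoly n R S f).
Proof.
move=> fI p q E; apply/mpolyP=> m; apply: fI.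
by rewrite -!mcoeff_map_mpoly E.
Qed.

Lemma map_mpoly_meval n (R S : comNzRingType) (f : {rmorphism R -> S}) (v : 'I_n -> R) p :
  (map_mpoly f p).@[fun i => f (v i)] = f p.@[v].
Proof.
have := @mpoly_rmorph_ext n R S (meval (fun i => f (v i)) \o map_mpoly f) (f \o meval v) _ _ p.
apply=> [c|i] /=; first by rewrite map_mpolyC !mevalC.
by rewrite map_mpolyX !mevalXU.
Qed.

Lemma homog_meval0 n (R : comNzRingType) d (p : {mpoly R[n]}) : (0 < d)%N ->
  p \is d.-homog -> p.@[fun _ => 0] = 0.
Proof.
move=> d0 /dhomogP hp; rewrite mevalE big_seq big1 // => m /hp /=.
rewrite mdegE => Dm; have /existsP[i mi] : [exists i, m i != 0%N].
  apply: contraLR d0; rewrite negb_exists => /forallP m0.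
  by rewrite -Dm big1 // => i _; apply/eqP; rewrite -[_ == _]negbK m0.
by rewrite (bigD1 i) //= expr0n (negPf mi) mul0r mulr0.
Qed.

(** Factoriality provides a prime factor and irreducibility makes its cofactor a unit. That [f] is
    not a unit itself is seen at the origin, where a homogeneous polynomial of positive degree
    vanishes. *)
Lemma mirreducible_prime m (f : {mpoly int[m]}) d : (0 < d)%N -> f \is d.-homog ->
  mirreducible f -> prime_elt f.
Proof.
move=> d0 hf [/eqP f0 [_ [_ irr]]].
have [u [s [[v Dv] ps Df]]] := factorial_mpoly factorial_int (elimN eqP f0).
case: s ps Df => [|p s] ps Df.
  rewrite big_nil mulr1 in Df; move: Dv; rewrite -Df => /(congr1 (meval (fun _ => 0))).
  by rewrite mevalM (homog_meval0 d0 hf) mulr0 meval1 => /eqP; rewrite oner_eq0.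
have pp : prime_elt p by apply: ps; rewrite inE eqxx.
have prN q : prime_elt q -> prime_elt (- q).
  case=> q0 q1 qM; split.
  - by move/eqP; rewrite oppr_eq0 => /eqP.
  - by move=> [c Dc]; apply: q1; exists (- c); rewrite mulNr -mulrN.
  move=> a b [c Dc]; have [|[e ->]|[e ->]] := qM a b.
  - by exists (- c); rewrite Dc mulNr -mulrN.
  - by left; exists (- e); rewrite mulrNN.
  by right; exists (- e); rewrite mulrNN.
have {}Df : f = p * (u * \prod_(q <- s) q) by rewrite Df big_cons mulrCA.
case: (irr _ _ Df) => [p1|[p1|[q1|q1]]].
- by case: pp => _ []; exists 1; rewrite p1 mulr1.
- by case: pp => _ []; exists (-1); rewrite p1 mulrNN mulr1.
- by rewrite Df q1 mulr1.
by rewrite Df q1 mulrN1; apply: prN.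
Qed.

Lemma prime_elt_rat m (f : {mpoly int[m]}) d : (0 < d)%N -> f \is d.-homog ->
  prime_elt f -> prime_elt (map_mpoly intr f : {mpoly rat[m]}).
Proof.
move=> d0 hf [f0 f1 fM].
have inj := map_mpoly_inj (n := m) (f := intr : {rmorphism int -> rat}) (@intr_inj rat).
have f00 : (map_mpoly intr f).@[fun _ => 0 : rat] = 0.
  have -> : 0 = 0%:~R :> rat by [].
  by rewrite (map_mpoly_meval intr (fun=> 0)) (homog_meval0 d0 hf).
(* Clearing denominators will put a nonzero constant in front of the product; [f] cannot divide it
   because [f] vanishes at the origin. *)
have nk (k : rat) : k != 0 -> ~ rdvd (map_mpoly intr f : {mpoly rat[m]}) k%:MP.
  move=> k0 [c /(congr1 (meval (fun _ => 0)))].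
  by rewrite mevalC mevalM f00 mulr0 => /eqP; rewrite (negPf k0).
split.
- by move/eqP; rewrite -(rmorph0 (map_mpoly (n:=m) (intr : int -> rat))) => /eqP/inj.
- by move=> h; apply: (nk 1); rewrite ?oner_neq0.
move=> a b [c Dc].
have [ka [a' [ka0 Da]]] := clear_denominators a.
have [kb [b' [kb0 Db]]] := clear_denominators b.
have [kc [c' [kc0 Dcc]]] := clear_denominators c.
have Zk (k : int) (p : {mpoly rat[m]}) : k != 0 ->
    rdvd (map_mpoly intr f) (k%:~R *: p) -> rdvd (map_mpoly intr f) p.
  move=> k0 [q Dq]; exists (k%:~R^-1 *: q).
  by rewrite -scalerAl -Dq scalerA mulVf ?scale1r // intr_eq0.
have dl (p : {mpoly int[m]}) : rdvd f p -> rdvd (map_mpoly intr f : {mpoly rat[m]}) (map_mpoly intr p).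
  by move=> [q ->]; exists (map_mpoly intr q); rewrite rmorphM.
have E : kc%:MP * (a' * b') = (ka * kb)%:MP * c' * f.
  apply: inj; rewrite !rmorphM /= !map_mpolyC -Da -Db -Dcc !mul_mpolyC.
  rewrite /= -!mul_mpolyC.
  transitivity ((kc%:~R)%:MP * (ka%:~R)%:MP * (kb%:~R)%:MP * (a * b)); first by ring.
  by rewrite Dc; ring.
case: (fM kc%:MP (a' * b')) => [|/dl|/fM[/dl|/dl]].
- by eexists; apply: E.
- by rewrite map_mpolyC => /nk []; rewrite intr_eq0.
- by rewrite -Da => /(Zk _ _ ka0); left.
by rewrite -Db => /(Zk _ _ kb0); right.
Qed.

(** * Branches of roots at infinity *)

Definition ev (P : nat -> Prop) := exists N0, forall N, (N0 <= N)%N -> P N.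

Lemma ev_and P Q : ev P -> ev Q -> ev (fun N => P N /\ Q N).
Proof.
move=> [N1 h1] [N2 h2]; exists (maxn N1 N2) => N.
by rewrite geq_max => /andP[/h1 ? /h2 ?].
Qed.

Lemma ev_mono (P Q : nat -> Prop) : (forall N, P N -> Q N) -> ev P -> ev Q.
Proof. by move=> PQ [N0 h]; exists N0 => N /h/PQ. Qed.

Lemma ev_fin (I : finType) (P : I -> nat -> Prop) :
  (forall i, ev (P i)) -> ev (fun N => forall i, P i N).
Proof.
move=> evP; suff [N0 h] : ev (fun N => forall i, i \in enum I -> P i N).
  by exists N0 => N /h hN i; apply: hN; rewrite mem_enum.
elim: (enum I) => [|i s [N1 h1]]; first by exists 0%N.
have [N2 h2] := evP i; exists (maxn N1 N2) => N.
by rewrite geq_max => /andP[/h1 hs /h2 hi] j; rewrite inE => /orP[/eqP->|/hs].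
Qed.

Lemma ev_geq K : ev (fun N => (K <= N)%N).
Proof. by exists K. Qed.

(* [g N] is a big O of [N^-k]. *)
Definition bigO (k : nat) (g : nat -> algC) :=
  exists C, ev (fun N => `|g N| * N%:R ^+ k <= C).

Lemma bigO_eq k g h : ev (fun N => g N = h N) -> bigO k g -> bigO k h.
Proof.
move=> gh [C hC]; exists C; apply: ev_mono (ev_and gh hC) => N [<-] //.
Qed.

Lemma bigOD k g h : bigO k g -> bigO k h -> bigO k (fun N => g N + h N).
Proof.
move=> [C hC] [E hE]; exists (C + E); apply: ev_mono (ev_and hC hE) => N [le1 le2].
apply: le_trans (lerD le1 le2); rewrite -mulrDl ler_wpM2r ?exprn_ge0 //.
exact: ler_normD.
Qed.

Lemma bigOM k l g h : bigO k g -> bigO l h -> bigO (k + l) (fun N => g N * h N).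
Proof.
move=> [C hC] [E hE]; exists (C * E); apply: ev_mono (ev_and hC hE) => N [le1 le2].
by rewrite normrM exprD mulrACA ler_pM ?mulr_ge0 ?exprn_ge0.
Qed.

Lemma bigO_le k l g : (l <= k)%N -> bigO k g -> bigO l g.
Proof.
move=> lk [C hC]; exists C; apply: ev_mono (ev_and (ev_geq 1) hC) => N [N1 le].
by apply: le_trans le; rewrite ler_wpM2l // ler_weXn2l // ler1n.
Qed.

Lemma bigO_cst c : bigO 0 (fun=> c).
Proof. by exists `|c|; exists 0%N => N _; rewrite expr0 mulr1. Qed.

Lemma bigO0 k : bigO k (fun=> 0).
Proof. by exists 0; exists 0%N => N _; rewrite normr0 mul0r. Qed.

Lemma bigOM0 k g h : bigO k g -> bigO 0 h -> bigO k (fun N => g N * h N).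
Proof. by move=> hg hh; rewrite -[k]addn0; apply: bigOM. Qed.

Lemma bigOZ k c g : bigO k g -> bigO k (fun N => c * g N).
Proof. by move=> hg; rewrite -[k]add0n; apply: bigOM => //; apply: bigO_cst. Qed.

Lemma bigON k g : bigO k g -> bigO k (fun N => - g N).
Proof. by move=> /(bigOZ (-1)); apply: bigO_eq; exists 0%N => N _; rewrite mulN1r. Qed.

Lemma bigOB k g h : bigO k g -> bigO k h -> bigO k (fun N => g N - h N).
Proof. by move=> hg hh; apply: bigOD => //; apply: bigON. Qed.

Lemma bigO_sum (I : Type) (s : seq I) k (g : I -> nat -> algC) :
  (forall i, bigO k (g i)) -> bigO k (fun N => \sum_(i <- s) g i N).
Proof.
move=> hg; elim: s => [|i s IH].
  by apply: bigO_eq (bigO0 k); exists 0%N => N _; rewrite big_nil.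
apply: bigO_eq (bigOD (hg i) IH); exists 0%N => N _; by rewrite big_cons.
Qed.

Lemma bigO_invn k : bigO k (fun N => N%:R ^- k).
Proof.
exists 1; apply: ev_mono (ev_geq 1) => N N1.
by rewrite ger0_norm ?invr_ge0 ?exprn_ge0 // mulVf // expf_neq0 // pnatr_eq0 -lt0n.
Qed.

Lemma bigO_inv : bigO 1 (fun N => N%:R ^-1).
Proof. exact: bigO_invn 1. Qed.

Lemma bigO_expM j k g : bigO (k + j) g -> bigO k (fun N => N%:R ^+ j * g N).
Proof.
move=> [C hC]; exists C; apply: ev_mono hC => N.
by rewrite normrM ger0_norm ?exprn_ge0 // addnC exprD; apply: etrans; congr (_ <= _); ring.
Qed.

Lemma bigO_scale k g x : (0 < x)%N -> bigO k g -> bigO k (fun N => g (x * N)%N).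
Proof.
move=> x0 [C [N0 hC]]; exists C; exists N0 => N le.
have le1 : (N <= x * N)%N by rewrite leq_pmull.
apply: le_trans (hC (x * N)%N (leq_trans le le1)).
by rewrite ler_wpM2l // lerXn2r ?nnegrE // ler_nat.
Qed.

Lemma bigO_small g (e : algC) : 0 < e -> bigO 1 g -> ev (fun N => `|g N| < e).
Proof.
move=> e0 [C hC].
have [N1 hN1] : exists N1 : nat, `|C| / e < N1%:R.
  by exists (Num.bound (`|C| / e)); apply: archi_boundP; rewrite divr_ge0 // ltW.
apply: ev_mono (ev_and (ev_geq N1.+1) hC) => N [le]; rewrite expr1 => hN.
have N0 : 0 < N%:R :> algC by rewrite ltr0n (leq_trans _ le).
have C0 : `|C| = C by rewrite ger0_norm // (le_trans _ hN) // mulr_ge0.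
rewrite -(ltr_pM2r N0); apply: le_lt_trans hN _.
rewrite -{1}C0 mulrC -ltr_pdivrMr //; apply: lt_le_trans hN1 _.
by rewrite ler_nat ltnW.
Qed.

Lemma bigO_neq0 g c : c != 0 -> bigO 1 (fun N => g N - c) -> ev (fun N => g N != 0).
Proof.
move=> c0 /bigO_small-/(_ `|c|); rewrite normr_gt0 => /(_ c0).
apply: ev_mono => N; apply: contraTneq => ->.
by rewrite sub0r normrN ltxx.
Qed.

Lemma bigO_poly (p : {poly algC}) : bigO 0 (fun N => p.[N%:R^-1]).
Proof.
elim/poly_ind: p => [|p c IH].
  by apply: bigO_eq (bigO0 0); exists 0%N => N _; rewrite horner0.
apply: bigO_eq (bigOD (bigOM IH (bigO_le (leq0n 1) bigO_inv)) (bigO_cst c)).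
by exists 0%N => N _; rewrite hornerMXaddC.
Qed.

Lemma bigO_poly_low k (p : {poly algC}) : (forall j, (j < k)%N -> p`_j = 0) ->
  bigO k (fun N => p.[N%:R^-1]).
Proof.
move=> pk; have -> : p = drop_poly k p * 'X^k.
  rewrite -[LHS](poly_take_drop k) [take_poly k p](_ : _ = 0) ?add0r //.
  by apply/polyP=> j; rewrite coef_take_poly coef0; case: ifP => // /pk.
apply: bigO_eq (bigOM (bigO_poly (drop_poly k p)) (bigO_invn k)).
by exists 0%N => N _; rewrite hornerM hornerXn exprVn.
Qed.

Lemma bigO_poly0 (p : {poly algC}) : bigO 1 (fun N => p.[N%:R^-1] - p`_0).
Proof.
apply: bigO_eq (bigO_poly_low (k := 1) (p := p - (p`_0)%:P) _).
  by exists 0%N => N _; rewrite hornerD hornerN hornerC.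
by case=> // _; rewrite coefB coefC subrr.
Qed.

Definition eval_inv (N : nat) (Phi : {poly {poly algC}}) : {poly algC} :=
  map_poly (horner_eval (N%:R^-1)) Phi.

Lemma eval_inv_MXaddC N Phi c :
  eval_inv N (Phi * 'X + c%:P) = eval_inv N Phi * 'X + (c.[N%:R^-1])%:P.
Proof. by rewrite /eval_inv rmorphD rmorphM /= map_polyX map_polyC. Qed.

Lemma bigO_eval0 Phi g : bigO 0 g -> bigO 0 (fun N => (eval_inv N Phi).[g N]).
Proof.
move=> hg; elim/poly_ind: Phi => [|Phi c IH].
  by apply: bigO_eq (bigO0 0); exists 0%N => N _; rewrite /eval_inv rmorph0 horner0.
apply: bigO_eq (bigOD (bigOM IH hg) (bigO_poly c)).
by exists 0%N => N _; rewrite eval_inv_MXaddC hornerMXaddC.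
Qed.

Lemma bigO_eval k Phi g h : bigO 0 g -> bigO 0 h -> bigO k (fun N => g N - h N) ->
  bigO k (fun N => (eval_inv N Phi).[g N] - (eval_inv N Phi).[h N]).
Proof.
move=> hg hh hgh; elim/poly_ind: Phi => [|Phi c IH].
  by apply: bigO_eq (bigO0 k); exists 0%N => N _; rewrite /eval_inv rmorph0 !horner0 subrr.
apply: bigO_eq (bigOD (bigOM0 IH hg) (bigOM0 hgh (bigO_eval0 Phi hh))).
by exists 0%N => N _; rewrite eval_inv_MXaddC !hornerMXaddC; ring.
Qed.

Lemma eval_inv_horner N Phi (y : {poly algC}) :
  (eval_inv N Phi).[y.[N%:R^-1]] = (Phi.[y]).[N%:R^-1].
Proof. by rewrite /eval_inv -[y.[_]]/(horner_eval _ y) horner_map. Qed.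

Lemma bigO_eval_cst Phi a g : bigO 1 (fun N => g N - a) ->
  bigO 1 (fun N => (eval_inv N Phi).[g N] - (map_poly (coefp 0) Phi).[a]).
Proof.
move=> hg.
have hg0 : bigO 0 g.
  apply: bigO_eq (bigOD (bigO_le (leq0n 1) hg) (bigO_cst a)).
  by exists 0%N => N _; rewrite subrK.
apply: bigO_eq (bigOD (bigO_eval Phi hg0 (bigO_cst a) hg) (bigO_poly0 (Phi.[a%:P]))).
exists 0%N => N _; rewrite -eval_inv_horner hornerC.
rewrite (_ : (Phi.[a%:P])`_0 = (map_poly (coefp 0) Phi).[a]); first by ring.
by rewrite -horner_coef0 -[_.[0]]/(horner_eval 0 _) -horner_map /= /horner_eval hornerC;
   congr _.[_]; apply: eq_map_poly => q; rewrite /= /horner_eval horner_coef0.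
Qed.

(** For the root closest to [x], every factor of the product is at least the distance to that
    root. *)
Lemma exists_close_root (r : seq algC) x : (0 < size r)%N ->
  exists2 y, y \in r & `|x - y| ^+ size r <= `|(\prod_(z <- r) ('X - z%:P)).[x]|.
Proof.
move=> r0.
have [y yr ymin] : exists2 y, y \in r & forall z, z \in r -> `|x - y| <= `|x - z|.
  elim: r r0 => // y [|z r] IH _; first by exists y; rewrite ?inE // => z; rewrite inE => /eqP->.
  have [w wr wmin] := IH isT.
  have [le|lt] := real_leP (normr_real (x - y)) (normr_real (x - w)).
    exists y; rewrite ?inE ?eqxx // => t; rewrite inE => /orP[/eqP->//|/wmin].
    exact: le_trans.
  exists w; first by rewrite inE wr orbT.
  move=> t; rewrite inE => /orP[/eqP->|/wmin //]; exact: ltW.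
exists y => //.
elim: (r) ymin => [|z s IH] smin; first by rewrite big_nil hornerC normr1.
rewrite big_cons hornerM normrM hornerXsubC exprS ler_pM ?exprn_ge0 //.
  by apply: smin; rewrite inE eqxx.
by apply: IH => t ts; apply: smin; rewrite inE ts orbT.
Qed.

Section RootBranches.

Variables (n M : nat) (Phi : {poly {poly algC}}).
Variables (a : 'I_n -> algC) (x : 'I_n -> {poly algC}).
Hypotheses (n_gt0 : (0 < n)%N) (M_gt0 : (0 < M)%N).
Hypotheses (Phi_monic : Phi \is monic) (Phi_size : size Phi = n.+1).
Hypotheses (a_inj : injective a) (xa : forall i, (x i)`_0 = a i).
Hypothesis xM : forall i j, (j < n * M)%N -> (Phi.[x i])`_j = 0.

Lemma eval_inv_monic N : eval_inv N Phi \is monic.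
Proof. by rewrite /eval_inv monic_map. Qed.

Lemma size_eval_inv N : size (eval_inv N Phi) = n.+1.
Proof.
rewrite /eval_inv size_map_poly_id0 //.
by rewrite (monicP Phi_monic) rmorph1 oner_eq0.
Qed.

(** The value of [Phi] at [x i] is [O(N^-(n M))] and bounds the [n]-th power of the distance to the
    closest root; this is why the series must be correct to order [n * M] for precision [M]. *)
Lemma root_branches : exists rho : nat -> 'I_n -> algC,
  [/\ forall i, bigO M (fun N => rho N i - (x i).[N%:R^-1]),
      forall i, bigO 1 (fun N => rho N i - a i) &
      ev (fun N => injective (rho N) /\ eval_inv N Phi = \prod_i ('X - (rho N i)%:P))].
Proof.
pose near N i y := `|(x i).[N%:R^-1] - y| ^+ n <= `|(eval_inv N Phi).[(x i).[N%:R^-1]]|.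
have /all_sig2[rt Drt srt] N : {r : seq algC | eval_inv N Phi = \prod_(z <- r) ('X - z%:P) & size r = n}.
  have [r Dr] := closed_field_poly_normal (eval_inv N Phi).
  rewrite (monicP (eval_inv_monic N)) scale1r in Dr; exists r => //.
  by apply: succn_inj; rewrite -(size_eval_inv N) Dr size_prod_XsubC.
pose rho N i := nth 0 (rt N) (find (near N i) (rt N)).
have rhoP N i : rho N i \in rt N /\ near N i (rho N i).
  have : has (near N i) (rt N).
    apply/hasP; have [|y yr hy] := @exists_close_root (rt N) (x i).[N%:R^-1].
      by rewrite srt.
    by exists y => //; rewrite /near Drt -[n in _ ^+ n](srt N).
  by move=> hs; split; [rewrite mem_nth // -has_find|apply: nth_find].
have rhoM i : bigO M (fun N => rho N i - (x i).[N%:R^-1]).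
  have [C hC] := bigO_poly_low (xM i).
  (* Extracting the [n]-th root of the bound [C] uses [C <= 1 + C <= (1 + C)^n]. *)
  exists (1 + C); apply: ev_mono hC => N; rewrite -eval_inv_horner => hC.
  have [_ hn] := rhoP N i.
  have C0 : 0 <= C by rewrite (le_trans _ hC) // mulr_ge0 ?exprn_ge0.
  rewrite -(@ler_pXn2r _ n) ?nnegrE ?mulr_ge0 ?exprn_ge0 ?addr_ge0 //.
  rewrite exprMn -exprM mulnC distrC.
  apply: (@le_trans _ _ C).
    by apply: le_trans hC; rewrite ler_wpM2r ?exprn_ge0.
  apply: (@le_trans _ _ (1 + C)); first by rewrite lerDr.
  by rewrite ler_eXnr // lerDl.
have rhoa i : bigO 1 (fun N => rho N i - a i).
  rewrite -xa; apply: bigO_eq (bigOD (bigO_le M_gt0 (rhoM i)) (bigO_poly0 (x i))).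
  by exists 0%N => N _; ring.
exists rho; split=> //.
(* Distinct limits keep the branches apart for large [N], so these [n] roots are all the roots. *)
have : ev (fun N => forall ij : 'I_n * 'I_n, ij.1 != ij.2 -> rho N ij.1 != rho N ij.2).
  apply: ev_fin => -[i j] /=; have [_|neq] := eqVneq i j; first by exists 0%N.
  have aij : a i - a j != 0 by rewrite subr_eq0 (inj_eq a_inj).
  have : bigO 1 (fun N => (rho N i - rho N j) - (a i - a j)).
    by apply: bigO_eq (bigOB (rhoa i) (rhoa j)); exists 0%N => N _; ring.
  by move/(bigO_neq0 aij); apply: ev_mono => N; rewrite subr_eq0.
apply: ev_mono => N hN.
have inj : injective (rho N).
  by move=> i j /eqP; apply: contraTeq => ne; apply: (hN (i, j)).
split=> //; rewrite [LHS](Drt N).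
have -> : \prod_i ('X - (rho N i)%:P) = \prod_(z <- [seq rho N i | i <- enum 'I_n]) ('X - z%:P).
  by rewrite big_map big_enum.
apply: perm_big; rewrite perm_sym.
have sub : {subset [seq rho N i | i <- enum 'I_n] <= rt N}.
  by move=> _ /mapP[i _ ->]; case: (rhoP N i).
have u : uniq [seq rho N i | i <- enum 'I_n] by rewrite map_inj_uniq ?enum_uniq.
have le : (size (rt N) <= size [seq rho N i | i <- enum 'I_n])%N.
  by rewrite srt size_map size_enum_ord.
have [_ eqi] := uniq_min_size u sub le.
by apply: uniq_perm => //; apply: leq_size_uniq u sub le.
Qed.

End RootBranches.

(** * Divided differences *)

Lemma size_prod_XsubC_in (R : comNzRingType) (I : finType) (A : {pred I}) (F : I -> R) :
  size (\prod_(i in A) ('X - (F i)%:P)) = #|A|.+1.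
Proof. by rewrite -(big_enum _ _ A) /= size_prod_XsubC -cardE. Qed.

Lemma monic_prod_XsubC_in (R : comNzRingType) (I : finType) (A : {pred I}) (F : I -> R) :
  \prod_(i in A) ('X - (F i)%:P) \is monic.
Proof. by rewrite -(big_enum _ _ A) /= monic_prod_XsubC. Qed.

Definition lagrange m (x y : 'I_m -> algC) : {poly algC} :=
  \sum_k (y k / \prod_(l in predC1 k) (x k - x l)) *: \prod_(l in predC1 k) ('X - (x l)%:P).

Lemma size_lagrange m (x y : 'I_m -> algC) : (size (lagrange x y) <= m)%N.
Proof.
apply: (leq_trans (size_sum _ _ _)); apply/bigmax_leqP => k _.
rewrite (leq_trans (size_scale_leq _ _)) // size_prod_XsubC_in cardC1 card_ord.
by case: (m) k => [[]|].
Qed.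

Lemma horner_lagrange m (x y : 'I_m -> algC) k : injective x -> (lagrange x y).[x k] = y k.
Proof.
move=> x_inj; rewrite horner_sum (bigD1 k) //= [X in _ + X]big1 ?addr0 => [|l lk]; last first.
  rewrite hornerZ horner_prod [X in _ * X](bigD1 k) /=; last by rewrite inE eq_sym.
  by rewrite hornerXsubC subrr mul0r mulr0.
rewrite hornerZ horner_prod [X in _ * X](eq_bigr (fun l => x k - x l)) => [|l _]; last first.
  by rewrite hornerXsubC.
rewrite divfK //; apply/prodf_neq0 => l; rewrite inE => lk.
by rewrite subr_eq0 (inj_eq x_inj) eq_sym.
Qed.

Lemma lagrangeE m (x : 'I_m -> algC) (p : {poly algC}) : injective x -> (size p <= m)%N ->
  p = lagrange x (fun k => p.[x k]).
Proof.
move=> x_inj sp; apply/eqP; rewrite -subr_eq0; apply/eqP.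
apply: (@roots_geq_poly_eq0 _ _ [seq x k | k <- enum 'I_m]).
- by apply/allP => _ /mapP[j _ ->]; rewrite rootE hornerD hornerN horner_lagrange // subrr.
- by rewrite map_inj_uniq ?enum_uniq.
by rewrite size_map size_enum_ord (leq_trans (size_polyD _ _)) // geq_max sp size_polyN size_lagrange.
Qed.

(** The weights are those of the [m]-th divided difference, multiplied by [D] to become integers.
    They extract the top coefficient of the interpolant, which is 0 for [t^l] with [l < m]. On [1/t]
    the value is nonzero, as evaluating the interpolant of the constant 1 at 0 shows. *)
Lemma divided_difference m (x : 'I_m.+1 -> nat) : injective x -> (forall k, (0 < x k)%N) ->
  exists c : 'I_m.+1 -> int,
    (forall l, (l < m)%N -> \sum_k (c k)%:~R * (x k)%:R ^+ l = 0 :> algC) /\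
    \sum_k (c k)%:~R / (x k)%:R != 0 :> algC.
Proof.
move=> x_inj x_gt0; pose y k := (x k)%:R : algC.
have y_inj : injective y by move=> i j /eqP; rewrite eqr_nat => /eqP/x_inj.
pose wz k : int := \prod_(l in predC1 k) ((x k)%:Z - (x l)%:Z).
pose w k : algC := \prod_(l in predC1 k) (y k - y l).
have wE k : w k = (wz k)%:~R.
  by rewrite rmorph_prod; apply: eq_bigr => l _; rewrite rmorphB.
have w0 k : w k != 0.
  by apply/prodf_neq0 => l lj; rewrite subr_eq0 (inj_eq y_inj) eq_sym.
pose c k : int := \prod_(j in predC1 k) wz j; pose D := \prod_j w j.
have D0 : D != 0 by apply/prodf_neq0.
have cE k : (c k)%:~R = D / w k.
  rewrite /D (bigD1 k) //= mulrC mulKf // rmorph_prod; apply: eq_big => [j|j _] //=.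
have lag (p : {poly algC}) := @lagrangeE m.+1 y p y_inj.
exists c; split=> [l lm|].
  have := congr1 (coefp m) (lag 'X^l _); rewrite size_polyXn => /(_ (ltnW _))-/(_ lm) /=.
  rewrite /lagrange coefXn gtn_eqF // coef_sum => /(congr1 ( *%R D)); rewrite mulr0 => /esym; apply: etrans.
  rewrite mulr_sumr; apply: eq_bigr => k _; rewrite cE coefZ hornerXn.
  have := monic_prod_XsubC_in (predC1 k) y; rewrite monicE lead_coefE.
  by rewrite size_prod_XsubC_in cardC1 card_ord /= => /eqP ->; rewrite mulr1 -/(w k) -/(y k); ring.
have := congr1 (horner_eval 0) (lag 1 _); rewrite size_poly1 => /(_ isT).
rewrite /horner_eval /lagrange hornerC horner_sum => E.
have {}E : 1 = \sum_k (w k)^-1 * \prod_(l in predC1 k) - y l.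
  rewrite {1}E; apply: eq_bigr => k _; rewrite hornerC mul1r hornerZ horner_prod.
  by congr (_ * _); apply: eq_bigr => l _; rewrite hornerXsubC sub0r.
apply: contra_eq_neq E => S0.
have -> : \sum_k (w k)^-1 * (\prod_(l in predC1 k) - y l) =
   (\prod_l - y l) * - D^-1 * \sum_k (c k)%:~R / (x k)%:R.
  rewrite mulr_sumr; apply: eq_bigr => k _.
  have -> : \prod_l - y l = - y k * \prod_(l in predC1 k) - y l by rewrite (bigD1 k).
  have yk : y k != 0 by rewrite pnatr_eq0 -lt0n.
  rewrite cE -/(y k); move: (\prod_(l in _) - y l) => z.
  by field; rewrite yk w0 D0.
by rewrite S0 mulr0 oner_neq0.
Qed.

(** After multiplication by [N^j] the terms of index at least [j + 2] are [O(N^-2)], and [j.+2 <= M]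
    makes the error of the expansion equally small. *)
Lemma bigO_asymp j M v (p : {poly algC}) : (j.+2 <= M)%N ->
  bigO M (fun N => v N - p.[N%:R^-1]) ->
  bigO 2 (fun N => N%:R ^+ j * v N -
    (\sum_(i < j.+1) p`_i * N%:R ^+ (j - i) + p`_j.+1 / N%:R)).
Proof.
move=> jM /(bigO_le jM) hv; have {}hv := bigO_expM (k := 2) (j := j) hv.
have hq : bigO 2 (fun N => N%:R ^- 2 * (drop_poly j.+2 p).[N%:R^-1]).
  by apply: bigOM0; [apply: bigO_invn|apply: bigO_poly].
apply: bigO_eq (bigOD hv hq); apply: ev_mono (ev_geq 1) => N N1.
have N0 : N%:R != 0 :> algC by rewrite pnatr_eq0 -lt0n.
rewrite mulrBr -addrA; congr (_ + _).
rewrite -{1}(poly_take_drop j.+2 p) hornerD hornerM hornerXn mulrDr opprD -addrA.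
rewrite [X in _ + X](_ : _ = 0) ?addr0; last first.
  rewrite (_ : N%:R ^+ j * (_ * N%:R^-1 ^+ j.+2) = N%:R ^- 2 * (drop_poly j.+2 p).[N%:R^-1]).
    by rewrite addNr.
  by rewrite !exprS exprVn; field; rewrite N0 expf_neq0.
congr (- _); rewrite /take_poly horner_poly mulr_sumr big_ord_recr /=; congr (_ + _).
  apply: eq_bigr => i _; rewrite mulrCA; congr (_ * _).
  by rewrite exprVn -expfB_cond ?(negPf N0) //= ?leq_ord // -ltnS.
by rewrite mulrCA exprS exprVn; congr (_ * _); field; rewrite N0 expf_neq0.
Qed.

Section Sparse.

Variables (m : nat) (x : 'I_m.+1 -> nat) (c : 'I_m.+1 -> int).
Hypothesis x_gt0 : forall k, (0 < x k)%N.
Hypothesis c_kill : forall l, (l < m)%N -> \sum_k (c k)%:~R * (x k)%:R ^+ l = 0 :> algC.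
Hypothesis c_inv : \sum_k (c k)%:~R / (x k)%:R != 0 :> algC.

(* The weights [c] kill all powers [x_k^l] with [l < m], so in the expansion of
   [v] in [1/N] the polynomial part of [N^j v] cancels and the first surviving
   term is the one in [1/N]. *)
Definition dsum j (v : nat -> algC) N : algC :=
  \sum_k (c k)%:~R * ((x k * N)%:R ^+ j * v (x k * N)%N).

Lemma dsum_asymp j M v (p : {poly algC}) : (j < m)%N -> (j.+2 <= M)%N ->
  bigO M (fun N => v N - p.[N%:R^-1]) ->
  bigO 2 (fun N => dsum j v N - p`_j.+1 * (\sum_k (c k)%:~R / (x k)%:R) / N%:R).
Proof.
move=> jm jM /(bigO_asymp jM); set r := (fun N : nat => _) => hr.
have {}hr k : bigO 2 (fun N => (c k)%:~R * r (x k * N)%N).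
  by apply: bigOZ; apply: bigO_scale.
apply: bigO_eq (bigO_sum (index_enum 'I_m.+1) hr).
apply: ev_mono (ev_geq 1) => N N1.
have N0 : N%:R != 0 :> algC by rewrite pnatr_eq0 -lt0n.
rewrite /dsum /r.
rewrite [LHS](eq_bigr (fun k => (c k)%:~R * ((x k * N)%:R ^+ j * v (x k * N)%N)
   - \sum_(i < j.+1) p`_i * N%:R ^+ (j - i) * ((c k)%:~R * (x k)%:R ^+ (j - i))
   - p`_j.+1 / N%:R * ((c k)%:~R / (x k)%:R))); last first.
  move=> k _; rewrite mulrBr -addrA; congr (_ + _).
  rewrite mulrDr opprD; congr (- _ - _).
    rewrite mulr_sumr; apply: eq_bigr => i _.
    by rewrite natrM exprMn; ring.
  have xk : (x k)%:R != 0 :> algC by rewrite pnatr_eq0 -lt0n.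
  by rewrite natrM; field; rewrite N0 xk.
rewrite !sumrB [X in _ - X - _]exchange_big /= [X in _ - X - _]big1 ?subr0; last first.
  move=> i _; rewrite -mulr_sumr c_kill ?mulr0 //.
  by rewrite (leq_ltn_trans _ jm) // leq_subr.
by rewrite -mulr_sumr; congr (_ - _); rewrite mulrAC.
Qed.

Lemma dsum_bigO j M v (p : {poly algC}) : (j < m)%N -> (j.+2 <= M)%N ->
  bigO M (fun N => v N - p.[N%:R^-1]) -> bigO 1 (dsum j v).
Proof.
move=> jm jM /(dsum_asymp jm jM) /(bigO_le (leqnSn 1)) h.
apply: bigO_eq (bigOD h (bigOZ (p`_j.+1 * (\sum_k (c k)%:~R / (x k)%:R)) bigO_inv)).
by exists 0%N => N _; rewrite subrK.
Qed.

Lemma dsum_neq0 j M v (p : {poly algC}) : (j < m)%N -> (j.+2 <= M)%N ->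
  bigO M (fun N => v N - p.[N%:R^-1]) -> p`_j.+1 != 0 -> ev (fun N => dsum j v N != 0).
Proof.
move=> jm jM /(dsum_asymp jm jM) h pj.
have {}h := bigO_expM (k := 1) (j := 1) h.
have nz := mulf_neq0 pj c_inv.
suff /(bigO_neq0 nz) : bigO 1 (fun N => N%:R * dsum j v N -
    p`_j.+1 * (\sum_k (c k)%:~R / (x k)%:R)).
  by apply: ev_mono => N; apply: contraNneq => ->; rewrite mulr0.
apply: bigO_eq h; apply: ev_mono (ev_geq 1) => N N1.
have N0 : N%:R != 0 :> algC by rewrite pnatr_eq0 -lt0n.
by rewrite expr1 mulrBr mulrC [_ / _]mulrC; congr (_ - _); rewrite mulrA divff ?mul1r // mulrC.
Qed.

End Sparse.

Lemma bigO_coef_prod (I : Type) (s : seq I) M (rho : nat -> I -> algC) (x : I -> {poly algC}) l :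
  (forall i, bigO M (fun N => rho N i - (x i).[N%:R^-1])) ->
  bigO M (fun N => (\prod_(i <- s) ('X - (rho N i)%:P))`_l -
     ((\prod_(i <- s) ('X - (x i)%:P))`_l).[N%:R^-1]).
Proof.
move=> hx; elim: s l => [|i s IH] l.
  apply: bigO_eq (bigO0 M); exists 0%N => N _.
  by rewrite !big_nil !coef1; case: eqP; rewrite ?hornerC subrr.
have coefE (R : comNzRingType) (y : R) (q : {poly R}) :
    (('X - y%:P) * q)`_l = (if l is k.+1 then q`_k else 0) - y * q`_l.
  by rewrite mulrBl coefB coefCM coefXM; case: l {IH}.
have h1 : bigO M (fun N => (if l is k.+1 then (\prod_(i <- s) ('X - (rho N i)%:P))`_k else 0) -
   (if l is k.+1 then (\prod_(i <- s) ('X - (x i)%:P))`_k else 0).[N%:R^-1]).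
  case: (l) => [|k]; last exact: IH.
  by apply: bigO_eq (bigO0 M); exists 0%N => N _; rewrite horner0 subrr.
pose q := (\prod_(i <- s) ('X - (x i)%:P))`_l.
have hrho : bigO 0 (fun N => rho N i).
  apply: bigO_eq (bigOD (bigO_le (leq0n M) (hx i)) (bigO_poly (x i))).
  by exists 0%N => N _; rewrite subrK.
apply: bigO_eq (bigOB h1 (bigOD (bigOM0 (hx i) (bigO_poly q)) (bigOM0 (IH l) hrho))).
exists 0%N => N _; rewrite !big_cons !coefE hornerD hornerN hornerM -/q.
by case: (l) => [|k]; rewrite ?horner0; ring.
Qed.

Lemma Aint_coef_prod (I : Type) (s : seq I) (y : I -> algC) (t : algC) l :
  t \in Aint -> (forall i, t * y i \in Aint) ->
  t ^+ size s * (\prod_(i <- s) ('X - (y i)%:P))`_l \in Aint.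
Proof.
move=> At Ay; elim: s l => [|i s IH] l.
  by rewrite big_nil expr0 mul1r coef1; case: eqP => _; rewrite ?Aint0 ?Aint1.
rewrite big_cons mulrBl coefB coefCM coefXM mulrBr rpredB //.
  case: l => [|k]; first by rewrite mulr0 Aint0.
  by rewrite /= exprS -mulrA rpredM // IH.
by rewrite exprS mulrACA rpredM // IH.
Qed.

Lemma common_denominator (I : eqType) (s : seq I) (y : I -> algC) :
  (forall i, y i \in Crat) ->
  exists2 k : nat, (0 < k)%N & forall i, i \in s -> k%:R * y i \in Num.int.
Proof.
move=> Qy; elim: s => [|i s [k k0 hk]]; first by exists 1%N.
have /CratP[q Dq] := Qy i.
exists (k * `|denq q|)%N; first by rewrite muln_gt0 k0 absz_gt0 denq_neq0.
move=> j; rewrite inE => /orP[/eqP->|/hk].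
  rewrite Dq natrM -mulrA rpredM ?rpred_nat //.
  rewrite -[q in ratr q]divq_num_den fmorph_div /= !ratr_int.
  rewrite (_ : `|denq q|%:R = (denq q)%:~R); last first.
    by rewrite -[in RHS](gez0_abs (denq_ge0 q)).
  by rewrite mulrC divfK ?rpred_int // intr_eq0 denq_neq0.
by rewrite natrM mulrAC => hj; rewrite rpredM ?rpred_nat.
Qed.

(** * Specialisation in one parameter *)

(* If every multiple [w N] with [w <= #|I| m + 1] were bad, one kind of badness
   would occur at [m + 1] of them. *)
Lemma pigeonhole_multiples (I : finType) m (bad : I -> nat -> Prop) :
  (forall i (x : 'I_m.+1 -> nat), injective x -> (forall k, (0 < x k)%N) ->
     ev (fun N => ~ forall k, bad i (x k * N)%N)) ->
  forall T0, exists2 T, (T0 <= T)%N & forall i, ~ bad i T.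
Proof.
move=> elim_bad T0; pose W := (#|I| * m).+1.
have : ev (fun N => forall t : I * {ffun 'I_m.+1 -> 'I_W}, injective t.2 ->
    ~ forall k, bad t.1 ((t.2 k).+1 * N)%N).
  apply: ev_fin => -[i f] /=; case: (classic (injective f)) => [fI|nfI]; last first.
    by exists 0%N => N _ /nfI.
  have [|//|N0 h] := elim_bad i (fun k => (f k).+1).
    by move=> k l [/val_inj/fI].
  by exists N0 => N /h.
case=> N0 hN; apply: NNPP => nex.
pose N := maxn N0 T0.
have : forall w : 'I_W, exists i, bad i (w.+1 * N)%N.
  move=> w; apply: NNPP => nb; apply: nex.
  exists (w.+1 * N)%N; first by rewrite (leq_trans (leq_maxr N0 T0)) // leq_pmull.
  by move=> i bi; apply: nb; exists i.
case/fin_all_exists => th hth.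
have [i hi] : exists i, (m < #|[pred w | th w == i]|)%N.
  apply/existsP; apply: contraT; rewrite negb_exists => /forallP h.
  have : (W <= \sum_(i : I) m)%N.
    rewrite -{1}[W]card_ord -sum1_card (partition_big th predT) //=.
    apply: leq_sum => i _; have := h i; rewrite -leqNgt; apply: leq_trans.
    by rewrite sum1_card.
  by rewrite sum_nat_const /W ltnn.
pose f := [ffun k : 'I_m.+1 => enum_val (widen_ord hi k)].
have fI : injective f.
  by move=> k l; rewrite !ffunE => /enum_val_inj/(congr1 val) /= /val_inj.
apply: (hN N (leq_maxl _ _) (i, f) fI) => k /=.
have := enum_valP (widen_ord hi k); rewrite inE => /eqP <-.
by rewrite ffunE.
Qed.

Section OneParameter.

Variables (n D M : nat) (Phi : {poly {poly algC}}).
Variables (a : 'I_n -> algC) (x : 'I_n -> {poly algC}) (eta : algC).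
Hypotheses (n_gt0 : (0 < n)%N) (M_gt0 : (0 < M)%N).
Hypotheses (Phi_monic : Phi \is monic) (Phi_size : size Phi = n.+1).
Hypotheses (a_inj : injective a) (xa : forall i, (x i)`_0 = a i).
Hypothesis xM : forall i j, (j < n * M)%N -> (Phi.[x i])`_j = 0.
Hypothesis PhiD : forall l, (size (Phi`_l)%R <= D.+1)%N.
Hypothesis PhiQ : forall l j, Phi`_l`_j \in Crat.

Definition subproduct (w : {set 'I_n}) : {poly {poly algC}} :=
  \prod_(i in w) ('X - (x i)%:P).

(* A subset [w] of the roots is ruled out in one of two ways: a symmetric
   function of its series has a nonzero coefficient too late for a polynomial of
   the expected degree, or the series form an exact factor of [Phi] which is not
   rational. *)
Definition late_coef (w : {set 'I_n}) :=
  exists l j, [/\ (D * n < j)%N, (j < M)%N & (subproduct w)`_l`_j != 0].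

Definition moved_factor (w : {set 'I_n}) :=
  exists V W : {poly {poly algC}},
    [/\ Phi = V * W, V \is monic, map_poly (coefp 0) V = \prod_(i in w) ('X - (a i)%:P),
        map_poly (coefp 0) W = \prod_(i in ~: w) ('X - (a i)%:P) &
        exists l (nu : {rmorphism algC -> algC}), (size (V`_l)%R <= M)%N /\
          map_poly nu (V`_l) <> V`_l].

Variable rho : nat -> 'I_n -> algC.
Hypothesis rhoM : forall i, bigO M (fun N => rho N i - (x i).[N%:R^-1]).
Hypothesis rhoa : forall i, bigO 1 (fun N => rho N i - a i).
Hypothesis rhoE : ev (fun N => injective (rho N) /\
                               eval_inv N Phi = \prod_i ('X - (rho N i)%:P)).

Lemma eval_invQ N l : (eval_inv N Phi)`_l \in Crat.
Proof.
rewrite /eval_inv coef_map /= /horner_eval horner_coef rpred_sum // => j _.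
by rewrite rpredM ?PhiQ // rpredX // rpredV rpred_nat.
Qed.

(** At the parameter [1/N] the coefficients of [Phi] have denominator dividing [k N^D], because they
    have degree at most [D] in the parameter. *)
Lemma scaled_integral : exists2 k : nat, (0 < k)%N &
  ev (fun N => forall i, k%:R * N%:R ^+ D * rho N i \in Aint).
Proof.
have [k k0 hk] := @common_denominator _ (enum [set: 'I_n.+1 * 'I_D.+1])
  (fun lj => Phi`_(lj.1)`_(lj.2)) (fun lj => PhiQ lj.1 lj.2).
have {}hk l j : (l < n.+1)%N -> (j < D.+1)%N -> k%:R * Phi`_l`_j \in Num.int.
  by move=> hl hj; apply: (hk (Ordinal hl, Ordinal hj)); rewrite mem_enum inE.
exists k => //; apply: ev_mono (ev_and (ev_geq 1) rhoE) => N [N1 [_ DN]] i.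
have N0 : N%:R != 0 :> algC by rewrite pnatr_eq0 -lt0n.
pose t := k%:R * N%:R ^+ D : algC.
have tZ : t \in Num.int by rewrite rpredM ?rpredX ?rpred_nat.
have t0 : t != 0 by rewrite mulf_neq0 ?expf_neq0 // pnatr_eq0 -lt0n.
have lc : (eval_inv N Phi)`_n = 1.
  have := eval_inv_monic Phi_monic N; rewrite monicE lead_coefE.
  by rewrite (size_eval_inv Phi_monic Phi_size) /= => /eqP.
(* This is [t^n P(X/t)] for [P = eval_inv N Phi]: monic with integer coefficients and root
   [t * rho N i]. *)
pose q := \poly_(l < n.+1) (t ^+ (n - l) * (eval_inv N Phi)`_l).
have qn : q`_n = 1 by rewrite coef_poly ltnSn subnn expr0 mul1r lc.
have sq : size q = n.+1.
  by rewrite size_poly_eq // subnn expr0 mul1r lc oner_eq0.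
apply: (@root_monic_Aint q).
- rewrite rootE horner_poly -/t; have := size_eval_inv Phi_monic Phi_size N => sN.
  rewrite (eq_bigr (fun l : 'I_n.+1 => t ^+ n * ((eval_inv N Phi)`_l * rho N i ^+ l))).
    rewrite -mulr_sumr -sN -horner_coef DN horner_prod (bigD1 i) //=.
    by rewrite hornerXsubC subrr mul0r mulr0.
  move=> l _; have ln : (l <= n)%N by rewrite -ltnS.
  have -> : t ^+ n = t ^+ (n - l) * t ^+ l by rewrite -exprD subnK.
  by rewrite [(t * _) ^+ l]exprMn; ring.
- by rewrite monicE lead_coefE sq /= qn.
apply/polyOverP=> l; rewrite coef_poly; case: ifP => [hl|_]; last by rewrite rpred0.
have [->|ln] := eqVneq l n; first by rewrite subnn expr0 mul1r lc rpred1.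
have {ln hl} hl : (l < n)%N by rewrite ltn_neqAle ln -ltnS.
have -> : (n - l = (n - l).-1.+1)%N by rewrite prednK // subn_gt0.
rewrite exprS -mulrA [_ ^+ _ * _]mulrC mulrA rpredM ?rpredX //.
rewrite /eval_inv coef_map /= /horner_eval (horner_coef_wide _ (PhiD l)) mulr_sumr.
apply: rpred_sum => j _.
have jD : (j <= D)%N by rewrite -ltnS.
rewrite /t -{1}(subnK jD) exprD.
rewrite (_ : k%:R * (N%:R ^+ (D - j) * N%:R ^+ j) * (Phi`_l`_j * N%:R^-1 ^+ j) =
   k%:R * Phi`_l`_j * N%:R ^+ (D - j)).
  by rewrite rpredM ?rpredX ?rpred_nat // hk // ltnW.
by rewrite exprVn; field; rewrite expf_neq0.
Qed.

Definition bad_split (w : {set 'I_n}) N :=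
  forall l, (\prod_(i in w) ('X - (rho N i)%:P))`_l \in Crat.

Section Elim.

Variable y : 'I_M.+1 -> nat.
Hypotheses (y_inj : injective y) (y_gt0 : forall k, (0 < y k)%N).

Lemma ev_scale (P : nat -> Prop) k : ev P -> ev (fun N => P (y k * N)%N).
Proof.
by move=> [N0 h]; exists N0 => N le; apply: h; rewrite (leq_trans le) // leq_pmull.
Qed.

(** If all the values were rational, [k^n] times the weighted sum would be an integer: [T^j] with
    [D * n <= j] absorbs the denominators of the symmetric function. But this number is nonzero and
    tends to 0. *)
Lemma elim_late w : late_coef w -> ev (fun N => ~ forall k, bad_split w (y k * N)%N).
Proof.
(* The late coefficient has index [j.+1], so weighting by [T^j] leaves it in front of [1/T]. *)
move=> [l [[|j] []]]; [by rewrite ltn0|move=> jD jM pj].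
have [c [c_kill c_inv]] := divided_difference y_inj y_gt0.
pose v N := (\prod_(i in w) ('X - (rho N i)%:P))`_l.
have hv : bigO M (fun N => v N - ((subproduct w)`_l).[N%:R^-1]).
  have := @bigO_coef_prod _ (enum w) M rho x l rhoM.
  apply: bigO_eq; exists 0%N => N _.
  by rewrite /v /subproduct -!(big_enum _ _ w).
have jM' := ltnW jM.
have nz := dsum_neq0 y_gt0 c_kill c_inv jM' jM hv pj.
have [k k0 hk] := scaled_integral.
have small : ev (fun N => `|k%:R ^+ n * dsum y c j v N| < 1).
  apply: bigO_small; first exact: ltr01.
  by apply: bigOZ; apply: dsum_bigO hv.
have hk' : ev (fun N => forall (r : 'I_M.+1) i, k%:R * (y r * N)%:R ^+ D * rho (y r * N)%N i \in Aint).
  by apply: ev_fin => r; apply: ev_scale hk.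
apply: ev_mono (ev_and nz (ev_and small hk')) => N [nzN [smN hN]] bad.
have : k%:R ^+ n * dsum y c j v N \in Num.int.
  rewrite /dsum mulr_sumr rpred_sum // => r _.
  apply: Cint_rat_Aint.
    rewrite rpredM ?rpredX ?rpred_nat // rpredM ?rpred_int // rpredM ?rpredX ?rpred_nat //.
    exact: bad.
  set T := (y r * N)%N.
  have -> : k%:R ^+ n * ((c r)%:~R * (T%:R ^+ j * v T)) =
     (c r)%:~R * (T%:R ^+ (j - D * n) * (k%:R * T%:R ^+ D) ^+ (n - #|w|)) *
     ((k%:R * T%:R ^+ D) ^+ #|w| * v T).
    have wn : (#|w| <= n)%N by rewrite -[n in (_ <= n)%N]card_ord max_card.
    have Dj : T%:R ^+ j = T%:R ^+ (j - D * n) * T%:R ^+ (D * n) :> algC.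
      by rewrite -exprD subnK.
    have Dt : (k%:R * T%:R ^+ D) ^+ n =
        (k%:R * T%:R ^+ D) ^+ (n - #|w|) * (k%:R * T%:R ^+ D) ^+ #|w| :> algC.
      by rewrite -exprD subnK.
    transitivity ((c r)%:~R * T%:R ^+ (j - D * n) * ((k%:R * T%:R ^+ D) ^+ n * v T)).
      by rewrite exprMn -exprM Dj; ring.
    by rewrite Dt; ring.
  have Anat q : q%:R \in Aint by rewrite Aint_Cint ?rpred_nat.
  apply: rpredM.
    by apply: rpredM; rewrite ?Aint_int // rpredM ?rpredX // rpredM ?rpredX.
  rewrite /v -(big_enum _ _ w) /= cardE; apply: Aint_coef_prod.
    by rewrite rpredM ?rpredX.
  exact: hN.
move/norm_intr_ge1; rewrite mulf_neq0 ?expf_neq0 ?pnatr_eq0 -?lt0n // => /(_ isT).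
by move/le_gtF; rewrite smN.
Qed.

(** For large [N] the roots in [w] are not roots of [W], hence they are exactly those of [V]. If
    their product were rational at [M + 1] parameters, the coefficient [V_l] and its image under
    [nu] would agree at [M + 1] points, more than their degrees allow. *)
Lemma elim_moved w : moved_factor w -> ev (fun N => ~ forall k, bad_split w (y k * N)%N).
Proof.
move=> [V [W [DVW Vm DV DW [l [nu [sV mv]]]]]].
have notW : ev (fun N => forall i, i \in w -> ~~ root (eval_inv N W) (rho N i)).
  suff : ev (fun N => forall i, i \in w -> (eval_inv N W).[rho N i] != 0).
    by apply: ev_mono => N h i /h.
  apply: ev_fin => i; have [iw|_] := boolP (i \in w); last by exists 0%N.
  have nz : (\prod_(j in ~: w) ('X - (a j)%:P)).[a i] != 0.
    rewrite horner_prod; apply/prodf_neq0 => j; rewrite inE => jw.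
    rewrite hornerXsubC subr_eq0 (inj_eq a_inj).
    by apply: contraNneq jw => <-.
  have := bigO_eval_cst W (rhoa i); rewrite DW => /(bigO_neq0 nz) [N0 h].
  by exists N0 => N /h.
have VE : ev (fun N => \prod_(i in w) ('X - (rho N i)%:P) = eval_inv N V).
  apply: ev_mono (ev_and notW rhoE) => N [nW [rI DN]].
  have mV : eval_inv N V \is monic by rewrite /eval_inv monic_map.
  have rV : all (root (eval_inv N V)) [seq rho N i | i <- enum w].
    apply/allP => _ /mapP[i + ->]; rewrite mem_enum => iw.
    have : root (eval_inv N Phi) (rho N i).
      by rewrite DN /root horner_prod (bigD1 i) //= hornerXsubC subrr mul0r.
    by rewrite DVW /eval_inv rmorphM rootM (negPf (nW i iw)) orbF.
  have u : uniq [seq rho N i | i <- enum w] by rewrite map_inj_uniq ?enum_uniq.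
  have sz : size (eval_inv N V) = (size [seq rho N i | i <- enum w]).+1.
    rewrite size_map -cardE /eval_inv size_map_poly_id0; last first.
      by rewrite (monicP Vm) rmorph1 oner_eq0.
    have := congr1 (size : {poly algC} -> nat) DV.
    rewrite size_prod_XsubC_in size_map_poly_id0 //.
    by rewrite (monicP Vm) /= coefC oner_eq0.
  rewrite [RHS](all_roots_prod_XsubC sz rV) ?uniq_rootsE // (monicP mV) scale1r.
  by rewrite big_map big_enum.
have VE' : ev (fun N => forall r : 'I_M.+1,
    \prod_(i in w) ('X - (rho (y r * N)%N i)%:P) = eval_inv (y r * N)%N V).
  by apply: ev_fin => r; apply: ev_scale VE.
apply: ev_mono (ev_and (ev_geq 1) VE') => N [N1 hN] bad; apply: mv.
apply/eqP; rewrite -subr_eq0; apply/eqP.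
apply: (@roots_geq_poly_eq0 _ _ [seq (y r * N)%:R^-1 | r <- enum 'I_M.+1]).
- apply/allP => _ /mapP[r _ ->]; rewrite rootE hornerD hornerN subr_eq0.
  have := bad r l; rewrite hN /eval_inv coef_map /= /horner_eval => /aut_Crat-/(_ nu) E.
  by rewrite -[in X in _ == X]E -horner_map fmorphV rmorph_nat.
- rewrite map_inj_uniq ?enum_uniq // => r s /invr_inj/eqP.
  by rewrite eqr_nat eqn_pmul2r // => /eqP/y_inj.
rewrite size_map size_enum_ord (leq_trans (size_polyD _ _)) // geq_max.
by rewrite size_polyN size_map_poly (leqW sV).
Qed.

End Elim.

(** * Roots lying in a prescribed number field *)

Section FieldElim.

Variables (r : seq algC).
Hypothesis eta_r : minCpoly eta = \prod_(z <- r) ('X - z%:P).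

(** If [rho N i] is a rational polynomial in [eta], its image under [nu] depends only on the
    conjugate [nu eta]. Recording in [pi] which root it is leaves finitely many types of badness, as
    the pigeonhole argument requires. *)
Definition bad_field (i : 'I_n) (pi : {ffun 'I_(size r) -> 'I_n}) N :=
  forall (k : 'I_(size r)) (nu : {rmorphism algC -> algC}), nu eta = r`_k -> nu (rho N i) = rho N (pi k).

(** Here the weighted sum is only an algebraic integer. Its conjugates are the weighted sums of the
    branches [pi k], with the same pattern at all the parameters, so they are all small and
    [Aint_small_conj] applies. *)
Lemma elim_field (y : 'I_M.+1 -> nat) i pi : injective y -> (forall k, (0 < y k)%N) ->
  (exists j, [/\ (D * n < j)%N, (j < M)%N & (x i)`_j != 0]) ->
  ev (fun N => ~ forall k, bad_field i pi (y k * N)%N).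
Proof.
move=> y_inj y_gt0 [[|j] []]; [by rewrite ltn0|move=> jD jM pj].
have [c [c_kill c_inv]] := divided_difference y_inj y_gt0.
have jM' := ltnW jM.
have nz := dsum_neq0 y_gt0 c_kill c_inv jM' jM (rhoM i) pj.
have [k k0 hk] := scaled_integral.
have small : ev (fun N => forall i', `|k%:R * dsum y c j (rho^~ i') N| < 1).
  apply: ev_fin => i'; apply: bigO_small; first exact: ltr01.
  by apply: bigOZ; apply: dsum_bigO (rhoM i').
have hk' : ev (fun N => forall q : 'I_M.+1, forall i,
    k%:R * (y q * N)%:R ^+ D * rho (y q * N)%N i \in Aint).
  by apply: ev_fin => q; apply: (ev_scale y_gt0 q hk).
apply: ev_mono (ev_and nz (ev_and small hk')) => N [nzN [smN hN]] bad.
have Anat q : q%:R \in Aint by rewrite Aint_Cint ?rpred_nat.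
have Dlej : (D <= j)%N.
  by apply: (leq_trans _ (jD : (D * n <= j)%N)); rewrite leq_pmulr.
have : k%:R * dsum y c j (rho^~ i) N \in Aint.
  rewrite /dsum mulr_sumr rpred_sum // => q _; set T := (y q * N)%N.
  have -> : k%:R * ((c q)%:~R * (T%:R ^+ j * rho T i)) =
    (c q)%:~R * T%:R ^+ (j - D) * (k%:R * T%:R ^+ D * rho T i).
    have -> : T%:R ^+ j = T%:R ^+ (j - D) * T%:R ^+ D :> algC by rewrite -exprD subnK.
    by ring.
  by apply: rpredM; rewrite ?hN // rpredM ?Aint_int ?rpredX.
move/Aint_small_conj => z0.
suff /z0/eqP : forall nu : {rmorphism algC -> algC}, `|nu (k%:R * dsum y c j (rho^~ i) N)| < 1.
  by rewrite mulf_eq0 (negPf nzN) orbF pnatr_eq0 -leqn0 leqNgt k0.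
move=> nu.
have : nu eta \in r.
  by rewrite -root_prod_XsubC -eta_r -(minCpoly_aut nu) root_minCpoly.
move=> hr; have hidx : (index (nu eta) r < size r)%N by rewrite index_mem.
pose o := Ordinal hidx.
have nuo : nu eta = r`_o by rewrite /= nth_index.
rewrite [nu _](_ : _ = k%:R * dsum y c j (rho^~ (pi o)) N) //.
rewrite rmorphM rmorph_nat rmorph_sum; congr (_ * _); apply: eq_bigr => q _.
by rewrite [LHS]rmorphM [nu (_ * rho _ _)]rmorphM rmorphXn /= rmorph_int rmorph_nat (bad q o nu nuo).
Qed.

End FieldElim.

End OneParameter.

Lemma Crat_poly_lift (p : {poly algC}) : (forall i, p`_i \in Crat) -> exists q, p = pQtoC q.
Proof.
move=> Qp; exists (\poly_(i < size p) getCrat p`_i).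
apply/polyP=> i; rewrite coef_map coef_poly; case: ltnP => [_|le].
  by rewrite /= getCratK.
by rewrite nth_default //= rmorph0.
Qed.

(** A root of smaller degree splits the roots into those of its minimal polynomial and the rest, and
    both products are rational. Hence it is enough that [hsplit] excludes a subset or its
    complement. *)
Theorem one_parameter_specialization n D M (Phi : {poly {poly algC}}) (a : 'I_n -> algC)
    (x : 'I_n -> {poly algC}) (eta : algC) :
  (0 < n)%N -> (0 < M)%N -> Phi \is monic -> size Phi = n.+1 ->
  injective a -> (forall i, (x i)`_0 = a i) ->
  (forall i j, (j < n * M)%N -> (Phi.[x i])`_j = 0) ->
  (forall l, (size (Phi`_l)%R <= D.+1)%N) ->
  (forall l j, Phi`_l`_j \in Crat) ->
  (forall w, w != set0 -> w != setT ->
     (late_coef D M x w \/ moved_factor M Phi a w) \/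
     (late_coef D M x (~: w) \/ moved_factor M Phi a (~: w))) ->
  (forall i, exists j, [/\ (D * n < j)%N, (j < M)%N & (x i)`_j != 0]) ->
  exists2 T, (0 < T)%N & forall y, root (eval_inv T Phi) y ->
    size (minCpoly y) = n.+1 /\ forall g : {poly rat}, y <> (pQtoC g).[eta].
Proof.
move=> n_gt0 M_gt0 Phi_monic Phi_size a_inj xa xM PhiD PhiQ hsplit hfield.
have [rho [rhoM rhoa rhoE]] :=
  root_branches n_gt0 M_gt0 Phi_monic Phi_size a_inj xa xM.
have [r Dr] := closed_field_poly_normal (minCpoly eta).
rewrite (monicP (minCpoly_monic eta)) scale1r in Dr.
(* The reason for exclusion is part of the badness, so a subset that cannot be excluded is never bad
   and the pigeonhole hypothesis holds for it trivially. *)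
pose bad (t : {set 'I_n} + 'I_n * {ffun 'I_(size r) -> 'I_n}) N :=
  match t with
  | inl w => (late_coef D M x w \/ moved_factor M Phi a w) /\ bad_split rho w N
  | inr ip => @bad_field n eta rho r ip.1 ip.2 N
  end.
have elim_bad t (y : 'I_M.+1 -> nat) : injective y -> (forall k, (0 < y k)%N) ->
    ev (fun N => ~ forall k, bad t (y k * N)%N).
  case: t => [w|[i pi]] y_inj y_gt0 /=; last exact: (elim_field (D := D) (Phi := Phi)).
  have [lm|nlm] := classic (late_coef D M x w \/ moved_factor M Phi a w); last first.
    by exists 0%N => N _ /(_ ord0) [].
  suff : ev (fun N => ~ forall k, bad_split rho w (y k * N)%N).
    by apply: ev_mono => N nb h; apply: nb => k; case: (h k).
  case: lm => [/(elim_late (Phi := Phi))|/elim_moved]; exact.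
case: rhoE (rhoE) => N0 hN0 rhoE.
have [T] := pigeonhole_multiples elim_bad (maxn 1 N0).
rewrite geq_max => /andP[T_gt0 /hN0[rI DT]] good; exists T => //.
have PhiT_Q := eval_invQ PhiQ T.
have [PT DPT] := Crat_poly_lift PhiT_Q.
have rootE z : root (eval_inv T Phi) z -> exists i, z = rho T i.
  rewrite DT -(big_map (rho T) predT (fun z => 'X - z%:P)) root_prod_XsubC.
  by case/mapP=> i _ ->; exists i.
have rhoR i : root (eval_inv T Phi) (rho T i).
  by rewrite DT /root horner_prod (bigD1 i) //= hornerXsubC subrr mul0r.
move=> y ry; have [i Dy] := rootE y ry; split.
  apply: NNPP => szp.
  have [p0 [Dp mp0] p0P] := minCpolyP y.
  have /dvdpP[q0 Dq0] : p0 %| PT by rewrite -p0P -DPT.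
  pose w := [set j | root (minCpoly y) (rho T j)].
  have DP : eval_inv T Phi = pQtoC q0 * minCpoly y.
    by rewrite DPT Dq0 rmorphM /= -Dp.
  have Dw : minCpoly y = \prod_(j in w) ('X - (rho T j)%:P).
    have [s Ds] := closed_field_poly_normal (minCpoly y).
    rewrite (monicP (minCpoly_monic y)) scale1r in Ds; rewrite Ds.
    rewrite -(big_enum _ _ w) /= -(big_map (rho T) predT (fun z => 'X - z%:P)).
    apply: perm_big; apply: uniq_perm.
    - by rewrite -separable_prod_XsubC -Ds minCpoly_separable.
    - by rewrite map_inj_uniq ?enum_uniq.
    move=> z; rewrite -root_prod_XsubC -Ds; apply/idP/mapP => [rz|[j]].
      have [|j Dz] := rootE z; first by rewrite DP rootM rz orbT.
      by exists j; rewrite // mem_enum inE -Dz.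
    by rewrite mem_enum inE => rj ->.
  have Qw l : (\prod_(j in w) ('X - (rho T j)%:P))`_l \in Crat.
    by rewrite -Dw Dp coef_map Crat_rat.
  (* The complement has a rational product too, being the cofactor of the minimal polynomial. *)
  have Qcw l : (\prod_(j in ~: w) ('X - (rho T j)%:P))`_l \in Crat.
    have -> : \prod_(j in ~: w) ('X - (rho T j)%:P) = pQtoC q0.
      apply: (mulfI (monic_neq0 (minCpoly_monic y))).
      rewrite [RHS]mulrC -DP DT Dw [RHS](bigID (fun j => j \in w)) /=; congr (_ * _).
      by apply: eq_bigl => j; rewrite inE.
    by rewrite coef_map Crat_rat.
  have iw : i \in w by rewrite inE -Dy root_minCpoly.
  have [||h|h] := hsplit w.
  - by apply/set0Pn; exists i.
  - apply/eqP=> wT; apply: szp; rewrite Dw size_prod_XsubC_in wT cardsT card_ord //.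
  - by apply: (good (inl w)).
  by apply: (good (inl (~: w))).
move=> g Dg.
have : forall k : 'I_(size r), exists j, forall nu : {rmorphism algC -> algC},
    nu eta = r`_k -> nu (rho T i) = rho T j.
  move=> k; have : root (minCpoly eta) r`_k.
    by rewrite Dr root_prod_XsubC mem_nth.
  case/conj_aut=> nu0 Dnu0.
  have [|j Dj] := rootE (nu0 y).
    have <- : map_poly nu0 (eval_inv T Phi) = eval_inv T Phi.
      by rewrite DPT -map_poly_comp; apply: eq_map_poly => c; rewrite /= fmorph_rat.
    by rewrite fmorph_root.
  exists j => nu Dnu; rewrite -Dj -Dy Dg -!horner_map Dnu Dnu0 -!map_poly_comp.
  by congr _.[_]; apply: eq_map_poly => c; rewrite /= !fmorph_rat.
case/fin_all_exists=> pi hpi.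
apply: (good (inr (i, [ffun k => pi k]))) => k nu /= /hpi ->.
by rewrite ffunE.
Qed.

(** * Power series roots *)

Lemma horner_addr_taylor (R : comNzRingType) (p : {poly R}) x h :
  exists q, p.[x + h] = p.[x] + p^`().[x] * h + q * h ^+ 2.
Proof.
elim/poly_ind: p => [|p c [q Dq]].
  by exists 0; rewrite deriv0 !horner0 !mul0r !addr0.
exists (p^`().[x] + q * (x + h)).
by rewrite derivD derivM derivX derivC addr0 mulr1 !hornerD !hornerMX !hornerC Dq; ring.
Qed.

Lemma coef0_horner (R : comNzRingType) (Q : {poly {poly R}}) (x : {poly R}) :
  (Q.[x])`_0 = (map_poly (coefp 0) Q).[x`_0].
Proof. by rewrite -[LHS]/(coefp 0 _) -horner_map. Qed.

Section Newton.

Variables (R : comNzRingType) (Phi : {poly {poly R}}) (a w : R).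
Hypothesis Phi_a : (map_poly (coefp 0) Phi).[a] = 0.
Hypothesis dPhi_a : w * (map_poly (coefp 0) Phi)^`().[a] = 1.

(** One coefficient is corrected at a time, always dividing by the same derivative at [a]. As this
    is a unit of [R], the coefficients stay in [R], even when [R] is a polynomial ring. *)
Lemma newton_series K :
  exists x : {poly R}, x`_0 = a /\ forall j, (j < K)%N -> (Phi.[x])`_j = 0.
Proof.
elim: K => [|K [x [xa hx]]]; first by exists a%:P; rewrite coefC.
case: K hx => [|K] hx.
  by exists a%:P; split=> [|[|] //]; rewrite ?coef0_horner coefC.
pose y := - (w * (Phi.[x])`_K.+1).
exists (x + y *: 'X^(K.+1)); split=> [|j jK].
  by rewrite coefD coefZ coefXn mulr0 addr0.
have [q ->] := horner_addr_taylor Phi x (y *: 'X^(K.+1)).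
rewrite exprZn -exprM -[q * _]mulrC !coefD -!scalerAl -scalerAr !coefZ.
rewrite coefXnM coefMXn ltnS in jK *.
have -> : (j < K.+1 * 2)%N by lia.
rewrite mulr0 addr0.
have [ltj|gej] := ltnP j K.+1; first by rewrite mulr0 addr0 hx.
have -> : j = K.+1 by apply/eqP; rewrite eqn_leq jK gej.
by rewrite subnn coef0_horner -deriv_map xa /y mulNr mulrAC dPhi_a mul1r subrr.
Qed.

End Newton.

Lemma poly_nat_nonroot (p : {poly algC}) : p != 0 -> exists k : nat, p.[k%:R] != 0.
Proof.
move=> p0; apply: NNPP => nex.
have /(max_poly_roots p0) : all (root p) [seq k%:R | k <- iota 0 (size p)].
  apply/allP => _ /mapP[k _ ->]; rewrite rootE.
  by apply: contraT => h; case: nex; exists k.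
rewrite size_map size_iota ltnn map_inj_uniq ?iota_uniq => [/(_ isT)//|i j /eqP].
by rewrite eqr_nat => /eqP.
Qed.

Lemma meval_muni n (R : comNzRingType) (b : 'I_n.+1 -> R) (p : {mpoly R[n.+1]}) :
  p.@[b] = (map_poly (meval (fun i => b (widen_ord (leqnSn n) i))) (muni p)).[b ord_max].
Proof.
pose b' := fun i => b (widen_ord (leqnSn n) i).
have := @mpoly_rmorph_ext n.+1 R R (meval b)
  (horner_eval (b ord_max) \o map_poly (meval b') \o @muni n R) _ _ p.
apply=> [c|i] /=; first by rewrite mevalC muniC map_polyC /= mevalC /horner_eval hornerC.
rewrite /horner_eval mevalXU; case: (unliftP ord_max i) => [j ->|->].
  have -> : lift ord_max j = widen_ord (leqnSn n) j.
    by apply/val_inj; rewrite /= /bump leqNgt ltn_ord.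
  by rewrite muni_X_widen map_polyC hornerC /= mevalXU.
by rewrite muni_X_max map_polyX hornerX.
Qed.

(** The source of the later generic choices: natural points are rational and fixed by every
    automorphism. *)
Lemma mpoly_nat_nonroot m (p : {mpoly algC[m]}) : p != 0 ->
  exists b : 'I_m -> nat, p.@[fun i => (b i)%:R] != 0.
Proof.
elim: m p => [|m IH] p p0.
  exists (fun=> 0%N); move: p0; rewrite [p]nvar0_mpolyC mevalC.
  by apply: contraNneq => ->.
have q0 : lead_coef (muni p) != 0.
  rewrite lead_coef_eq0; apply: contraNneq p0 => q0.
  by rewrite -(muniK p) q0 rmorph0.
have [b hb] := IH _ q0.
have : map_poly (meval (fun i => (b i)%:R)) (muni p) != 0.
  apply: contraNneq hb => /(congr1 (coefp (size (muni p)).-1)).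
  by rewrite /= coef_map coef0 lead_coefE => ->.
case/poly_nat_nonroot=> k hk.
exists (fun i => oapp b k (unlift ord_max i)).
rewrite meval_muni unlift_none /= (_ : map_poly _ _ = map_poly (meval (fun i => (b i)%:R)) (muni p)) //.
apply: eq_map_poly => c; apply: meval_eq => i.
have -> : widen_ord (leqnSn m) i = lift ord_max i.
  by apply/val_inj; rewrite /= /bump leqNgt ltn_ord.
by rewrite liftK.
Qed.

(** * Congruences modulo a power of the inner variable *)

Section Modulo.

Variable R : idomainType.
Implicit Types (p q : {poly {poly R}}).

Definition eq_mod M p q := forall l j, (j < M)%N -> p`_l`_j = q`_l`_j.

Lemma eq_modM M p p' q q' : eq_mod M p p' -> eq_mod M q q' -> eq_mod M (p * q) (p' * q').
Proof.
move=> pp qq l j jM; rewrite !coefM !coef_sum; apply: eq_bigr => i _.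
rewrite !coefM; apply: eq_bigr => k _.
have kj : (k <= j)%N by rewrite -ltnS.
by rewrite pp ?qq // (leq_ltn_trans _ jM) // leq_subr.
Qed.

Lemma eq_mod_sym M p q : eq_mod M p q -> eq_mod M q p.
Proof. by move=> pq l j /pq ->. Qed.

Lemma eq_mod_trans M p q r : eq_mod M p q -> eq_mod M q r -> eq_mod M p r.
Proof. by move=> pq qr l j h; rewrite pq ?qr. Qed.

Lemma eq_mod_eq M p q : (forall l, (size (p`_l)%R <= M)%N) -> (forall l, (size (q`_l)%R <= M)%N) ->
  eq_mod M p q -> p = q.
Proof.
move=> sp sq pq; apply/polyP=> l; apply/polyP=> j; have [/pq->//|le] := ltnP j M.
by rewrite (nth_default _ (leq_trans (sp l) le)) (nth_default _ (leq_trans (sq l) le)).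
Qed.

Definition trunc M p : {poly {poly R}} := map_poly (take_poly M) p.

Lemma coef_trunc M p l : (trunc M p)`_l = take_poly M (p`_l)%R.
Proof. by rewrite /trunc coef_map_id0 // take_poly0r. Qed.

Lemma trunc_eq_mod M p : eq_mod M (trunc M p) p.
Proof. by move=> l j jM; rewrite coef_trunc coef_take_poly jM. Qed.

Lemma size_trunc M p : (0 < M)%N -> p \is monic -> size (trunc M p) = size p.
Proof.
move=> M0 pm; rewrite /trunc size_map_poly_id0 // (monicP pm) take_poly_id ?oner_eq0 //.
by rewrite size_poly1.
Qed.

Lemma trunc_monic M p : (0 < M)%N -> p \is monic -> trunc M p \is monic.
Proof.
move=> M0 pm.
have t1 : take_poly M (1 : {poly R}) = 1.
  by rewrite take_poly_id // size_poly1.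
rewrite monicE lead_coefE /trunc size_map_poly_id0; last first.
  by rewrite (monicP pm) t1 oner_eq0.
rewrite -/(trunc M p) coef_trunc -lead_coefE (monicP pm) t1 //.
Qed.

(** The difference has degree less than [n] and is small at every [x i]. Its lowest nonzero layer
    would be a polynomial of degree less than [n] vanishing at the [n] distinct values [a i]. *)
Lemma prod_roots_eq_mod n K (Phi : {poly {poly R}}) (a : 'I_n -> R) (x : 'I_n -> {poly R}) :
  injective a -> (forall i, (x i)`_0 = a i) ->
  Phi \is monic -> size Phi = n.+1 ->
  (forall i j, (j < K)%N -> (Phi.[x i])`_j = 0) ->
  eq_mod K Phi (\prod_i ('X - (x i)%:P)).
Proof.
move=> a_inj xa Pm Ps hx.
set V := \prod_i _; pose Q := Phi - V.
have Vs : size V = n.+1.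
  by rewrite /V (eq_bigl (fun i => i \in 'I_n)) // size_prod_XsubC_in card_ord.
have Vm : V \is monic by rewrite /V (eq_bigl (fun i => i \in 'I_n)) // monic_prod_XsubC_in.
have Qs : (size Q <= n)%N.
  apply/leq_sizeP=> j; rewrite leq_eqVlt => /orP[/eqP<-|lt].
    rewrite coefB; move: Pm Vm; rewrite !monicE !lead_coefE Ps Vs /= => /eqP-> /eqP->.
    by rewrite subrr.
  by rewrite coefB !nth_default ?subrr ?Ps ?Vs.
have Qx i j : (j < K)%N -> (Q.[x i])`_j = 0.
  move=> jK; rewrite /Q hornerD hornerN coefB hx // sub0r.
  by rewrite /V horner_prod (bigD1 i) //= hornerXsubC subrr mul0r coef0 oppr0.
suff Q0 : forall j, (j <= K)%N -> forall l k, (k < j)%N -> Q`_l`_k = 0.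
  move=> l j jK; apply/eqP; rewrite -subr_eq0 -coefB -coefB -/Q.
  by rewrite (Q0 K).
elim=> [//|j IH] jK l k; rewrite ltnS leq_eqVlt => /orP[/eqP->|]; last first.
  by apply: IH; apply: ltnW.
have {}IH := IH (ltnW jK).
pose q := \poly_(l < n) Q`_l`_j.
suff : q = 0.
  move=> /polyP/(_ l); rewrite coef0 coef_poly; case: ltnP => // le _.
  by rewrite [Q`_l]nth_default ?coef0 // (leq_trans Qs).
apply: (@roots_geq_poly_eq0 _ _ [seq a i | i <- enum 'I_n]).
- apply/allP=> _ /mapP[i _ ->]; rewrite rootE horner_poly.
  have := Qx i j jK; rewrite (horner_coef_wide _ Qs) coef_sum => /eqP; apply: etrans.
  congr (_ == 0); apply: eq_bigr => s _; rewrite coefM big_ord_recr /=.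
  rewrite big1 ?add0r => [|t _]; last by rewrite IH ?mul0r.
  by rewrite subnn -horner_coef0 horner_exp horner_coef0 xa.
- by rewrite map_inj_uniq ?enum_uniq.
by rewrite size_map size_enum_ord size_poly.
Qed.

End Modulo.

(** * Hilbert irreducibility *)

Lemma mpoly_natr_neq0 m (K : numFieldType) n : n.+1%:R != 0 :> {mpoly K[m]}.
Proof.
apply/eqP=> /(congr1 (meval (fun=> 0))).
by rewrite rmorph_nat meval0 => /eqP; rewrite pnatr_eq0.
Qed.

Section Line.

Variables (m : nat) (u0 : 'I_m -> nat) (K : comNzRingType) (f : {rmorphism rat -> K}).

(** All lines through [u0] at once: the outer variable is the parameter on the line and the inner
    variables are the coordinates of its direction. *)
Definition line : {mpoly rat[m]} -> {poly {mpoly K[m]}} :=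
  mmap (polyC \o @mpolyC m K \o f) (fun i => (u0 i)%:R + 'X * ('X_i)%:P).

HB.instance Definition _ := GRing.RMorphism.on line.

Lemma line_C c : line c%:MP = ((f c)%:MP)%:P.
Proof. by rewrite /line mmapC. Qed.

Lemma line_X i : line 'X_i = (u0 i)%:R + 'X * ('X_i)%:P.
Proof. by rewrite /line mmapX mmap1U. Qed.

(** Parameter 1 and direction [X - u0] lead back to the generic point, so a factorisation or a root
    found on the generic line gives one for the original polynomial. *)
Definition unline : {poly {mpoly K[m]}} -> {mpoly K[m]} :=
  comp_mpoly [tuple 'X_i - (u0 i)%:R | i < m] \o horner_eval 1.

HB.instance Definition _ := GRing.RMorphism.on unline.

Lemma lineK c : unline (line c) = map_mpoly f c.
Proof.
have := @mpoly_rmorph_ext m _ _ (unline \o line) (map_mpoly f) _ _ c; apply=> [a|i] /=.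
  by rewrite line_C /unline /= /horner_eval hornerC comp_mpolyC map_mpolyC.
rewrite line_X /unline /= /horner_eval hornerD hornerM hornerX hornerC mul1r.
rewrite hornerMn hornerC rmorphD rmorph_nat /= comp_mpolyXU -tnth_nth tnth_mktuple map_mpolyX.
by rewrite addrC subrK.
Qed.

Lemma line_0 c : (line c)`_0 = (f c.@[fun i => (u0 i)%:R])%:MP.
Proof.
have := @mpoly_rmorph_ext m _ _ (coefp 0 \o line)
  (@mpolyC m K \o f \o meval (fun i => (u0 i)%:R)) _ _ c; apply=> [a|i] /=.
  by rewrite line_C coefC mevalC.
by rewrite line_X coefD coefXM addr0 coefMn coefC mevalXU !rmorph_nat.
Qed.

End Line.

Lemma line_ratr m (u0 : 'I_m -> nat) (c : {mpoly rat[m]}) :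
  map_poly (map_mpoly (ratr : rat -> algC)) (line u0 (idfun : {rmorphism rat -> rat}) c) =
  line u0 ratC c.
Proof.
have := @mpoly_rmorph_ext m _ _
  (map_poly (map_mpoly (ratr : rat -> algC)) \o line u0 (idfun : {rmorphism rat -> rat}))
  (line u0 ratC) _ _ c; apply=> [e|i] /=.
  by rewrite !line_C map_polyC /= map_mpolyC.
rewrite !line_X rmorphD rmorphM /= map_polyX map_polyC /= map_mpolyX.
by rewrite !rmorph_nat.
Qed.

Lemma line_eval m (u0 b : 'I_m -> nat) N (c : {mpoly rat[m]}) :
  (map_poly (meval (fun i => (b i)%:R)) (line u0 ratC c)).[N%:R^-1] =
  ratr c.@[fun i => (u0 i)%:R + (b i)%:R / N%:R].
Proof.
have := @mpoly_rmorph_ext m _ _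
  (horner_eval N%:R^-1 \o map_poly (meval (fun i => (b i)%:R)) \o line u0 ratC)
  (ratr \o meval (fun i => (u0 i)%:R + (b i)%:R / N%:R)) _ _ c; apply=> [a|i] /=.
  by rewrite line_C map_polyC /horner_eval hornerC /= !mevalC.
rewrite line_X mevalXU rmorphD rmorphM /= map_polyX map_polyC /= mevalXU rmorph_nat.
rewrite /horner_eval hornerD hornerM hornerX hornerC hornerMn hornerC.
by rewrite rmorphD rmorphM /= fmorphV !rmorph_nat mulrC.
Qed.

Section Hilbert.

Variables (m n : nat) (F : {poly {mpoly rat[m]}}) (eta : algC).
Hypotheses (n_gt0 : (0 < n)%N) (F_monic : F \is monic) (F_size : size F = n.+1).
Hypothesis irr : forall c U V, c != 0 -> c *: F = U * V ->
  (size U <= 1)%N \/ (size V <= 1)%N.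
Hypothesis noroot : forall g : {mpoly algC[m]}, (map_poly (map_mpoly ratr) F).[g] != 0.

(** Irreducibility over the fraction field makes [F] and its derivative coprime; any point where the
    nonzero constant [r] of a Bezout relation does not vanish will do. *)
Lemma separable_base_point : exists u0 : 'I_m -> nat,
  separable_poly (pQtoC (map_poly (meval (fun i => (u0 i)%:R)) F)).
Proof.
have cop : coprimep F F^`().
  have /Pdiv.Idomain.dvdpP[[c q] /= c0 Dg] : gcdp F F^`() %| F by apply: dvdp_gcdl.
  have F0 : F != 0 by apply: monic_neq0.
  have dF0 : F^`() != 0.
    by apply: deriv_neq0; rewrite ?F_size // => k; apply: mpoly_natr_neq0.
  have g0 : gcdp F F^`() != 0 by rewrite gcdp_eq0 negb_and F0.
  have q0 : q != 0.
    apply: contraNneq F0 => q0; rewrite q0 mul0r in Dg.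
    by move/(congr1 (size : {poly _} -> nat)): Dg => /eqP; rewrite size_scale // size_poly0 size_poly_eq0.
  case: (irr c0 Dg) => s1; last by rewrite coprimep_def eqn_leq s1 size_poly_gt0.
  have := congr1 (size : {poly _} -> nat) Dg; rewrite size_scale // size_mul //.
  have -> : size q = 1 by apply/eqP; rewrite eqn_leq s1 size_poly_gt0.
  rewrite add1n /= => sg; have := dvdp_leq dF0 (dvdp_gcdr F F^`()).
  by rewrite -sg leqNgt lt_size_deriv.
have /Bezout_coprimepP[[u v]] := cop; rewrite -size_poly_eq1 => /size_poly1P[r r0 Dr].
have rC0 : map_mpoly (ratr : rat -> algC) r != 0.
  apply: contraNneq r0 => /eqP; rewrite -(rmorph0 (map_mpoly (n:=m) (ratr : rat -> algC))).
  by rewrite (inj_eq (map_mpoly_inj (fmorph_inj _))).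
have [b hb] := mpoly_nat_nonroot rC0; exists b.
pose e := meval (fun i => (b i)%:R : rat).
rewrite separable_map unlock deriv_map; apply/Bezout_coprimepP.
exists (map_poly e u, map_poly e v) => /=.
rewrite -!rmorphM -rmorphD /= Dr map_polyC -size_poly_eq1 size_polyC.
suff -> : e r != 0 by [].
apply: contraNneq hb => er0; rewrite -(rmorph0 (ratr : rat -> algC)) -er0 /e.
rewrite -map_mpoly_meval; apply/eqP/meval_eq => i; by rewrite rmorph_nat.
Qed.

Section Direction.

Variable u0 : 'I_m -> nat.
Variable a : 'I_n -> algC.
Hypothesis a_inj : injective a.
Hypothesis F_a : pQtoC (map_poly (meval (fun i => (u0 i)%:R)) F) = \prod_i ('X - (a i)%:P).

Local Notation P := {mpoly algC[m]}.
Local Notation Qmap := (map_mpoly (ratr : rat -> algC)).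

Let lineC : {rmorphism {mpoly rat[m]} -> {poly P}} := line u0 ratC.
Let Phi : {poly {poly P}} := map_poly lineC F.

Lemma size_line : size Phi = n.+1.
Proof. by rewrite /Phi size_map_poly_id0 // (monicP F_monic) rmorph1 oner_eq0. Qed.

Lemma monic_line : Phi \is monic.
Proof. by rewrite /Phi monic_map. Qed.

Lemma line_at0 : map_poly (coefp 0) Phi = map_poly (@mpolyC m algC) (\prod_i ('X - (a i)%:P)).
Proof.
rewrite -F_a /Phi -!map_poly_comp; apply: eq_map_poly => c /=.
exact: line_0.
Qed.

(** At the base point the roots are distinct, so the derivative at [a i] is a nonzero constant and
    the coefficients of the series are polynomials in the direction. *)
Lemma exists_series K : exists x : 'I_n -> {poly P}, forall i,
  (x i)`_0 = (a i)%:MP /\ forall j, (j < K)%N -> (Phi.[x i])`_j = 0.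
Proof.
suff h i : exists x : {poly P}, x`_0 = (a i)%:MP /\ forall j, (j < K)%N -> (Phi.[x])`_j = 0.
  by have [x hx] := fin_all_exists h; exists x.
pose q := \prod_(j in predC1 i) ('X - (a j)%:P).
have Dq : \prod_j ('X - (a j)%:P) = ('X - (a i)%:P) * q by rewrite (bigD1 i).
have qi : q.[a i] != 0.
  rewrite horner_prod; apply/prodf_neq0 => j ji.
  by rewrite hornerXsubC subr_eq0 (inj_eq a_inj) eq_sym.
apply: (@newton_series _ Phi (a i)%:MP ((q.[a i])^-1)%:MP).
  by rewrite line_at0 horner_map Dq hornerM hornerXsubC subrr mul0r /= mpolyC0.
rewrite line_at0 deriv_map horner_map Dq derivM derivXsubC hornerD hornerM hornerC.
by rewrite mul1r hornerM hornerXsubC subrr mul0r addr0 /= -mpolyCM mulVf.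
Qed.

Lemma exists_line_degree : exists D, forall l, (size (Phi`_l)%R <= D.+1)%N.
Proof.
exists (\max_(l < size Phi) size (Phi`_l)%R) => l; have [lt|le] := ltnP l (size Phi).
  by apply: leqW; apply: (leq_bigmax (Ordinal lt)).
by rewrite nth_default ?size_poly0.
Qed.

Variables (D M : nat) (x : 'I_n -> {poly P}).
Hypothesis PhiD : forall l, (size (Phi`_l)%R <= D.+1)%N.
Hypothesis MD : (D + n.+2 * (D * n) < M)%N.
Hypothesis xa : forall i, (x i)`_0 = (a i)%:MP.
Hypothesis xM : forall i j, (j < n * M)%N -> (Phi.[x i])`_j = 0.

Definition generic_product (w : {set 'I_n}) : {poly {poly P}} :=
  \prod_(i in w) ('X - (x i)%:P).

Definition generic_late w :=
  exists l j, [/\ (D * n < j)%N, (j < M)%N & (generic_product w)`_l`_j != 0].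

Definition generic_moved (w : {set 'I_n}) :=
  exists V W : {poly {poly P}},
    [/\ Phi = V * W, V \is monic,
        map_poly (coefp 0) V = map_poly (@mpolyC m algC) (\prod_(i in w) ('X - (a i)%:P)),
        map_poly (coefp 0) W = map_poly (@mpolyC m algC) (\prod_(i in ~: w) ('X - (a i)%:P)) &
        exists l j (nu : {rmorphism algC -> algC}), (size (V`_l)%R <= M)%N /\
          map_mpoly nu V`_l`_j != V`_l`_j].

Lemma M_gt0 : (0 < M)%N. Proof. exact: leq_ltn_trans MD. Qed.

Lemma generic_product_coef0 w :
  map_poly (coefp 0) (trunc M (generic_product w)) =
  map_poly (@mpolyC m algC) (\prod_(i in w) ('X - (a i)%:P)).
Proof.
transitivity (map_poly (coefp 0) (generic_product w)).
  apply/polyP=> l; rewrite [LHS]coef_map [RHS]coef_map /=.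
  by rewrite (@trunc_eq_mod _ M _ l 0 M_gt0).
rewrite /generic_product !rmorph_prod; apply: eq_bigr => i _.
have hx : map_poly (coefp 0) ('X - (x i)%:P) = 'X - ((a i)%:MP)%:P :> {poly P}.
  by rewrite (map_polyXsubC (coefp 0 : {rmorphism {poly P} -> P})) /= xa.
apply: etrans hx (esym _); exact: (map_polyXsubC (@mpolyC m algC : {rmorphism algC -> P})).

Qed.

Lemma generic_product_size w : ~ generic_late w ->
  forall l, (size ((trunc M (generic_product w))`_l)%R <= (D * n).+1)%N.
Proof.
move=> nl l; apply/leq_sizeP=> j lt; rewrite coef_trunc coef_take_poly.
case: ltnP => // jM; apply/eqP; apply: contraT => nz.
by case: nl; exists l, j.
Qed.

(** Both sides have degree less than [M] in the line parameter and agree modulo its [M]-th power. *)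
Lemma trunc_factor w : ~ generic_late w -> ~ generic_late (~: w) ->
  Phi = trunc M (generic_product w) * trunc M (generic_product (~: w)).
Proof.
move=> nw ncw; apply: (@eq_mod_eq _ M) => [l|l|].
- apply: leq_trans (PhiD l) _; lia.
- apply/leq_sizeP=> j Mj; rewrite coefM coef_sum big1 // => i _.
  rewrite coefM big1 // => k _.
  have [lk|le] := leqP (D * n).+1 k.
    by rewrite [X in X * _]nth_default ?mul0r // (leq_trans (generic_product_size nw i)).
  rewrite [X in _ * X]nth_default ?mulr0 // (leq_trans (generic_product_size ncw _)) //.
  by move: MD; nia.
apply: (eq_mod_trans (q := generic_product w * generic_product (~: w))); last first.
  by apply: eq_modM; apply: eq_mod_sym; apply: trunc_eq_mod.
have -> : generic_product w * generic_product (~: w) = \prod_i ('X - (x i)%:P).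
  rewrite [RHS](bigID (fun i => i \in w)) /=; congr (_ * _).
  by apply: eq_bigl => i; rewrite inE.
move=> l j jM; have aP : injective (fun i => (a i)%:MP : P).
  by move=> i j' /eqP; rewrite mpolyC_eq => /eqP/a_inj.
apply: (prod_roots_eq_mod aP xa monic_line size_line xM).
by rewrite (leq_trans jM) // leq_pmull.
Qed.

Lemma exact_split w : ~ generic_late w -> ~ generic_late (~: w) ->
  exists V W : {poly {poly P}}, [/\ Phi = V * W, V \is monic, W \is monic,
    map_poly (coefp 0) V = map_poly (@mpolyC m algC) (\prod_(i in w) ('X - (a i)%:P)) &
    [/\ map_poly (coefp 0) W = map_poly (@mpolyC m algC) (\prod_(i in ~: w) ('X - (a i)%:P)),
        forall l, (size (V`_l)%R <= (D * n).+1)%N, forall l, (size (W`_l)%R <= (D * n).+1)%N,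
        size V = #|w|.+1 & size W = #|~: w|.+1]].
Proof.
move=> nl ncl.
exists (trunc M (generic_product w)), (trunc M (generic_product (~: w))).
split; first exact: trunc_factor.
- exact: trunc_monic M_gt0 (monic_prod_XsubC_in _ _).
- exact: trunc_monic M_gt0 (monic_prod_XsubC_in _ _).
- exact: generic_product_coef0.
split; first exact: generic_product_coef0.
- exact: generic_product_size.
- exact: generic_product_size.
- by rewrite size_trunc ?M_gt0 ?monic_prod_XsubC_in // size_prod_XsubC_in.
by rewrite size_trunc ?M_gt0 ?monic_prod_XsubC_in // size_prod_XsubC_in.
Qed.

Lemma generic_rational_lift (V : {poly {poly P}}) :
  (forall l j mm, V`_l`_j@_mm \in Crat) ->
  exists V' : {poly {poly {mpoly rat[m]}}}, V = map_poly (map_poly Qmap) V'.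
Proof.
move=> QV.
have liftP (p : P) : (forall mm, p@_mm \in Crat) -> exists q : {mpoly rat[m]}, p = Qmap q.
  move=> Qp; exists (\sum_(mm <- msupp p) getCrat p@_mm *: 'X_[mm]).
  rewrite {1}[p]mpolyE raddf_sum /=; apply: eq_bigr => mm _.
  by rewrite map_mpolyZ map_mpolyX /= getCratK.
have liftPP (R S : nzRingType) (g : {additive R -> S}) (p : {poly S}) :
    (forall i, exists c, p`_i = g c) -> exists q, p = map_poly g q.
  move=> hp; have /fin_all_exists[c hc] : forall i : 'I_(size p), exists c, p`_i = g c.
    by move=> i; apply: hp.
  exists (\poly_(i < size p) (if insub i is Some o then c o else 0)).
  apply/polyP=> i; rewrite coef_map coef_poly /=; case: ltnP => [lt|le].
    by rewrite insubT /= -hc.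
  by rewrite raddf0 nth_default.
apply: (liftPP _ _ (map_poly Qmap)) => l; apply: (liftPP _ _ Qmap) => j.
exact: liftP.
Qed.

Lemma mpoly_moved (p : P) mm : p@_mm \notin Crat ->
  exists nu : {rmorphism algC -> algC}, map_mpoly nu p != p.
Proof.
move=> nQ; apply: NNPP => nex; case/negP: nQ; apply: fix_Crat => nu.
rewrite -mcoeff_map_mpoly; congr (_@_mm); apply/eqP; apply: contraT => h.
by case: nex; exists nu.
Qed.

(** If neither product of series has a late coefficient, their truncations factor [Phi] exactly. If
    both factors were rational, [unline] would give a factorisation of [F]; otherwise some
    automorphism moves a coefficient of one of them. *)
Lemma generic_dichotomy w : w != set0 -> w != setT ->
  (generic_late w \/ generic_moved w) \/ (generic_late (~: w) \/ generic_moved (~: w)).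
Proof.
move=> w0 wT; apply: NNPP => no.
have nl : ~ generic_late w by move=> h; apply: no; left; left.
have ncl : ~ generic_late (~: w) by move=> h; apply: no; right; left.
have nM : ((D * n).+1 <= M)%N by move: MD; nia.
have [V [W [DPhi Vm Wm V0 [W0 Vs Ws sV sW]]]] := exact_split nl ncl.
have QV l j mm : V`_l`_j@_mm \in Crat.
  apply: contraT => /mpoly_moved [nu hnu]; case: no; left; right.
  exists V, W; split; [exact: DPhi|exact: Vm|exact: V0|exact: W0|].
  by exists l, j, nu; split; [apply: leq_trans nM; apply: Vs|].
have QW l j mm : W`_l`_j@_mm \in Crat.
  apply: contraT => /mpoly_moved [nu hnu]; case: no; right; right.
  exists W, V; rewrite setCK; split; [by rewrite mulrC|exact: Wm|exact: W0|exact: V0|].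
  by exists l, j, nu; split; [apply: leq_trans nM; apply: Ws|].
have [V' DV] := generic_rational_lift QV; have [W' DW] := generic_rational_lift QW.
pose lineQ : {rmorphism _ -> _} := line u0 (idfun : {rmorphism rat -> rat}).
pose unQ : {rmorphism _ -> _} := @unline m u0 rat.
have QI : injective (Qmap : {mpoly rat[m]} -> P) by apply: map_mpoly_inj; apply: fmorph_inj.
have Qinj : injective (map_poly Qmap : {poly {mpoly rat[m]}} -> {poly P}).
  by apply: map_inj_poly; rewrite // rmorph0.
have lineQE c : map_poly Qmap (lineQ c) = lineC c by apply: line_ratr.
have E : map_poly lineQ F = V' * W'.
  have Qinj2 : injective (map_poly (map_poly Qmap) :
      {poly {poly {mpoly rat[m]}}} -> {poly {poly P}}).
    by apply: map_inj_poly; rewrite // rmorph0.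
  apply: Qinj2; rewrite rmorphM /= -DV -DW -DPhi.
  by apply/polyP=> l; rewrite !coef_map /=; apply: lineQE.
have FE : F = map_poly unQ V' * map_poly unQ W'.
  rewrite -rmorphM -E; apply/polyP=> l; rewrite !coef_map /= [RHS]lineK.
  by apply/mpolyP=> mm; rewrite mcoeff_map_mpoly.
have sz (U : {poly {poly P}}) U' : U \is monic -> U = map_poly (map_poly Qmap) U' ->
    size (map_poly unQ U') = size U.
  have inj0 : map_poly Qmap (0 : {poly {mpoly rat[m]}}) = 0 by apply: rmorph0.
  move=> Um DU; have Um' : lead_coef U' = 1.
    apply: (Qinj); rewrite -(lead_coef_map_inj Qinj inj0) -DU (monicP Um).
    by rewrite rmorph1.
  rewrite DU (size_map_inj_poly Qinj inj0) size_map_poly_id0 // Um' rmorph1.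
  by rewrite oner_eq0.
case: (irr (c := 1) _ (etrans (scale1r _) FE)); rewrite ?oner_neq0 //.
  by rewrite (sz V) // sV ltnS leqn0 cards_eq0 (negPf w0).
rewrite (sz W) // sW ltnS leqn0 cards_eq0 => /eqP cw0.
by case/eqP: wT; rewrite -[w]setCK cw0 setC0.
Qed.

End Direction.
End Hilbert.

Lemma mpoly_prod_nonroot m (I : finType) (w : I -> {mpoly algC[m]}) :
  (forall i, w i != 0) -> exists b : 'I_m -> nat, forall i, (w i).@[fun k => (b k)%:R] != 0.
Proof.
move=> w0; have [|b hb] := @mpoly_nat_nonroot m (\prod_i w i); first exact/prodf_neq0.
by exists b => i; move: hb; rewrite rmorph_prod /= => /prodf_neq0; apply.
Qed.

(** * Choice of a direction, and reduction to one parameter *)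

Section Specialize.

Variables (m n : nat) (F : {poly {mpoly rat[m]}}) (eta : algC).
Hypotheses (n_gt0 : (0 < n)%N) (F_monic : F \is monic) (F_size : size F = n.+1).
Hypothesis irr : forall c U V, c != 0 -> c *: F = U * V ->
  (size U <= 1)%N \/ (size V <= 1)%N.
Hypothesis noroot : forall g : {mpoly algC[m]}, (map_poly (map_mpoly ratr) F).[g] != 0.

Variable u0 : 'I_m -> nat.
Variable a : 'I_n -> algC.
Hypothesis a_inj : injective a.
Hypothesis F_a : pQtoC (map_poly (meval (fun i => (u0 i)%:R)) F) = \prod_i ('X - (a i)%:P).

Local Notation P := {mpoly algC[m]}.
Let lineC : {rmorphism {mpoly rat[m]} -> {poly P}} := line u0 ratC.
Let Phi : {poly {poly P}} := map_poly lineC F.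

Variables (D M : nat) (x : 'I_n -> {poly P}).
Hypothesis PhiD : forall l, (size (Phi`_l)%R <= D.+1)%N.
Hypothesis MD : (D + n.+2 * (D * n) < M)%N.
Hypothesis xa : forall i, (x i)`_0 = (a i)%:MP.
Hypothesis xM : forall i j, (j < n * M)%N -> (Phi.[x i])`_j = 0.

(** Without a late coefficient the truncated series [y] is an exact root, because [Phi.[y]] vanishes
    to order [M] and has degree less than [M]. By [unline] this would be a polynomial root of [F],
    against [noroot]. *)
Lemma series_late i : exists j, [/\ (D * n < j)%N, (j < M)%N & (x i)`_j != 0].
Proof.
apply: NNPP => nex.
pose y := take_poly M (x i).
have ys : (size y <= (D * n).+1)%N.
  apply/leq_sizeP=> j lt; rewrite coef_take_poly; case: ltnP => // jM.
  by apply/eqP; apply: contraT => h; case: nex; exists j.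
have y0 : Phi.[y] = 0.
  apply/polyP=> j; rewrite coef0; have [jM|Mj] := ltnP j M.
    have : (Phi.[x i])`_j = 0 by rewrite xM // (leq_trans jM) // leq_pmull.
    rewrite -{1}[x i](poly_take_drop M) -/y.
    (* By Taylor expansion, discarding the terms of order at least [M] changes the value only from
       order [M] on. *)
    have [q ->] := horner_addr_taylor Phi y (drop_poly M (x i) * 'X^M).
    by rewrite expr2 !mulrA !coefD !coefMXn jM !addr0.
  rewrite nth_default // (leq_trans _ Mj) // horner_coef.
  apply: (leq_trans (size_sum _ _ _)); apply/bigmax_leqP => l _.
  apply: (leq_trans (size_polyMleq _ _)).
  have ln : (l <= n)%N by rewrite -ltnS -(size_line F_monic F_size u0).
  have sl := PhiD l.
  have sy : (size (y ^+ l) <= (n * (D * n)).+1)%N.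
    apply: (leq_trans (size_poly_exp_leq _ _)).
    by rewrite ltnS; nia.
  apply: (@leq_trans (D.+1 + (n * (D * n)).+1).-1).
    by rewrite -!subn1 leq_sub2r // leq_add.
  by move: MD; clear; nia.
have := congr1 (@unline m u0 algC) y0; rewrite /Phi => E.
have /eqP := noroot (@unline m u0 algC y); apply.
rewrite rmorph0 in E; rewrite -[RHS]E -horner_map; congr _.[_].
apply/polyP=> l; rewrite !coef_map /=; apply/esym; exact: lineK.
Qed.

Section AtDirection.

Variable b : 'I_m -> nat.
Let ev : {rmorphism P -> algC} := meval (fun i => (b i)%:R).

Lemma late_at (w : {set 'I_n}) l j : (D * n < j)%N -> (j < M)%N ->
  ((generic_product x w)`_l`_j).@[fun i => (b i)%:R] != 0 ->
  late_coef D M (fun i => map_poly ev (x i)) w.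
Proof.
move=> jD jM nz; exists l, j; split=> //.
have -> : subproduct (fun i => map_poly ev (x i)) w =
    map_poly (map_poly ev) (generic_product x w).
  rewrite /subproduct /generic_product rmorph_prod; apply: eq_bigr => i _.
  exact: esym (map_polyXsubC (map_poly ev) (x i)).
by rewrite !coef_map.
Qed.

Lemma moved_at (w : {set 'I_n}) (V W : {poly {poly P}}) l j (nu : {rmorphism algC -> algC}) :
  Phi = V * W -> V \is monic ->
  map_poly (coefp 0) V = map_poly (@mpolyC m algC) (\prod_(i in w) ('X - (a i)%:P)) ->
  map_poly (coefp 0) W = map_poly (@mpolyC m algC) (\prod_(i in ~: w) ('X - (a i)%:P)) ->
  (size (V`_l)%R <= M)%N ->
  (map_mpoly nu V`_l`_j - V`_l`_j).@[fun i => (b i)%:R] != 0 ->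
  moved_factor M (map_poly (map_poly ev) Phi) a w.
Proof.
move=> DPhi Vm V0 W0 sV nz.
have at0 (U : {poly {poly P}}) A : map_poly (coefp 0) U = map_poly (@mpolyC m algC) A ->
    map_poly (coefp 0) (map_poly (map_poly ev) U) = A.
  move=> U0; apply/polyP=> k; have := congr1 (fun p : {poly P} => ev p`_k) U0.
  by rewrite !coef_map /= !coef_map /= mevalC.
exists (map_poly (map_poly ev) V), (map_poly (map_poly ev) W); split.
- by rewrite DPhi rmorphM.
- by rewrite monic_map.
- exact: at0.
- exact: at0.
exists l, nu; rewrite coef_map; split.
  by apply: leq_trans sV; apply: size_poly.
move/(congr1 (coefp j)); rewrite /= !coef_map /= => E.
case/eqP: nz; rewrite mevalB -E; apply/eqP; rewrite subr_eq0; apply/eqP.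
rewrite -(map_mpoly_meval nu (fun i => (b i)%:R)).
by apply: meval_eq => i; rewrite rmorph_nat.
Qed.

Lemma specialize_direction :
  (forall w, w != set0 -> w != setT ->
     (late_coef D M (fun i => map_poly ev (x i)) w \/
        moved_factor M (map_poly (map_poly ev) Phi) a w) \/
     (late_coef D M (fun i => map_poly ev (x i)) (~: w) \/
        moved_factor M (map_poly (map_poly ev) Phi) a (~: w))) ->
  (forall i, exists j, [/\ (D * n < j)%N, (j < M)%N & (map_poly ev (x i))`_j != 0]) ->
  exists u : 'I_m -> rat, forall y, root (pQtoC (map_poly (meval u) F)) y ->
    size (minCpoly y) = n.+1 /\ forall g : {poly rat}, y <> (pQtoC g).[eta].
Proof.
move=> hsplit hfield.
have PhiE l : (map_poly (map_poly ev) Phi)`_l = map_poly ev (lineC F`_l).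
  by rewrite !coef_map.
have [| | | | | |T T_gt0 hT] := @one_parameter_specialization n D M
    (map_poly (map_poly ev) Phi) a (fun i => map_poly ev (x i)) eta n_gt0
    (M_gt0 MD) _ _ a_inj _ _ _ _ hsplit hfield.
- by rewrite monic_map // monic_line.
- rewrite size_map_poly_id0; first exact: size_line.
  have /monicP -> : Phi \is monic by apply: monic_line.
  by rewrite rmorph1 oner_eq0.
- by move=> i; rewrite coef_map xa /= mevalC.
- by move=> i j jM; rewrite horner_map coef_map xM //= meval0.
- by move=> l; apply: leq_trans (PhiD l); rewrite coef_map; apply: size_poly.
- move=> l j; rewrite PhiE coef_map /=.
  have -> : lineC F`_l = map_poly (map_mpoly (ratr : rat -> algC))
      (line u0 (idfun : {rmorphism rat -> rat}) F`_l) by rewrite line_ratr.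
  rewrite coef_map /=; move: (_`_j) => q.
  have -> : (map_mpoly (ratr : rat -> algC) q).@[fun i => (b i)%:R] =
      ratr q.@[fun i => (b i)%:R].
    rewrite -(map_mpoly_meval ratC).
    by apply: meval_eq => i; rewrite rmorph_nat.
  exact: Crat_rat.
exists (fun i => (u0 i)%:R + (b i)%:R / T%:R) => y ry; apply: hT.
suff -> : eval_inv T (map_poly (map_poly ev) Phi) =
    pQtoC (map_poly (meval (fun i => (u0 i)%:R + (b i)%:R / T%:R)) F) by [].
apply/polyP=> l; rewrite /eval_inv coef_map PhiE !coef_map /=.
exact: line_eval.
Qed.

End AtDirection.

(** Each obstruction, late coefficient or moved coefficient, is witnessed by one nonzero polynomial
    in the direction. There are finitely many, so a single natural direction preserves them all. *)
Lemma generic_specialization : exists u : 'I_m -> rat,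
  forall y, root (pQtoC (map_poly (meval u) F)) y ->
    size (minCpoly y) = n.+1 /\ forall g : {poly rat}, y <> (pQtoC g).[eta].
Proof.
have : forall w : {set 'I_n}, exists2 t : P, t != 0 & forall b : 'I_m -> nat,
    t.@[fun i => (b i)%:R] != 0 -> w != set0 -> w != setT ->
    let ev : {rmorphism P -> algC} := meval (fun i => (b i)%:R) in
    (late_coef D M (fun i => map_poly ev (x i)) w \/
        moved_factor M (map_poly (map_poly ev) Phi) a w) \/
     (late_coef D M (fun i => map_poly ev (x i)) (~: w) \/
        moved_factor M (map_poly (map_poly ev) Phi) a (~: w)).
  have one (w : {set 'I_n}) : generic_late D M x w \/ generic_moved F u0 a M w ->
    exists2 t : P, t != 0 & forall b : 'I_m -> nat, t.@[fun i => (b i)%:R] != 0 ->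
      let ev : {rmorphism P -> algC} := meval (fun i => (b i)%:R) in
      late_coef D M (fun i => map_poly ev (x i)) w \/
        moved_factor M (map_poly (map_poly ev) Phi) a w.
    case=> [[l [j [jD jM nz]]]|[V [W [DPhi Vm V0 W0 [l [j [nu [sV mv]]]]]]]].
      by exists (generic_product x w)`_l`_j => // b hb; left; apply: late_at hb.
    exists (map_mpoly nu V`_l`_j - V`_l`_j); first by rewrite subr_eq0.
    by move=> b hb; right; apply: (moved_at DPhi Vm V0 W0 sV hb).
  move=> w; have [w0|w0] := eqVneq w set0.
    by exists 1 => [|b _]; rewrite ?oner_neq0 // w0 eqxx.
  have [wT|wT] := eqVneq w setT.
    by exists 1 => [|b _ _]; rewrite ?oner_neq0 // wT eqxx.
  case: (generic_dichotomy n_gt0 F_monic F_size irr a_inj PhiD MD xa xM w0 wT).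
    by case/one=> t t0 ht; exists t => // b hb _ _; left; apply: ht.
  by case/one=> t t0 ht; exists t => // b hb _ _; right; apply: ht.
case/fin_all_exists2=> tw tw0 htw.
have [js hjs] := fin_all_exists series_late.
have [|b hb] := @mpoly_prod_nonroot m ({set 'I_n} + 'I_n)%type
  (fun t => match t with inl w => tw w | inr i => (x i)`_(js i) end).
  by case=> [w|i]; [apply: tw0|case: (hjs i)].
apply: (@specialize_direction b).
  by move=> w w0 wT; apply: (htw w b (hb (inl w))).
move=> i; have [jD jM _] := hjs i; exists (js i); split=> //.
by rewrite coef_map; apply: (hb (inr i)).
Qed.

End Specialize.

Theorem hilbert_specialization m n (F : {poly {mpoly rat[m]}}) (eta : algC) :
  (0 < n)%N -> F \is monic -> size F = n.+1 ->
  (forall c U V, c != 0 -> c *: F = U * V -> (size U <= 1)%N \/ (size V <= 1)%N) ->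
  (forall g : {mpoly algC[m]}, (map_poly (map_mpoly ratr) F).[g] != 0) ->
  exists u : 'I_m -> rat, forall y, root (pQtoC (map_poly (meval u) F)) y ->
    size (minCpoly y) = n.+1 /\ forall g : {poly rat}, y <> (pQtoC g).[eta].
Proof.
move=> n_gt0 F_monic F_size irr noroot.
have [u0 sep] := separable_base_point n_gt0 F_monic F_size irr.
set F0 := pQtoC _ in sep.
have F0m : F0 \is monic by rewrite map_monic monic_map.
have F0s : size F0 = n.+1.
  by rewrite size_map_poly size_map_poly_id0 // (monicP F_monic) rmorph1 oner_eq0.
have [r Dr] := closed_field_poly_normal F0.
rewrite (monicP F0m) scale1r in Dr.
have ur : uniq r by rewrite -separable_prod_XsubC -Dr.
have sr : size r = n by apply: succn_inj; rewrite -F0s Dr size_prod_XsubC.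
pose a (i : 'I_n) := r`_i.
have a_inj : injective a.
  by move=> i j /eqP; rewrite nth_uniq ?sr // => /eqP/val_inj.
have F_a : F0 = \prod_i ('X - (a i)%:P).
  by rewrite Dr (big_nth 0) sr big_mkord.
have [D PhiD] := exists_line_degree F u0.
(* [M] exceeds the parameter degrees met on the way: [D] for [Phi], [2 * (D * n)] for a product of
   two truncations, and [D + n * (D * n)] for [Phi] at a truncated series. *)
pose M := (D + n.+2 * (D * n)).+1.
have [x hx] := exists_series a_inj F_a (n * M)%N.
apply: (generic_specialization eta n_gt0 F_monic F_size irr noroot a_inj PhiD (ltnSn _)
  (fun i => (hx i).1)) => i j; exact: (hx i).2.
Qed.

(** * Substitution in homogeneous polynomials *)

Lemma mpoly_ring_ind n (R : comNzRingType) (Q : {mpoly R[n]} -> Prop) :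
  (forall c, Q c%:MP) -> (forall i, Q 'X_i) ->
  (forall p q, Q p -> Q q -> Q (p + q)) -> (forall p q, Q p -> Q q -> Q (p * q)) ->
  forall p, Q p.
Proof.
move=> QC QX QD QM p; rewrite (mpolyE p); apply: (big_ind Q) => [|p1 q1|mm _]; [|exact: QD|].
  by rewrite -mpolyC0; apply: QC.
rewrite -mul_mpolyC; apply: (QM) => //; rewrite mpolyXE_id.
apply: (big_ind Q) => [|p1 q1|i _]; [by rewrite -mpolyC1; apply: QC|exact: QM|].
elim: (mm i) => [|k IH]; first by rewrite expr0 -mpolyC1; apply: QC.
by rewrite exprS; apply: QM.
Qed.

Lemma mmap_morph n (R S S' : comNzRingType) (j : {rmorphism R -> S}) (j' : {rmorphism R -> S'})
    (phi : {rmorphism S -> S'}) (y : 'I_n -> S) (y' : 'I_n -> S') p :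
  (forall c, phi (j c) = j' c) -> (forall i, phi (y i) = y' i) ->
  phi (mmap j y p) = mmap j' y' p.
Proof.
move=> hj hy; have := @mpoly_rmorph_ext n R S' (phi \o mmap j y) (mmap j' y') _ _ p.
apply=> [c|i] /=; first by rewrite !mmapC hj.
by rewrite !mmapX !mmap1U hy.
Qed.

Lemma mmap_meval n (R S : comNzRingType) (j : {rmorphism R -> S}) (y : 'I_n -> S) p :
  mmap j y p = (map_mpoly j p).@[y].
Proof.
have := @mpoly_rmorph_ext n R S (mmap j y) (meval y \o map_mpoly j) _ _ p.
apply=> [c|i] /=; first by rewrite mmapC map_mpolyC mevalC.
by rewrite map_mpolyX mmapX mmap1U mevalXU.
Qed.

Lemma mderivXU n (R : comNzRingType) (i k : 'I_n) :
  mderiv i ('X_k : {mpoly R[n]}) = (k == i)%:R%:MP.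
Proof.
rewrite mderivX mnm1E; case: eqP => [->|_]; last by rewrite scale0r mpolyC0.
by rewrite scale1r (_ : (_ - _)%MM = 0%MM) ?mpolyX0 ?mpolyC1 //; apply/mnmP=> l; rewrite mnmBE subnn mnm0E.
Qed.

Lemma mmap_chain_rule n (R S : comNzRingType) (j : {rmorphism R -> S})
    (y : 'I_n -> {poly S}) p :
  (mmap (polyC \o j) y p)^`() = \sum_i mmap (polyC \o j) y (mderiv i p) * (y i)^`().
Proof.
elim/mpoly_ring_ind: p => [c|k|p q IHp IHq|p q IHp IHq].
- by rewrite mmapC derivC big1 // => i _; rewrite mderivC raddf0 mul0r.
- rewrite mmapX mmap1U (bigD1 k) //= big1 ?addr0 => [|i ik].
    by rewrite mderivXU eqxx mpolyC1 rmorph1 mul1r.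
  by rewrite mderivXU eq_sym (negPf ik) mpolyC0 rmorph0 mul0r.
- rewrite rmorphD /= derivD IHp IHq -big_split; apply: eq_bigr => i _ /=.
  by rewrite mderivD rmorphD mulrDl.
rewrite rmorphM /= derivM IHp IHq mulr_suml mulr_sumr -big_split.
apply: eq_bigr => i _ /=; rewrite mderivM rmorphD !rmorphM /=; ring.
Qed.

Lemma top_coef_mul (S : comNzRingType) (q r : {poly S}) A B :
  (size q <= A.+1)%N -> (size r <= B.+1)%N ->
  (size (q * r)%R <= (A + B).+1)%N /\ (q * r)`_(A + B) = q`_A * r`_B.
Proof.
move=> sq sr; split.
  apply: (leq_trans (size_polyMleq _ _)).
  by move: sq sr; lia.
have lA : (A < (A + B).+1)%N by rewrite ltnS leq_addr.
rewrite coefM (bigD1 (Ordinal lA)) //= addKn big1 ?addr0 // => i iA.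
have [lt|gt|Ei] := ltngtP i A.
- rewrite [r`_ _]nth_default ?mulr0 // (leq_trans sr) //.
  by move: lt; lia.
- by rewrite [q`_ _]nth_default ?mul0r // (leq_trans sq).
by case/eqP: iA; apply: val_inj.
Qed.

Lemma top_coef_exp (S : comNzRingType) (p : {poly S}) e k : (size p <= e.+1)%N ->
  (size (p ^+ k)%R <= (e * k).+1)%N /\ (p ^+ k)`_(e * k) = p`_e ^+ k.
Proof.
move=> sp; elim: k => [|k [IHs IHc]]; first by rewrite muln0 !expr0 coef1 size_poly1.
by rewrite !exprS mulnS -IHc; apply: top_coef_mul.
Qed.

Lemma top_coef_prod (S : comNzRingType) n (y : 'I_n -> {poly S}) (e : nat) (k : 'I_n -> nat) :
  (forall i, (size (y i) <= e.+1)%N) ->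
  (size (\prod_i y i ^+ k i)%R <= (e * \sum_i k i).+1)%N /\
  (\prod_i y i ^+ k i)`_(e * \sum_i k i) = \prod_i (y i)`_e ^+ k i.
Proof.
move=> sy; rewrite !unlock; elim: (index_enum _) => [|i s [IHs IHc]] /=.
  by rewrite muln0 coef1 size_poly1.
have [si ci] := top_coef_exp (k i) (sy i).
by rewrite mulnDr -ci -IHc; apply: top_coef_mul.
Qed.

(** Every monomial is a product of [d] factors of degree at most [e], so degree [e * d] is reached
    only through their coefficients of index [e]. *)
Lemma homog_top_coef n (R S : comNzRingType) (j : {rmorphism R -> S}) d (p : {mpoly R[n]})
    (y : 'I_n -> {poly S}) e : p \is d.-homog -> (forall i, (size (y i) <= e.+1)%N) ->
  (size (mmap (polyC \o j) y p) <= (e * d).+1)%N /\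
  (mmap (polyC \o j) y p)`_(e * d) = mmap j (fun i => (y i)`_e) p.
Proof.
move=> /dhomogP hp sy; rewrite /mmap !big_seq; split.
  apply: (leq_trans (size_sum _ _ _)); apply/bigmax_leqP_seq => mm mp _.
  rewrite /= mul_polyC (leq_trans (size_scale_leq _ _)) //.
  have := (top_coef_prod mm sy).1; have /= := hp mm mp.
  by rewrite mdegE => ->.
rewrite coef_sum; apply: eq_bigr => mm mp.
have := (top_coef_prod mm sy).2; have /= := hp mm mp.
by rewrite mdegE /= => -> E; rewrite coefCM E.
Qed.

Lemma homog_scale n (R S : comNzRingType) (j : {rmorphism R -> S}) d (p : {mpoly R[n]})
    (y : 'I_n -> S) l : p \is d.-homog ->
  mmap j (fun i => l * y i) p = l ^+ d * mmap j y p.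
Proof.
move=> /dhomogP hp; rewrite /mmap !big_seq mulr_sumr; apply: eq_bigr => mm mp.
rewrite mulrCA; congr (_ * _); have /= := hp mm mp; rewrite mdegE => <-.
by rewrite /mmap1 -prodrXr -big_split /=; apply: eq_bigr => i _; rewrite exprMn.
Qed.

Section LinearSubstitution.

Variable m : nat.

Definition lsub (V : 'M[rat]_m) : {mpoly rat[m]} -> {mpoly rat[m]} :=
  mmap (@mpolyC m rat) (fun i => \sum_r V r i *: 'X_r).

HB.instance Definition _ V := GRing.RMorphism.on (lsub V).

Lemma lsub_X V i : lsub V 'X_i = \sum_r V r i *: 'X_r.
Proof. by rewrite /lsub mmapX mmap1U. Qed.

Lemma lsub_C V c : lsub V c%:MP = c%:MP.
Proof. by rewrite /lsub mmapC. Qed.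

Lemma lsubK V W : V *m W = 1%:M -> cancel (lsub W) (lsub V).
Proof.
move=> VW p; have := @mpoly_rmorph_ext m _ _ (lsub V \o lsub W) idfun _ _ p.
apply=> [c|i] /=; first by rewrite !lsub_C.
rewrite lsub_X rmorph_sum /=.
transitivity (\sum_s (V *m W) s i *: ('X_s : {mpoly rat[m]})).
  under eq_bigr => r _ do rewrite -mul_mpolyC rmorphM /= lsub_C lsub_X mul_mpolyC scaler_sumr.
  rewrite exchange_big; apply: eq_bigr => s _ /=; rewrite mxE scaler_suml.
  by apply: eq_bigr => r _; rewrite scalerA mulrC.
rewrite VW (bigD1 i) //= mxE eqxx scale1r big1 ?addr0 // => s si.
by rewrite mxE (negPf si) scale0r.
Qed.

Lemma mmap_lsub (S : comNzRingType) (j : {rmorphism rat -> S}) (y : 'I_m -> S) V p :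
  mmap j y (lsub V p) = mmap j (fun i => \sum_r j (V r i) * y r) p.
Proof.
apply: (@mmap_morph m rat _ S (@mpolyC m rat) j (mmap j y)) => [c|i].
  by rewrite /= mmapC.
rewrite /= rmorph_sum; apply: eq_bigr => r _ /=.
by rewrite -mul_mpolyC rmorphM /= mmapC mmapX mmap1U.
Qed.

Lemma lsub_prime V W p : V *m W = 1%:M -> W *m V = 1%:M -> prime_elt p -> prime_elt (lsub V p).
Proof. by move=> /lsubK VK /lsubK WK; apply: prime_elt_iso WK VK. Qed.

Lemma lsub_homog V d p : p \is d.-homog -> lsub V p \is d.-homog.
Proof.
move=> /dhomogP hp; rewrite /lsub /mmap big_seq; apply: rpred_sum => mm mp.
rewrite mul_mpolyC; apply: rpredZ.
have /= := hp mm mp; rewrite mdegE => <-.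
apply: (big_ind2 (fun (q : {mpoly rat[m]}) k => q \is k.-homog)) => [|q e q' e' hq hq'|i _].
- exact: dhomog1.
- exact: dhomogM.
rewrite -[X in X.-homog]mul1n; apply: dhomogMn.
by apply: rpred_sum => r _; apply: rpredZ; rewrite dhomogX /= mdeg1.
Qed.

End LinearSubstitution.

(** * The family of curves *)

Lemma rat_rmorph_eq (S : nzRingType) (j j' : {rmorphism rat -> S}) : j =1 j'.
Proof.
move=> x; have d0 : (denq x)%:~R != 0 :> rat by rewrite intr_eq0 denq_neq0.
have E (i : {rmorphism rat -> S}) : i x * i (denq x)%:~R = (numq x)%:~R.
  by rewrite -rmorphM /= -[x in x * _]divq_num_den divfK // rmorph_int.
have cancel_den : j (denq x)%:~R * j (denq x)%:~R^-1 = 1.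
  by rewrite -rmorphM /= mulfV ?rmorph1.
have := congr1 (fun y => y * j (denq x)%:~R^-1) (etrans (E j) (esym (E j'))).
by rewrite !rmorph_int -!(rmorph_int j) -!mulrA cancel_den !mulr1.
Qed.

Lemma mmap_eq n (R S : nzRingType) (j : R -> S) (y y' : 'I_n -> S) p :
  y =1 y' -> mmap j y p = mmap j y' p.
Proof. by move=> E; apply: eq_bigr => mm _; rewrite (mmap1_eq _ E). Qed.

Lemma mpolyC_inj n (R : nzRingType) : injective (@mpolyC n R).
Proof. exact: can_inj (@mpolyCK n R). Qed.

Section Point.

Variable N : nat.

Definition pt (S : Type) (x0 x1 : S) (z : 'I_N -> S) (i : 'I_(2 + N)) : S :=
  match split i with inl j => if j == 0 then x0 else x1 | inr k => z k end.

Lemma pt0 S (x0 x1 : S) z : pt x0 x1 z (lshift N 0) = x0.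
Proof. by rewrite /pt (unsplitK (inl _ : 'I_2 + 'I_N)). Qed.

Lemma pt1 S (x0 x1 : S) z : pt x0 x1 z (lshift N 1) = x1.
Proof. by rewrite /pt (unsplitK (inl _ : 'I_2 + 'I_N)). Qed.

Lemma ptr S (x0 x1 : S) z k : pt x0 x1 z (rshift 2 k) = z k.
Proof. by rewrite /pt (unsplitK (inr _ : 'I_2 + 'I_N)). Qed.

Lemma pt_ind (Q : 'I_(2 + N) -> Prop) :
  Q (lshift N 0) -> Q (lshift N 1) -> (forall k, Q (rshift 2 k)) -> forall i, Q i.
Proof.
move=> Q0 Q1 Qr i; case: (split_ordP i) => [k|k] ->; last exact: Qr.
case: k => [[|[|k]] lt] //.
- by rewrite (_ : Ordinal lt = 0) //; apply: val_inj.
- by rewrite (_ : Ordinal lt = 1) //; apply: val_inj.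
Qed.

Lemma sum_pt (S : nmodType) (F : 'I_(2 + N) -> S) :
  \sum_i F i = F (lshift N 0) + F (lshift N 1) + \sum_k F (rshift 2 k).
Proof. by rewrite big_split_ord /= big_ord_recl big_ord1; congr (_ + F _ + _); apply: val_inj. Qed.

End Point.

Section Construction.

Variables (N d a q : nat) (h : {mpoly rat[2 + N]}) (eta : 'I_N -> rat).
Variables (th : 'I_a -> algC) (ze : 'I_a -> 'I_N -> algC).
Variables (A : {poly rat}) (c0 : 'I_N -> {poly rat}).

Hypotheses (d_gt0 : (0 < d)%N) (h_homog : h \is d.-homog) (h_prime : prime_elt h).
Hypothesis h_eta : h.@[pt 0 0 eta] != 0.
Hypotheses (th_inj : injective th) (A_def : pQtoC A = \prod_s ('X - (th s)%:P)).
Hypothesis c0_size : forall k, (size (c0 k) <= a)%N.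
Hypothesis c0_th : forall s k, (pQtoC (c0 k)).[th s] = ze s k.
Hypothesis h_ze : forall s, mmap ratr (pt 1 (th s) (ze s)) h = 0.
Hypothesis h_dir : forall s,
  \sum_k mmap ratr (pt 1 (th s) (ze s)) (mderiv (rshift 2 k) h) * ratr (eta k) != 0.
Hypothesis q_ge : (a.+2 <= q)%N.

Section Curve.

Variables (S : comNzRingType) (j : {rmorphism rat -> S}).

(** The ring [S] is left open because the same curve is used with [t] and [u] as indeterminates, as
    algebraic numbers and as polynomials along a line; [hcurve_morph] passes between these. *)
Definition curve_tail (t : S) (u : 'I_N -> S) (k : 'I_N) : S :=
  (map_poly j (c0 k)).[t] + (map_poly j A).[t] * (t ^+ q * j (eta k) + u k).

Definition curve t u : 'I_(2 + N) -> S := pt 1 t (curve_tail t u).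

Definition hcurve t u : S := mmap j (curve t u) h.

End Curve.

Lemma horner_morph_nat (S S' : comNzRingType) (j : {rmorphism rat -> S}) (j' : {rmorphism rat -> S'})
  (phi : {rmorphism S -> S'}) p t : phi (map_poly j p).[t] = (map_poly j' p).[phi t].
Proof.
rewrite -horner_map -map_poly_comp; congr _.[_]; apply: eq_map_poly => x /=.
exact: (rat_rmorph_eq (phi \o j) j').
Qed.

Lemma curve_morph (S S' : comNzRingType) (j : {rmorphism rat -> S}) (j' : {rmorphism rat -> S'})
  (phi : {rmorphism S -> S'}) t u i : phi (curve j t u i) = curve j' (phi t) (phi \o u) i.
Proof.
rewrite /curve; elim/pt_ind: i => [||k]; rewrite ?pt0 ?pt1 ?ptr ?rmorph1 //=.
rewrite /curve_tail rmorphD rmorphM /= !(horner_morph_nat _ j') rmorphD rmorphM rmorphXn /=.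
by have /= -> := rat_rmorph_eq (phi \o j) j' (eta k).
Qed.

Lemma hcurve_morph (S S' : comNzRingType) (j : {rmorphism rat -> S}) (j' : {rmorphism rat -> S'})
  (phi : {rmorphism S -> S'}) t u : phi (hcurve j t u) = hcurve j' (phi t) (phi \o u).
Proof.
apply: mmap_morph => [c|i]; last exact: curve_morph.
exact: (rat_rmorph_eq (phi \o j) j').
Qed.

Lemma hcurve_eq (S : comNzRingType) (j : {rmorphism rat -> S}) t u u' :
  u =1 u' -> hcurve j t u = hcurve j t u'.
Proof.
move=> E; apply: mmap_eq; rewrite /curve; elim/pt_ind => [||k]; rewrite ?pt0 ?pt1 ?ptr //.
by rewrite /curve_tail E.
Qed.

Lemma size_A : size A = a.+1.
Proof. by rewrite -(size_map_poly ratC) A_def size_prod_XsubC_in card_ord. Qed.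

Lemma A_monic : A \is monic.
Proof. by rewrite -(map_monic ratC) A_def monic_prod_XsubC. Qed.

Let P := {mpoly rat[N]}.
Let PC := {mpoly algC[N]}.

Definition hpoly : {poly P} := hcurve (polyC \o @mpolyC N rat) 'X (fun k => ('X_k)%:P).

Definition Apoly : {poly P} := map_poly (@mpolyC N rat) A.

Definition Bpoly : {poly P} := Pdiv.Ring.rdivp hpoly Apoly.

Lemma Apoly_monic : Apoly \is monic.
Proof. exact: monic_map A_monic. Qed.

Definition toPC : {poly P} -> {poly PC} := map_poly (map_mpoly ratC).
HB.instance Definition _ := GRing.RMorphism.on toPC.

Lemma toPC_Apoly : toPC Apoly = map_poly (@mpolyC N algC \o ratC) A.
Proof.
rewrite /toPC /Apoly -map_poly_comp; apply: eq_map_poly => c /=.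
by rewrite map_mpolyC.
Qed.

Lemma horner_Apoly t : (toPC Apoly).[t%:MP_[N]] = (pQtoC A).[t]%:MP_[N].
Proof.
rewrite toPC_Apoly.
by rewrite -(horner_morph_nat ratC (@mpolyC N algC \o ratC) (@mpolyC N algC)).
Qed.

Lemma toPC_X : toPC 'X = 'X. Proof. exact: map_polyX. Qed.

Lemma toPC_C c : toPC c%:P = (map_mpoly ratC c)%:P. Proof. exact: map_polyC. Qed.

Lemma A_root s : (pQtoC A).[th s] = 0.
Proof. by rewrite A_def (bigD1 s) //= hornerM hornerXsubC subrr mul0r. Qed.

Lemma A_nonroot_cases x : (pQtoC A).[x] = 0 -> exists s, x = th s.
Proof.
rewrite A_def horner_prod => /eqP; rewrite prodf_seq_eq0 => /hasP[s _ /=].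
by rewrite hornerXsubC subr_eq0 => /eqP; exists s.
Qed.

Lemma curve_at_th s (u : 'I_N -> algC) : @curve algC ratC (th s) u =1 pt 1 (th s) (ze s).
Proof.
by elim/pt_ind => [||k]; rewrite /curve ?pt0 ?pt1 ?ptr // /curve_tail /= A_root mul0r addr0 c0_th.
Qed.

Lemma hcurve_at_th s (u : 'I_N -> algC) : @hcurve algC ratC (th s) u = 0.
Proof. by rewrite -[RHS](h_ze s); apply: mmap_eq; apply: curve_at_th. Qed.

Lemma toPC_hpoly : toPC hpoly = @hcurve {poly PC} (polyC \o @mpolyC N algC \o ratC) 'X
  (fun k => ('X_k)%:P).
Proof.
rewrite /hpoly (hcurve_morph _ (polyC \o @mpolyC N algC \o ratC) toPC).
rewrite /= toPC_X; apply: hcurve_eq => k.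
by rewrite /= toPC_C map_mpolyX.
Qed.

Lemma horner_hpoly (t : PC) : (toPC hpoly).[t] = hcurve (@mpolyC N algC \o ratC) t (fun k => 'X_k).
Proof.
have := hcurve_morph (polyC \o @mpolyC N algC \o ratC) (@mpolyC N algC \o ratC)
  (horner_eval t) 'X (fun k => ('X_k)%:P).
rewrite -toPC_hpoly /= /horner_eval hornerX => ->.
by apply: hcurve_eq => k /=; rewrite /horner_eval hornerC.
Qed.

(** All curves pass through the given points, so the remainder, of degree less than [a], vanishes at
    the [a] distinct values [th s]. *)
Lemma rmodp_hpoly : Pdiv.Ring.rmodp hpoly Apoly = 0.
Proof.
have inj : injective toPC.
  by apply: map_inj_poly; [apply/map_mpoly_inj/fmorph_inj|rewrite rmorph0].
apply: inj; rewrite [RHS]rmorph0.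
pose r := [seq (th s)%:MP_[N] | s <- enum 'I_a].
apply: (@roots_geq_poly_eq0 _ _ r).
- apply/allP => _ /mapP[s _ ->]; rewrite /root.
  have := congr1 (fun p => (toPC p).[(th s)%:MP_[N]]) (Pdiv.RingMonic.rdivp_eq Apoly_monic hpoly).
  rewrite rmorphD rmorphM hornerD hornerM horner_hpoly /=.
  rewrite horner_Apoly A_root mulr0 add0r => /esym ->; apply/eqP.
  rewrite -[RHS](rmorph0 (@mpolyC N algC)) -(hcurve_at_th s (fun _ => 0)).
  rewrite /hcurve; apply/esym; apply: mmap_morph => // i.
  rewrite curve_at_th; rewrite /curve; elim/pt_ind: i => [||k]; rewrite ?pt0 ?pt1 ?ptr ?mpolyC1 //.
  rewrite /curve_tail -!(horner_morph_nat ratC (@mpolyC N algC \o ratC) (@mpolyC N algC)) /=.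
  by rewrite A_root c0_th mpolyC0 mul0r addr0.
- by rewrite map_inj_uniq ?enum_uniq // => x y /mpolyC_inj /th_inj.
rewrite size_map size_enum_ord (leq_trans (size_poly _ _)) //.
have := Pdiv.Ring.ltn_rmodp hpoly Apoly.
rewrite monic_neq0 ?Apoly_monic // size_map_inj_poly ?mpolyC0 ?size_A //.
exact: mpolyC_inj.
Qed.

Lemma hpoly_fact : hpoly = Bpoly * Apoly.
Proof. by rewrite {1}(Pdiv.RingMonic.rdivp_eq Apoly_monic hpoly) rmodp_hpoly addr0. Qed.

(** The first two coordinates, 1 and [t], have degree less than [e], so in degree [e * d] only the
    point [(0 : 0 : v)] is seen. *)
Lemma hcurve_top (S : comNzRingType) (j : {rmorphism rat -> S}) e r (t : {poly S}) (u : 'I_N -> {poly S})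
  (v : 'I_N -> S) : (size t <= r)%N -> (0 < r)%N -> (r <= e)%N ->
  (forall k, (size (curve_tail (polyC \o j) t u k) <= e.+1)%N /\
     (curve_tail (polyC \o j) t u k)`_e = v k) ->
  (size (hcurve (polyC \o j) t u) <= (e * d).+1)%N /\
   (hcurve (polyC \o j) t u)`_(e * d) = mmap j (pt 0 0 v) h.
Proof.
move=> st r0 re hw; rewrite /hcurve.
have := @homog_top_coef _ _ _ j d h (curve (polyC \o j) t u) e h_homog _.
case=> [|-> ->].
  rewrite /curve; elim/pt_ind => [||k]; rewrite ?pt0 ?pt1 ?ptr ?size_poly1 //.
  + by rewrite (leq_trans st) // (leq_trans re).
  + by case: (hw k).
split=> //; apply: mmap_eq; rewrite /curve; elim/pt_ind => [||k]; rewrite ?pt0 ?pt1 ?ptr.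
- by rewrite coef1; case: (e) r0 re => //; case: (r).
- by rewrite nth_default // (leq_trans st).
- by case: (hw k).
Qed.

Lemma h_eta_scale c : c != 0 -> mmap ratC (pt 0 0 (fun k => c * ratC (eta k))) h != 0.
Proof.
move=> c0'; have -> : mmap ratC (pt 0 0 (fun k => c * ratC (eta k))) h =
    mmap ratC (fun i => c * ratC (pt 0 0 eta i)) h.
  by apply: mmap_eq; elim/pt_ind => [||k]; rewrite ?pt0 ?pt1 ?ptr ?rmorph0 ?mulr0.
rewrite (homog_scale _ _ _ h_homog) mulf_neq0 ?expf_neq0 //.
have <- : ratC h.@[pt 0 0 eta] = mmap ratC (fun i => ratC (pt 0 0 eta i)) h.
  exact: (@mmap_morph _ _ _ _ idfun).
by rewrite fmorph_eq0.
Qed.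

Lemma horner_comp_poly (p : {poly rat}) (t : {poly algC}) :
  (map_poly (polyC \o ratC) p).[t] = pQtoC p \Po t.
Proof. by rewrite /comp_poly map_poly_comp. Qed.

(** For nonconstant [t] the term [t^q eta] dominates [X eta], since [q >= 2]; the top coefficient is
    the value of [h] at a nonzero multiple of [(0 : 0 : eta)]. *)
Lemma line_nonconst (t : {poly algC}) : (1 < size t)%N ->
  hcurve (polyC \o ratC) t (fun k => ratC (eta k) *: 'X) != 0.
Proof.
move=> st; set l := lead_coef t; pose e0 := (size t).-1.
have e0_gt0 : (0 < e0)%N by rewrite /e0; case: (size t) st => [|[]].
have st' : size t = e0.+1 by rewrite prednK // ltnW.
have [||||_ top] := @hcurve_top _ ratC (e0 * (a + q)) (size t) t (fun k => ratC (eta k) *: 'X)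
  (fun k => l ^+ (a + q) * ratC (eta k)).
- by [].
- by rewrite st'.
- by rewrite st'; move: q_ge e0_gt0; nia.
- move=> k; rewrite /curve_tail !horner_comp_poly.
  have sc : (size (pQtoC (c0 k) \Po t) <= e0 * (a + q))%N.
    apply: (leq_trans (size_comp_poly_leq _ _)); rewrite -/e0 size_map_poly.
    apply: (@leq_trans (a * e0).+1); first by rewrite ltnS leq_mul2r (leq_trans (leq_pred _)) ?orbT.
    by move: q_ge e0_gt0; nia.
  have sA : (size (pQtoC A \Po t) <= (e0 * a).+1)%N.
    apply: (leq_trans (size_comp_poly_leq _ _)); rewrite -/e0 size_map_poly size_A /=.
    by rewrite mulnC.
  have cA : (pQtoC A \Po t)`_(e0 * a) = l ^+ a.
    have := lead_coef_comp (pQtoC A) st; rewrite lead_coef_map (monicP A_monic) rmorph1 mul1r.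
    rewrite size_map_poly size_A /= => <-; rewrite lead_coefE size_comp_poly.
    by rewrite size_map_poly size_A mulnC.
  have [sq cq] : (size (t ^+ q)%R <= (e0 * q).+1)%N /\ (t ^+ q)`_(e0 * q) = l ^+ q.
    have := top_coef_exp q (_ : size t <= e0.+1)%N; rewrite {1}st' => /(_ (leqnn _)).
    by rewrite -[t`_e0]lead_coefE.
  pose w := t ^+ q * ((ratC (eta k))%:P : {poly algC}) + ratC (eta k) *: 'X.
  have sw : (size w <= (e0 * q).+1)%N.
    apply: (leq_trans (size_polyD _ _)); rewrite geq_max mulrC mul_polyC.
    rewrite (leq_trans (size_scale_leq _ _)) // (leq_trans (size_scale_leq _ _)) // size_polyX.
    by move: q_ge e0_gt0; nia.
  have cw : w`_(e0 * q) = l ^+ q * ratC (eta k).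
    rewrite coefD mulrC mul_polyC !coefZ cq coefX.
    have -> : (e0 * q == 1)%N = false by apply/negbTE; move: q_ge e0_gt0; nia.
    by rewrite mulr0 addr0 mulrC.
  have [sAw cAw] := top_coef_mul sA sw; rewrite -mulnDr in sAw cAw.
  split; first by rewrite (leq_trans (size_polyD _ _)) // geq_max sAw ltnW.
  by rewrite coefD [_`_ _]nth_default // add0r cAw cA cw mulrA -exprD.
apply: contraTneq (h_eta_scale (_ : l ^+ (a + q) != 0)) => [E|].
  by rewrite -top E coef0 eqxx.
by rewrite expf_neq0 // lead_coef_eq0 -size_poly_gt0 st'.
Qed.

(** For constant [t] away from the roots of [A] the tail is linear in [X] with slope [A(x) eta], and
    again [h] at a multiple of [(0 : 0 : eta)] appears. *)
Lemma line_const (x : algC) : (pQtoC A).[x] != 0 ->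
  hcurve (polyC \o ratC) x%:P (fun k => ratC (eta k) *: 'X) != 0.
Proof.
move=> Ax.
have [||||_ top] := @hcurve_top _ ratC 1 1 x%:P (fun k => ratC (eta k) *: 'X)
  (fun k => (pQtoC A).[x] * ratC (eta k)).
- by rewrite size_polyC_leq1.
- by [].
- by [].
- move=> k; rewrite /curve_tail !horner_comp_poly !comp_polyCr -rmorphXn -rmorphM.
  split.
    apply: (leq_trans (size_polyD _ _)); rewrite geq_max (leq_trans (size_polyC_leq1 _)) //.
    rewrite mul_polyC (leq_trans (size_scale_leq _ _)) // (leq_trans (size_polyD _ _)) //.
    rewrite geq_max (leq_trans (size_polyC_leq1 _)) //.
    by rewrite (leq_trans (size_scale_leq _ _)) // size_polyX.
  by rewrite coefD coefC add0r mul_polyC coefZ coefD coefC add0r coefZ coefX mulr1.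
by apply: contraTneq (h_eta_scale Ax) => E; rewrite -top E coef0 eqxx.
Qed.

Lemma A_deriv s : (pQtoC A)^`().[th s] != 0.
Proof.
rewrite A_def (bigD1 s) //= derivM derivXsubC mul1r hornerD hornerM hornerXsubC subrr mul0r addr0.
rewrite horner_prod; apply/prodf_neq0 => s' s's.
by rewrite hornerXsubC subr_eq0 (inj_eq th_inj) eq_sym.
Qed.

(* Restriction to the line [u = X eta] of the parameter space. *)
Definition along : PC -> {poly algC} := mmap (polyC : algC -> {poly algC}) (fun k => ratC (eta k) *: 'X).
HB.instance Definition _ := GRing.RMorphism.on along.

Lemma along_X k : along 'X_k = ratC (eta k) *: 'X.
Proof. by rewrite /along mmapX mmap1U. Qed.

Lemma along_C c : along c%:MP = c%:P.
Proof. exact: mmapC. Qed.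

Lemma along_hpoly g : along (toPC hpoly).[g] =
  hcurve (polyC \o ratC) (along g) (fun k => ratC (eta k) *: 'X).
Proof.
rewrite horner_hpoly (hcurve_morph _ (polyC \o ratC)).
by apply: hcurve_eq => k /=; rewrite along_X.
Qed.

Lemma horner_polyC_X (R : comNzRingType) (p : {poly R}) : (map_poly polyC p).['X] = p.
Proof. exact: comp_polyXr. Qed.

(* At a root of [A] the equation on the curve vanishes for every [u]; the value of
   [B] is read off the derivative in [t]. *)
Lemma along_tangent (g : PC) s : along g = (th s)%:P -> (toPC Bpoly).[g] != 0.
Proof.
move=> gs; apply/eqP => B0.

pose phi : {rmorphism {poly PC} -> {poly {poly algC}}} := map_poly along.
pose y := curve (polyC \o (polyC \o ratC)) 'X (fun k => (ratC (eta k) *: 'X)%:P : {poly {poly algC}}).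
have phi_h : phi (toPC hpoly) = mmap (polyC \o (polyC \o ratC)) y h.
  rewrite toPC_hpoly (hcurve_morph _ (polyC \o (polyC \o ratC)) phi).
  rewrite /= /phi map_polyX; apply: hcurve_eq => k /=.
  by rewrite map_polyC /= along_X.
have phi_A : phi (toPC Apoly) = map_poly polyC (pQtoC A).
  rewrite toPC_Apoly /phi /= -!map_poly_comp; apply: eq_map_poly => c /=; exact: along_C.
(* In the derivative of [B A] both terms vanish here: one contains [A], the other contains [B] at
   the supposed root. *)
have deriv0 : (phi (toPC hpoly))^`().[(th s)%:P] = 0.
  rewrite hpoly_fact !rmorphM derivM hornerD !hornerM phi_A horner_map /= A_root polyC0 mulr0 add0r.
  by rewrite -gs horner_map B0 rmorph0 mul0r.
have ys i : (y i).[(th s)%:P] = (pt 1 (th s) (ze s) i)%:P.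
  have := curve_morph (polyC \o (polyC \o ratC)) (polyC \o ratC) (horner_eval (th s)%:P)
    'X (fun k => (ratC (eta k) *: 'X)%:P) i.
  rewrite -/y /= {1}/horner_eval => ->; rewrite /curve; elim/pt_ind: i => [||k]; rewrite ?pt0 ?pt1 ?ptr //.
    by rewrite /horner_eval hornerX.
  rewrite /curve_tail /horner_eval /= hornerX hornerC.
  rewrite !horner_comp_poly !comp_polyCr A_root c0_th.
  by rewrite mul0r addr0.
have dy0 : ((y (lshift N 0))^`().[(th s)%:P])`_1 = 0.
  by rewrite /y /curve pt0 derivC horner0 coef0.
have dy1 : ((y (lshift N 1))^`().[(th s)%:P])`_1 = 0.
  by rewrite /y /curve pt1 derivX hornerC coef1.
have XE p : (map_poly (polyC \o (polyC \o ratC)) p : {poly {poly {poly algC}}}).['X] = map_poly polyC (pQtoC p).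
  by rewrite -[RHS]horner_polyC_X -!map_poly_comp.
have dyr k : ((y (rshift 2 k))^`().[(th s)%:P])`_1 = (pQtoC A)^`().[th s] * ratC (eta k).
  rewrite /y /curve ptr /curve_tail !XE derivD derivM !(hornerD, hornerM).
  rewrite !deriv_map !horner_map /= A_root polyC0 mul0r addr0.
  rewrite coefD coefC add0r coefCM coefD.
  by rewrite hornerXn !hornerC -rmorphXn -rmorphM coefC add0r coefZ coefX mulr1.
(* In the coefficient of [X] only the tail coordinates contribute; what remains is [A'(th s)] times
   the directional derivative of [h], nonzero by [h_dir]. *)
have := congr1 (fun p : {poly algC} => p`_1) deriv0.
rewrite phi_h (mmap_chain_rule (polyC \o ratC)) horner_sum coef_sum coef0 => E.
have mE i : (mmap (polyC \o (polyC \o ratC)) y (mderiv i h)).[(th s)%:P] =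
    (mmap ratC (pt 1 (th s) (ze s)) (mderiv i h))%:P.
  have E1 : horner_eval (th s)%:P (mmap (polyC \o (polyC \o ratC)) y (mderiv i h)) =
      mmap (polyC \o ratC) (fun i => (pt 1 (th s) (ze s) i)%:P) (mderiv i h).
    by apply: mmap_morph => [c|k]; rewrite /= /horner_eval ?hornerC ?ys.
  rewrite [LHS]E1; symmetry; exact: (@mmap_morph _ _ _ _ ratC (polyC \o ratC)).
have {}E : (pQtoC A)^`().[th s] *
    \sum_k mmap ratr (pt 1 (th s) (ze s)) (mderiv (rshift 2 k) h) * ratr (eta k) = 0.
  rewrite -[RHS]E sum_pt !hornerM !mE !coefCM dy0 dy1 !mulr0 !add0r mulr_sumr.
  by apply: eq_bigr => k _; rewrite hornerM mE coefCM dyr mulrCA.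
by move/eqP: E; rewrite mulf_eq0 (negPf (A_deriv s)) (negPf (h_dir s)).
Qed.

(** Three cases for the restriction of [g] to the line [u = X eta]: nonconstant, constant away from
    the roots of [A], and constant at such a root. The first two even give a nonzero value of
    [h]. *)
Lemma Bpoly_noroot (g : PC) : (toPC Bpoly).[g] != 0.
Proof.
have key : along (toPC hpoly).[g] != 0 -> (toPC Bpoly).[g] != 0.
  by apply: contraNneq => B0; rewrite hpoly_fact rmorphM hornerM B0 mul0r rmorph0.
have [st|] := ltnP 1 (size (along g)); first by apply: key; rewrite along_hpoly line_nonconst.
move/size1_polyC => gE; have [A0|A0] := eqVneq (pQtoC A).[(along g)`_0] 0.
  by have [s Ds] := A_nonroot_cases A0; apply: (@along_tangent g s); rewrite gE Ds.
by apply: key; rewrite along_hpoly gE line_const.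
Qed.

Lemma hpoly_top : size hpoly = ((a + q) * d).+1 /\ lead_coef hpoly = h.@[pt 0 0 eta]%:MP.
Proof.
have [||||le top] := @hcurve_top _ (@mpolyC N rat) (a + q) 2 'X (fun k => ('X_k)%:P)
  (fun k => (eta k)%:MP).
- by rewrite size_polyX.
- by [].
- by move: q_ge; lia.
- move=> k; rewrite /curve_tail.
  have XE p : (map_poly (polyC \o @mpolyC N rat) p).['X] = map_poly (@mpolyC N rat) p.
    by rewrite -[RHS]horner_polyC_X -map_poly_comp.
  rewrite !XE.
  have sc : (size (map_poly (@mpolyC N rat) (c0 k)) <= a)%N.
    by rewrite (leq_trans (size_poly _ _)).
  have sA : (size (map_poly (@mpolyC N rat) A) <= a.+1)%N.
    by rewrite (leq_trans (size_poly _ _)) // size_A.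
  have cA : (map_poly (@mpolyC N rat) A)`_a = 1.
    rewrite coef_map /= -[a]/(a.+1.-1) -size_A -lead_coefE (monicP A_monic).
    exact: mpolyC1.
  pose w : {poly P} := 'X^q * ((eta k)%:MP)%:P + ('X_k)%:P.
  have sw : (size w <= q.+1)%N.
    rewrite (leq_trans (size_polyD _ _)) // geq_max mulrC mul_polyC.
    by rewrite (leq_trans (size_scale_leq _ _)) ?size_polyXn // (leq_trans (size_polyC_leq1 _)).
  have cw : w`_q = (eta k)%:MP.
    rewrite coefD mulrC mul_polyC coefZ coefXn eqxx mulr1 coefC.
    by rewrite (_ : (q == 0)%N = false) ?addr0 //; apply/negbTE; move: q_ge; lia.
  have [sAw cAw] := top_coef_mul sA sw.
  split; first by rewrite (leq_trans (size_polyD _ _)) // geq_max sAw (leq_trans sc) //; lia.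
  rewrite coefD [_`_ _]nth_default ?add0r ?cAw ?cA ?cw ?mul1r //.
  by rewrite (leq_trans sc) // leq_addr.
have {}top : hpoly`_((a + q) * d) = h.@[pt 0 0 eta]%:MP.
  rewrite [LHS]top; symmetry; apply: (@mmap_morph _ _ _ _ idfun (@mpolyC N rat)) => // i.
  by elim/pt_ind: i => [||k]; rewrite ?pt0 ?pt1 ?ptr ?mpolyC0.
have sh : size hpoly = ((a + q) * d).+1.
  apply/eqP; rewrite eqn_leq le ltnNge; apply: contra h_eta => /leq_sizeP/(_ _ (leqnn _)).
  by rewrite top => /eqP; rewrite mpolyC_eq0.
by rewrite lead_coefE sh.
Qed.

Lemma Bpoly_size : size Bpoly = ((a + q) * d - a).+1.
Proof.
have B0 : Bpoly != 0.
  by apply: contraNneq (Bpoly_noroot 0) => ->; rewrite rmorph0 horner0.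
have := hpoly_top.1; rewrite hpoly_fact size_Mmonic ?Apoly_monic //.
rewrite size_map_inj_poly ?mpolyC0 ?size_A //; last exact: mpolyC_inj.
by move: B0 q_ge d_gt0; rewrite -size_poly_gt0; nia.
Qed.

Lemma Bpoly_lead : lead_coef Bpoly = h.@[pt 0 0 eta]%:MP.
Proof. by rewrite -hpoly_top.2 hpoly_fact lead_coef_Mmonic ?Apoly_monic. Qed.

Definition ev_ut (u : 'I_N -> algC) (t : algC) (U : {poly P}) : algC :=
  horner_eval t (map_poly (mmap ratC u) U).

Lemma ev_ut_is_zmod_morphism u t : zmod_morphism (ev_ut u t).
Proof. by move=> x y; rewrite /ev_ut rmorphB raddfB. Qed.
Lemma ev_ut_is_monoid_morphism u t : monoid_morphism (ev_ut u t).
Proof. by split=> [|x y]; rewrite /ev_ut ?rmorph1 ?rmorphM. Qed.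
HB.instance Definition _ u t := GRing.isZmodMorphism.Build _ _ (ev_ut u t) (ev_ut_is_zmod_morphism u t).
HB.instance Definition _ u t := GRing.isMonoidMorphism.Build _ _ (ev_ut u t) (ev_ut_is_monoid_morphism u t).

Lemma ev_utX u t : ev_ut u t 'X = t.
Proof. by rewrite /ev_ut map_polyX /horner_eval hornerX. Qed.

Lemma ev_utC u t c : ev_ut u t c%:P = mmap ratC u c.
Proof. by rewrite /ev_ut map_polyC /horner_eval hornerC. Qed.

Lemma meval_toPC u t Z : ((toPC Z).[t%:MP_[N]]).@[u] = ev_ut u t Z.
Proof.
rewrite -horner_map /= mevalC /toPC -map_poly_comp /ev_ut; congr _.[_].
by apply: eq_map_poly => c; rewrite /= mmap_meval.
Qed.

Lemma ev_ut_hpoly u t : ev_ut u t hpoly = @hcurve algC ratC t u.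
Proof.
rewrite (hcurve_morph _ ratC (ev_ut u t)) /= ev_utX; apply: hcurve_eq => k /=.
by rewrite ev_utC mmapX mmap1U.
Qed.

Lemma ev_ut_Apoly u t : ev_ut u t Apoly = (pQtoC A).[t].
Proof.
rewrite /ev_ut /Apoly -map_poly_comp /horner_eval; congr _.[_].
by apply: eq_map_poly => c; rewrite /= mmapC.
Qed.

(** * Irreducibility of [Bpoly] *)

Section Regular.

Local Notation point := ('I_(2 + N) -> algC).
Local Notation value x := (mmap ratC x).

(* [tx] and [ux] recover the parameters [t] and [u] from a point of a curve of
   the family. *)
Definition tx (x : point) := x (lshift N 1) / x (lshift N 0).

Definition dom (x : point) := (x (lshift N 0) != 0) && ((pQtoC A).[tx x] != 0).

Definition ux (x : point) (k : 'I_N) :=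
  (x (rshift 2 k) / x (lshift N 0) - (pQtoC (c0 k)).[tx x]) / (pQtoC A).[tx x]
    - tx x ^+ q * ratC (eta k).

Lemma curve_tx x : dom x -> (fun i => x (lshift N 0) * @curve algC ratC (tx x) (ux x) i) =1 x.
Proof.
case/andP=> x0 Ax; rewrite /curve; elim/pt_ind => [||k]; rewrite ?pt0 ?pt1 ?ptr ?mulr1 //.
  by rewrite /tx mulrCA mulfV ?mulr1.
rewrite /curve_tail /ux /=; field; by rewrite x0 Ax.
Qed.

Lemma dom_curve t u : (pQtoC A).[t] != 0 -> dom (@curve algC ratC t u).
Proof. by move=> At; rewrite /dom /tx /curve pt0 pt1 divr1 oner_neq0 At. Qed.

Lemma tx_curve t u : tx (@curve algC ratC t u) = t.
Proof. by rewrite /tx /curve pt0 pt1 divr1. Qed.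

Lemma ux_curve t u k : (pQtoC A).[t] != 0 -> ux (@curve algC ratC t u) k = u k.
Proof.
move=> At; rewrite /ux tx_curve /curve pt0 ptr divr1 /curve_tail /=.
by field.
Qed.

(** A substitute for the local ring of the open set [dom]: quotients of rational polynomials whose
    denominators have no zero there. *)
Definition regular (g : point -> algC) := exists n p : {mpoly rat[2 + N]},
  forall x, dom x -> value x p != 0 /\ value x n = value x p * g x.

Lemma regular_ext g g' : (forall x, dom x -> g x = g' x) -> regular g -> regular g'.
Proof. by move=> E [n [p gP]]; exists n, p => x dx; rewrite -E //; apply: gP. Qed.

Lemma regularC c : regular (fun _ => ratC c).
Proof. by exists c%:MP, 1 => x dx; rewrite rmorph1 oner_neq0 mmapC mul1r. Qed.

Lemma regularX i : regular (fun x => x i).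
Proof. by exists 'X_i, 1 => x dx; rewrite rmorph1 oner_neq0 mmapX mmap1U mul1r. Qed.

Lemma regularD g g' : regular g -> regular g' -> regular (fun x => g x + g' x).
Proof.
case=> n [p gP] [n' [p' gP']]; exists (n * p' + n' * p), (p * p') => x dx.
have [p0 E] := gP x dx; have [p0' E'] := gP' x dx.
rewrite rmorphD !rmorphM mulf_neq0 //= E E'; split=> //; ring.
Qed.

Lemma regularM g g' : regular g -> regular g' -> regular (fun x => g x * g' x).
Proof.
case=> n [p gP] [n' [p' gP']]; exists (n * n'), (p * p') => x dx.
have [p0 E] := gP x dx; have [p0' E'] := gP' x dx.
rewrite !rmorphM mulf_neq0 //= E E'; split=> //; ring.
Qed.

Lemma regularV g : (forall x, dom x -> g x != 0) -> regular g -> regular (fun x => (g x)^-1).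
Proof.
move=> g0 [n [p gP]]; exists p, n => x dx; have [p0 ->] := gP x dx.
by rewrite mulf_neq0 ?g0 // mulfK ?g0.
Qed.

Lemma regularXn g k : regular g -> regular (fun x => g x ^+ k).
Proof.
move=> rg; elim: k => [|k IH]; first by apply: regular_ext (regularC 1) => x _; rewrite rmorph1.
by apply: regular_ext (regularM rg IH) => x _; rewrite exprS.
Qed.

Lemma regular_horner p g : regular g -> regular (fun x => (pQtoC p).[g x]).
Proof.
move=> rg; elim/poly_ind: p => [|p c IH].
  by apply: regular_ext (regularC 0) => x _; rewrite !rmorph0 horner0.
apply: regular_ext (regularD (regularM IH rg) (regularC c)) => x _.
by rewrite rmorphD rmorphM /= map_polyX map_polyC hornerD hornerM hornerX hornerC.
Qed.

Lemma regular_mmap (g : 'I_N -> point -> algC) c : (forall k, regular (g k)) ->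
  regular (fun x => mmap ratC (fun k => g k x) c).
Proof.
move=> rg; elim/mpoly_ring_ind: c => [c|k|c c' IH IH'|c c' IH IH'].
- by apply: regular_ext (regularC c) => x _; rewrite mmapC.
- by apply: regular_ext (rg k) => x _; rewrite mmapX mmap1U.
- by apply: regular_ext (regularD IH IH') => x _; rewrite rmorphD.
- by apply: regular_ext (regularM IH IH') => x _; rewrite rmorphM.
Qed.

Lemma regular_tx : regular tx.
Proof.
apply: regularM (regularX _) (regularV _ (regularX _)) => x.
by case/andP.
Qed.

Lemma regular_ux k : regular (fun x => ux x k).
Proof.
have r0 : regular (fun x => (x (lshift N 0))^-1) by apply: regularV (regularX _) => x /andP[].
have rA : regular (fun x => (pQtoC A).[tx x]^-1).
  by apply: regularV (regular_horner _ regular_tx) => x /andP[].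
have rN g : regular g -> regular (fun x => - g x).
  move=> rg; apply: regular_ext (regularM (regularC (- 1)) rg) => x _.
  by rewrite rmorphN1 mulN1r.
apply: regularD; last by apply/rN/regularM/regularC/regularXn/regular_tx.
apply: regularM rA; apply: regularD; first exact: regularM (regularX _) r0.
exact/rN/regular_horner/regular_tx.
Qed.

Lemma regular_ev U : regular (fun x => ev_ut (ux x) (tx x) U).
Proof.
elim/poly_ind: U => [|U c IH].
  by apply: regular_ext (regularC 0) => x _; rewrite !rmorph0.
apply: regular_ext (regularD (regularM IH regular_tx) (regular_mmap c regular_ux)) => x _.
by rewrite rmorphD rmorphM /= ev_utX ev_utC.
Qed.

Lemma dom_ext p p' : (forall x, dom x -> value x p = value x p') -> p = p'.
Proof.
move=> E; apply/eqP/negPn/negP => pp'.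
(* Homogenised, this is [x0^(a+1) A(x1/x0)]; its nonvanishing is exactly membership in [dom], so
   polynomials agreeing on [dom] agree off a proper hypersurface. *)
pose delta : {mpoly rat[2 + N]} := 'X_(lshift N 0) *
  \sum_(i < a.+1) (A`_i)%:MP * ('X_(lshift N 1) ^+ i * 'X_(lshift N 0) ^+ (a - i)).
have ev_delta x : x (lshift N 0) != 0 -> value x delta = x (lshift N 0) ^+ a.+1 * (pQtoC A).[tx x].
  move=> x0; rewrite rmorphM rmorph_sum /= mmapX mmap1U exprS -mulrA; congr (_ * _).
  rewrite horner_coef size_map_poly size_A mulr_sumr; apply: eq_bigr => i _.
  rewrite !rmorphM !rmorphXn /= mmapC !mmapX !mmap1U coef_map /tx expr_div_n.
  rewrite [x (lshift N 0) ^+ (a - i)]expfB_cond; last by rewrite (negPf x0) add0n -ltnS ltn_ord.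
  by rewrite [RHS]mulrCA; congr (_ * _); rewrite mulrCA.
have delta0 : delta != 0.
  have [|k Ak] := @poly_nat_nonroot (pQtoC A); first by rewrite map_poly_eq0 monic_neq0 ?A_monic.
  apply: contraNneq Ak => D0.
  have := ev_delta (@curve algC ratC k%:R (fun _ => 0)).
  rewrite tx_curve D0 rmorph0 /curve pt0 expr1n mul1r => <- //; exact: oner_neq0.
have [|b] := @mpoly_nat_nonroot _ (map_mpoly ratC ((p - p') * delta)).
  rewrite -(rmorph0 (map_mpoly ratC)) (inj_eq (map_mpoly_inj (fmorph_inj ratC))).
  by rewrite mulf_neq0 // subr_eq0.
rewrite -mmap_meval rmorphM rmorphB /=; set x := fun k => _ => nz.
have [x0|x0] := eqVneq (x (lshift N 0)) 0.
  by case/negP: nz; rewrite /delta rmorphM /= mmapX mmap1U x0 mul0r mulr0.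
have [Ax|Ax] := eqVneq (pQtoC A).[tx x] 0.
  by case/negP: nz; rewrite ev_delta // Ax !mulr0.
by case/negP: nz; rewrite E ?subrr ?mul0r // /dom x0.
Qed.

(** On the curve with fixed [u] the numerator becomes [W B A], so [Q U = W B A]. Multiplying by [V]
    and cancelling [B] gives [Q c = W A V], whose left side has no zero outside the roots of [A]. *)
Lemma regular_fraction_pullback U Nn Q W :
  (forall x, dom x -> value x Q != 0 /\ value x Nn = value x Q * ev_ut (ux x) (tx x) U) ->
  Nn = W * h -> forall c V u t, c *: Bpoly = U * V -> mmap ratC u c != 0 ->
  (pQtoC A).[t] != 0 -> ev_ut u t V != 0.
Proof.
move=> UP NE c V u t cB cu At; apply/eqP => V0.
pose evp : {rmorphism {mpoly rat[2 + N]} -> {poly algC}} :=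
  mmap (polyC \o ratC) (curve (polyC \o ratC) 'X (fun k => (u k)%:P)).
have evpE p s : (evp p).[s] = value (@curve algC ratC s u) p.
  apply: (@mmap_morph _ _ _ _ (polyC \o ratC) ratC (horner_eval s)) => [r|i].
    by rewrite /= /horner_eval hornerC.
  have /= -> := curve_morph (polyC \o ratC) ratC (horner_eval s) 'X (fun k => (u k)%:P) i.
  rewrite /curve; elim/pt_ind: i => [||k]; rewrite ?pt0 ?pt1 ?ptr ?/horner_eval ?hornerX //.
  by rewrite /curve_tail /= hornerC.
pose hat : {rmorphism {poly P} -> {poly algC}} := map_poly (mmap ratC u).
have hatE Z s : (hat Z).[s] = ev_ut u s Z by [].
have B0 : hat Bpoly != 0.
  apply: contra_neq h_eta => B0; apply/eqP; rewrite -(fmorph_eq0 ratC).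
  have := congr1 (fun p : {poly algC} => p`_(size Bpoly).-1) B0.
  by rewrite coef_map -lead_coefE Bpoly_lead /= mmapC coef0 => ->.
have A0 : pQtoC A != 0 by rewrite map_poly_eq0 monic_neq0 ?A_monic.
have E : evp Q * hat U = evp W * hat Bpoly * pQtoC A.
  apply/eqP/negPn/negP => nE.
  have [|k] := @poly_nat_nonroot ((evp Q * hat U - evp W * hat Bpoly * pQtoC A) * pQtoC A).
    by rewrite mulf_neq0 // subr_eq0.
  rewrite !(hornerM, hornerN, hornerD) mulf_eq0 negb_or => /andP[/negP + Ak]; apply.
  have [_ UE] := UP _ (dom_curve u Ak).
  have EU : ev_ut (ux (@curve algC ratC k%:R u)) (tx (@curve algC ratC k%:R u)) U = ev_ut u k%:R U.
    rewrite tx_curve /ev_ut; congr _.[_]; apply: eq_map_poly => r; apply: mmap_eq => l.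
    exact: ux_curve.
  have Eh : value (@curve algC ratC k%:R u) h = ev_ut u k%:R Bpoly * (pQtoC A).[k%:R].
    by have := ev_ut_hpoly u k%:R; rewrite hpoly_fact rmorphM /= ev_ut_Apoly => ->.
  rewrite !evpE !hatE -EU -UE NE [mmap _ _ (W * h)]rmorphM /= Eh mulrA.
  by rewrite subrr.
have {}E : evp Q * (mmap ratC u c)%:P = evp W * pQtoC A * hat V.
  have cB' : (mmap ratC u c)%:P * hat Bpoly = hat U * hat V.
    by rewrite -rmorphM -cB -mul_polyC rmorphM /= map_polyC.
  apply: (mulIf B0); rewrite -[LHS]mulrA cB' mulrA E; ring.
have := congr1 (fun p => p.[t]) E; rewrite !hornerM hornerC hatE V0 mulr0 evpE => /eqP.
by rewrite mulf_eq0 (negPf cu) orbF (negPf (UP _ (dom_curve u At)).1).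
Qed.

(* If [h] divided the numerator of [U], then the cofactor [V] could vanish only at
   roots of [A], at which [B] is nonzero for generic [u]. *)
Lemma fraction_not_dvd U Nn Q c V :
  (forall x, dom x -> value x Q != 0 /\ value x Nn = value x Q * ev_ut (ux x) (tx x) U) ->
  c != 0 -> c *: Bpoly = U * V -> (1 < size V)%N -> ~ rdvd h Nn.
Proof.
move=> UP c_neq0 cB sV [W NE].
have injC : injective (map_mpoly ratC : P -> PC) by apply/map_mpoly_inj/fmorph_inj.
(* The conditions on [u]: [c] does not vanish, [V] keeps its degree and so has a root, and [B] does
   not vanish at the roots of [A]. *)
pose w (o : option (option 'I_a)) : PC := match o with
  | None => map_mpoly ratC c
  | Some None => map_mpoly ratC (lead_coef V)
  | Some (Some s) => (toPC Bpoly).[(th s)%:MP] end.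
have V0 : V != 0 by rewrite -size_poly_gt0 ltnW.
have [[[s|]|]|b hb] := @mpoly_prod_nonroot N _ w.
- exact: Bpoly_noroot.
- by rewrite /= -(rmorph0 (map_mpoly ratC)) (inj_eq injC) lead_coef_eq0.
- by rewrite /= -(rmorph0 (map_mpoly ratC)) (inj_eq injC).
set u : 'I_N -> algC := fun k => _ in hb.
have cu : mmap ratC u c != 0 by have := hb None; rewrite /= -mmap_meval.
have sVu : (1 < size (map_poly (mmap ratC u) V))%N.
  by rewrite size_poly_eq // mmap_meval; have := hb (Some None).
have /closed_rootP[t /eqP tV] : size (map_poly (mmap ratC u) V) != 1%N by rewrite gtn_eqF.
have At : (pQtoC A).[t] != 0.
  apply/eqP => /A_nonroot_cases[s Dt]; have /negP := hb (Some (Some s)); apply.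
  have : ev_ut u t (c *: Bpoly) = 0 by rewrite cB rmorphM /= [ev_ut _ _ V]tV mulr0.
  by rewrite -mul_polyC rmorphM /= ev_utC meval_toPC Dt => /eqP; rewrite mulf_eq0 (negPf cu).
by have /eqP := regular_fraction_pullback UP NE cB cu At; apply; exact: tV.
Qed.

(** On [dom], [h] equals [x0^d A(t) B(u; t)]. Writing all the functions as fractions turns
    [c B = U V] into a polynomial identity in which the prime [h] divides one of four numerators or
    denominators; each possibility is excluded. *)
Lemma Bpoly_irreducible c U V : c != 0 -> c *: Bpoly = U * V ->
  (size U <= 1)%N \/ (size V <= 1)%N.
Proof.
move=> c_neq0 cB; have [sU|sU] := leqP (size U) 1; [by left|right; rewrite leqNgt; apply/negP => sV].
have [NU [QU UP]] := regular_ev U; have [NV [QV VP]] := regular_ev V.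
have [Nc [Qc CP]] := regular_ev c%:P.
have [NA [QA AP]] := regularM (regularXn d (regularX (lshift N 0))) (regular_horner A regular_tx).
have E : Nc * QU * QV * QA * h = Qc * NA * NU * NV.
  apply: dom_ext => x dx.
  have -> : value x (Nc * QU * QV * QA * h) = value x Nc * value x QU * value x QV * value x QA * value x h.
    by rewrite !rmorphM.
  have -> : value x (Qc * NA * NU * NV) = value x Qc * value x NA * value x NU * value x NV by rewrite !rmorphM.
  have -> : value x h = x (lshift N 0) ^+ d * (ev_ut (ux x) (tx x) Bpoly * (pQtoC A).[tx x]).
    rewrite -(ev_ut_Apoly (ux x)) -rmorphM -hpoly_fact /= ev_ut_hpoly.
    by rewrite -(homog_scale _ _ _ h_homog); apply/mmap_eq => i; rewrite curve_tx.
  have := congr1 (ev_ut (ux x) (tx x)) cB; rewrite -mul_polyC !rmorphM /= => EB.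
  rewrite (UP x dx).2 (VP x dx).2 (CP x dx).2 (AP x dx).2.
  transitivity (value x Qc * value x QA * value x QU * value x QV * x (lshift N 0) ^+ d * (pQtoC A).[tx x] *
     (ev_ut (ux x) (tx x) c%:P * ev_ut (ux x) (tx x) Bpoly)); first by ring.
  rewrite EB; ring.
(* A polynomial without zeros on [dom] is the numerator for [U = 1], with cofactor [V = c B] of
   positive degree. *)
have unit_not_dvd p : (forall x, dom x -> value x p != 0) -> ~ rdvd h p.
  move=> p0; apply: (@fraction_not_dvd 1 p p c (c *: Bpoly) _ c_neq0) => [x dx||].
  - by rewrite rmorph1 mulr1 p0.
  - by rewrite mul1r.
  - rewrite size_scale ?Bpoly_size //.
    by move: q_ge d_gt0; nia.
have [_ _ h_dvd] := h_prime.
have : rdvd h (Qc * NA * NU * NV) by exists (Nc * QU * QV * QA).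
case/h_dvd => [/h_dvd[/h_dvd[]|]|].
- by apply: unit_not_dvd => x /CP[].
- apply: unit_not_dvd => x dx; rewrite (AP x dx).2 mulf_neq0 ?(AP x dx).1 //.
  by case/andP: dx => x0 Ax; rewrite mulf_neq0 ?expf_neq0.
- exact: fraction_not_dvd UP c_neq0 cB sV.
- by rewrite mulrC in cB; apply: fraction_not_dvd VP c_neq0 cB sU.
Qed.

End Regular.

(** The point is nonsingular because the derivative of [h] along the curve is [B'(t) A(t)], and the
    irreducible specialisation of [B] is separable. *)
Lemma curve_field (gen : algC) : exists t (w : 'I_N -> {poly rat}),
  let x := pt 1 t (fun k => (pQtoC (w k)).[t]) in
  [/\ size (minCpoly t) = ((a + q) * d - a).+1, forall g : {poly rat}, t <> (pQtoC g).[gen],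
      mmap ratC x h = 0 & exists i, mmap ratC x (mderiv i h) != 0].
Proof.
pose F := (h.@[pt 0 0 eta])^-1%:MP_[N] *: Bpoly.
have c_neq0 : (h.@[pt 0 0 eta])^-1%:MP_[N] != 0 by rewrite mpolyC_eq0 invr_eq0.
set n := ((a + q) * d - a)%N.
(* The bound [a.+2 <= q] makes the degree exceed that of [A]. *)
have n_gt : (a < n)%N by rewrite /n; move: q_ge d_gt0; nia.
have F_monic : F \is monic.
  by rewrite monicE lead_coefZ Bpoly_lead -mpolyCM mulVf // mpolyC1.
have F_size : size F = n.+1 by rewrite size_scale // Bpoly_size.
have [|||||u uP] := @hilbert_specialization N n F gen.
- exact: leq_ltn_trans n_gt.
- exact: F_monic.
- exact: F_size.
- move=> c U V c_neq E; apply: (@Bpoly_irreducible (c * (h.@[pt 0 0 eta])^-1%:MP)).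
    by rewrite mulf_neq0.
  by rewrite -E scalerA.
- move=> g; rewrite -[map_poly _ F]/(toPC F) /F -mul_polyC rmorphM /= toPC_C hornerM hornerC.
  rewrite mulf_neq0 ?Bpoly_noroot // map_mpolyC /= mpolyC_eq0 fmorph_eq0 invr_eq0 //.
pose Fu := map_poly (meval u) F; pose u' k := ratC (u k).
have Fu_monic : Fu \is monic by apply: monic_map.
have Fu_size : size Fu = n.+1.
  by rewrite size_map_poly_id0 ?F_size // (monicP F_monic) rmorph1 oner_neq0.
have FuE : pQtoC Fu = (ratC (h.@[pt 0 0 eta])^-1) *: map_poly (mmap ratC u') Bpoly.
  rewrite -mul_polyC /Fu /F -mul_polyC.
  have -> : pQtoC (map_poly (meval u) (((h.@[pt 0 0 eta])^-1%:MP)%:P * Bpoly)) =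
      map_poly (mmap ratC u') (((h.@[pt 0 0 eta])^-1%:MP)%:P * Bpoly).
    by rewrite -map_poly_comp; apply: eq_map_poly => p; apply: (@mmap_morph _ _ _ _ idfun ratC ratC).
  by rewrite rmorphM /= map_polyC /= mmapC.
have /closed_rootP[t tF] : size (pQtoC Fu) != 1%N.
  by rewrite size_map_poly Fu_size eqSS -lt0n; exact: leq_ltn_trans n_gt.
have [st tg] := uP t tF.
(* Otherwise the minimal polynomial of [t], of degree [n > a], would divide [A]. *)
have At : (pQtoC A).[t] != 0.
  have [p [Dp mon_p] pz] := minCpolyP t; apply: contraTneq n_gt => At.
  rewrite -leqNgt -ltnS -st -size_A Dp size_map_poly dvdp_leq ?monic_neq0 ?A_monic //.
  by rewrite -pz; apply/eqP.
have EFu : minCpoly t = pQtoC Fu.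
  have [p [Dp mon_p] pz] := minCpolyP t; rewrite Dp; congr (map_poly _ _).
  apply/eqP; rewrite -eqp_monic // -dvdp_size_eqp -?pz //.
  by rewrite Fu_size -st Dp size_map_poly.
pose hat := map_poly (mmap ratC u') : {poly P} -> {poly algC}.
have hat_t : (hat Bpoly).[t] = 0.
  move: tF; rewrite FuE rootE hornerZ mulf_eq0 fmorph_eq0 invr_eq0 (negPf h_eta) /=.
  by move/eqP.
have hat_t' : (hat Bpoly)^`().[t] != 0.
  have := minCpoly_separable t; rewrite unlock => /coprimep_root/(_ (root_minCpoly t)).
  by rewrite EFu FuE derivZ hornerZ mulf_eq0 negb_or => /andP[].
pose w k := c0 k + A * ('X^q * (eta k)%:P + (u k)%:P).
exists t, w; set x := pt 1 t _.
have xE : x =1 @curve algC ratC t u'.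
  rewrite /x /curve; elim/pt_ind => [||k]; rewrite ?pt0 ?pt1 ?ptr // /w.
  rewrite rmorphD rmorphM rmorphD rmorphM /= map_polyXn !map_polyC.
  by rewrite !(hornerD, hornerM, hornerXn, hornerC).
split=> //.
  rewrite (mmap_eq _ _ xE) -[LHS]ev_ut_hpoly hpoly_fact rmorphM /=.
  by rewrite /ev_ut /horner_eval [X in X * _]hat_t mul0r.
apply: NNPP => sing; have {}sing i : mmap ratC x (mderiv i h) = 0.
  by apply/eqP/negPn/negP => ni; apply: sing; exists i.
pose y : 'I_(2 + N) -> {poly algC} := curve (polyC \o ratC) 'X (fun k => (u' k)%:P).
have Dh : mmap (polyC \o ratC) y h = hat Bpoly * pQtoC A.
  have -> : pQtoC A = hat Apoly.
    by rewrite /hat /Apoly -map_poly_comp; apply: eq_map_poly => r; rewrite /= mmapC.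
  rewrite /hat -rmorphM -hpoly_fact /= (hcurve_morph _ (polyC \o ratC)).
  rewrite /= map_polyX; apply: hcurve_eq => k /=.
  by rewrite map_polyC /= mmapX mmap1U.
have := congr1 (fun p => p^`().[t]) Dh.
rewrite mmap_chain_rule horner_sum big1 => [|i _].
  rewrite derivM hornerD !hornerM hat_t mul0r addr0 => /esym/eqP.
  by rewrite mulf_eq0 (negPf hat_t') (negPf At).
rewrite hornerM; have -> : (mmap (polyC \o ratC) y (mderiv i h)).[t] = mmap ratC x (mderiv i h).
  apply: (@mmap_morph _ _ _ _ _ ratC (horner_eval t)) => [r|l].
    by rewrite /= /horner_eval hornerC.
  rewrite xE (curve_morph _ ratC (horner_eval t)) /= /horner_eval hornerX.
  rewrite /curve; elim/pt_ind: l => [||k]; rewrite ?pt0 ?pt1 ?ptr //.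
  by rewrite /curve_tail /= hornerC.
by rewrite sing mul0r.
Qed.

End Construction.

(** * Number fields generated by one element *)

Lemma horner_reduce z (g : {poly rat}) : exists2 g' : {poly rat},
  (size g' < size (minCpoly z))%N & (pQtoC g).[z] = (pQtoC g').[z].
Proof.
have [p [Dp mon_p] pz] := minCpolyP z; exists (g %% p).
  by rewrite Dp size_map_poly ltn_modp monic_neq0.
rewrite {1}(divp_eq g p) rmorphD rmorphM hornerD hornerM /= -Dp.
by rewrite (eqP (root_minCpoly z)) mulr0 add0r.
Qed.

(** The field generated by [z]. A [pred algC] is boolean, so membership must be decided; [Crat_span]
    of the powers of [z] does this. *)
Definition Qadj (z : algC) : pred algC := Crat_span (mkseq (fun i => z ^+ i) (size (minCpoly z)).-1).

Lemma QadjP z x : x \in Qadj z <-> exists g : {poly rat}, x = (pQtoC g).[z].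
Proof.
rewrite /Qadj; set s := mkseq _ _; have ss : size s = (size (minCpoly z)).-1 by rewrite size_mkseq.
split=> [/Crat_spanP[a ->]|[g ->]].
  exists (\sum_i a i *: 'X^i); rewrite rmorph_sum horner_sum; apply: eq_bigr => i _ /=.
  by rewrite map_polyZ map_polyXn hornerZ hornerXn nth_mkseq // -ss.
have [g' sg ->] := horner_reduce z g.
have {}sg : (size (pQtoC g') <= size s)%N.
  by rewrite ss size_map_poly -ltnS prednK // size_poly_gt0 monic_neq0 ?minCpoly_monic.
apply/Crat_spanP; exists [ffun i : 'I_(size s) => g'`_i].
rewrite (horner_coef_wide _ sg); apply: eq_bigr => i _.
by rewrite ffunE coef_map nth_mkseq // -ss.
Qed.

Lemma Qadj_subfield z : is_subfield (Qadj z).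
Proof.
split=> [|x y /QadjP[g ->] /QadjP[g' ->]|x y /QadjP[g ->] /QadjP[g' ->]]; apply/QadjP.
- by exists 1; rewrite rmorph1 hornerC.
- by exists (g - g'); rewrite rmorphB hornerD hornerN.
have [->|gz] := eqVneq (pQtoC g').[z] 0; first by exists 0; rewrite invr0 mulr0 rmorph0 horner0.
have [p [Dp mon_p] pz] := minCpolyP z.
have cop : coprimep p g'.
  have /dvdpP[e De] := dvdp_gcdl p g'; rewrite /coprimep.
  have gcd_z : ~~ root (pQtoC (gcdp p g')) z.
    apply: contra gz; rewrite pz => pg; have := dvdp_trans pg (dvdp_gcdr p g').
    by rewrite -pz.
  have : root (pQtoC p) z by rewrite -Dp root_minCpoly.
  rewrite {1}De rmorphM rootM (negPf gcd_z) orbF pz => pe.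
  have p0 : p != 0 by rewrite monic_neq0.
  have e0 : e != 0 by apply: contraNneq p0 => e0; rewrite De e0 mul0r.
  have g0 : gcdp p g' != 0 by apply: contraNneq p0 => g0; rewrite De g0 mulr0.
  have := dvdp_leq e0 pe; rewrite {1}De size_mul // => le.
  rewrite eqn_leq size_poly_gt0 g0 andbT.
  have aux (k l : nat) : ((k + l).-1 <= k -> 0 < k -> 0 < l -> l <= 1)%N by lia.
  by apply: aux le _ _; rewrite size_poly_gt0.
have [[u v] /= /eqpP[[c c'] /= /andP[c0 c0'] E]] := Bezout_coprimepP _ _ cop.
exists (g * (c'^-1 *: (c *: v))); rewrite rmorphM hornerM; congr (_ * _).
have : (pQtoC (c *: (u * p + v * g'))).[z] = (pQtoC (c' *: 1)).[z] by rewrite E.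
rewrite !map_polyZ rmorph1 rmorphD !rmorphM !hornerZ hornerD !hornerM hornerC /= -Dp.
rewrite (eqP (root_minCpoly z)) mulr0 add0r mulr1 => {}E.
have rc' : ratC c' != 0 by rewrite fmorph_eq0.
rewrite !map_polyZ !hornerZ /= fmorphV; apply: (mulIf gz).
rewrite mulVf // -mulrA -[LHS](mulVf rc'); congr (_ * _).
by rewrite -mulrA; exact/esym/E.
Qed.

Lemma Qadj_degree z n : size (minCpoly z) = n.+1 -> has_degree (Qadj z) n.
Proof.
move=> sz; exists (mktuple (fun i : 'I_n => z ^+ i)); split; [|split].
- move=> i; rewrite tnth_mktuple; apply/QadjP; exists 'X^i.
  by rewrite map_polyXn hornerXn.
- move=> x /QadjP[g ->]; have [g' sg ->] := horner_reduce z g.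
  have {}sg : (size (pQtoC g') <= n)%N by rewrite size_map_poly; rewrite sz in sg.
  exists (fun i : 'I_n => g'`_i); rewrite (horner_coef_wide _ sg).
  by apply: eq_bigr => i _; rewrite coef_map tnth_mktuple.
move=> c E i; pose g := rVpoly (\row_i c i).
have gz : root (pQtoC g) z.
  have sg : (size (pQtoC g) <= n)%N by rewrite size_map_poly size_poly.
  rewrite rootE (horner_coef_wide _ sg) -[X in _ == X]E.
  by apply/eqP/eq_bigr => k _; rewrite coef_map /= coef_rVpoly_ord mxE tnth_mktuple.
have [p [Dp mon_p] pz] := minCpolyP z; rewrite pz in gz.
have g0 : g = 0.
  apply/eqP/negPn/negP => /dvdp_leq/(_ gz); rewrite leqNgt.
  by rewrite -(size_map_poly ratC p) -Dp sz ltnS size_poly.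
by have := coef_rVpoly_ord (\row_i c i) i; rewrite mxE -/g g0 coef0.
Qed.

Lemma has_degree_le L n n' : has_degree L n -> has_degree L n' -> (n' <= n)%N.
Proof.
case=> b [_ [bS _]] [b' [b'L [_ b'I]]].
have /fin_all_exists[C bC] : forall j, exists c : 'I_n -> rat, tnth b' j = \sum_(i < n) ratr (c i) * tnth b i.
  by move=> j; apply: bS.
pose M := \matrix_(j < n', i < n) C j i.
have : row_free M; last by rewrite /row_free => /eqP <-; apply: rank_leq_col.
rewrite -kermx_eq0; apply/eqP/row_matrixP => r; rewrite row0.
apply/rowP => k; rewrite [LHS]mxE [RHS]mxE; apply: (b'I (fun j => kermx M r j)).
under eq_bigr => j _ do rewrite bC mulr_sumr.
rewrite exchange_big big1 //= => i _.
transitivity (ratC ((kermx M *m M) r i) * tnth b i); last by rewrite mulmx_ker mxE rmorph0 mul0r.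
rewrite [X in ratC X]mxE rmorph_sum mulr_suml; apply: eq_bigr => j _.
by rewrite rmorphM mulrA [M _ _]mxE.
Qed.

Lemma has_degree_uniq L n n' : has_degree L n -> has_degree L n' -> n = n'.
Proof. by move=> h h'; apply/eqP; rewrite eqn_leq !(@has_degree_le L). Qed.

Lemma eq_has_degree L L' n : L =i L' -> has_degree L n -> has_degree L' n.
Proof.
move=> E [b [bL [bS bI]]]; exists b; split; [|split] => // [i|x].
  by rewrite -E.
by rewrite -E; apply: bS.
Qed.

Lemma has_degree_gt0 L n : is_subfield L -> has_degree L n -> (0 < n)%N.
Proof.
case=> L1 _ _ [b [_ [bS _]]]; have [c E] := bS 1 L1; rewrite lt0n.
by apply: contra_eq_neq E => n0; move: b c bS; rewrite n0 => *; rewrite big_ord0 oner_neq0.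
Qed.

(** * Closed points *)

Lemma mderiv_homog m (R : comNzRingType) d (p : {mpoly R[m]}) i :
  p \is d.-homog -> mderiv i p \is (d.-1).-homog.
Proof.
move=> /dhomogP hp; apply/dhomogP => mm /=; rewrite mcoeff_msupp mcoeff_deriv => nz.
have /hp /= : (mm + U_(i))%MM \in msupp p.
  by rewrite mcoeff_msupp; apply: contraNneq nz => ->; rewrite mul0rn.
by rewrite mdegD mdeg1 addn1 => <-.
Qed.

Lemma map_mpoly_mderiv m (R S : comNzRingType) (j : {rmorphism R -> S}) (p : {mpoly R[m]}) i :
  map_mpoly j (mderiv i p) = mderiv i (map_mpoly j p).
Proof.
by apply/mpolyP => mm; rewrite mcoeff_map_mpoly !mcoeff_deriv mcoeff_map_mpoly raddfMn.
Qed.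

Section SubfieldClosure.

Variables (L : pred algC) (Lsub : is_subfield L).

Lemma subfield0 : 0 \in L.
Proof. by case: Lsub => L1 LB _; rewrite -(subrr 1) LB. Qed.

Lemma subfieldD u v : u \in L -> v \in L -> u + v \in L.
Proof.
by case: Lsub => _ LB _ Lu Lv; rewrite -[v]opprK LB // -sub0r LB // subfield0.
Qed.

Lemma subfieldV u : u \in L -> u^-1 \in L.
Proof. by case: Lsub => L1 _ LV Lu; rewrite -div1r LV. Qed.

Lemma subfieldM u v : u \in L -> v \in L -> u * v \in L.
Proof. by case: Lsub => _ _ LV Lu Lv; rewrite -[v]invrK LV // subfieldV. Qed.

Lemma subfield_sum I (r : seq I) (F : I -> algC) : (forall i, F i \in L) -> \sum_(i <- r) F i \in L.
Proof.
by move=> FL; apply: (big_ind (fun u => u \in L)) => //; [apply: subfield0|apply: subfieldD].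
Qed.

Lemma subfield_rat c : ratC c \in L.
Proof.
have Lnat n : n%:R \in L.
  by elim: n => [|n IH]; rewrite ?subfield0 // -addn1 natrD subfieldD //; case: Lsub.
have Lint n : n%:~R \in L.
  case: n => n; first exact: Lnat.
  by rewrite NegzE rmorphN /= -[- _]sub0r; case: Lsub => _ LB _; rewrite LB ?subfield0 ?Lnat.
by rewrite -[c]divq_num_den rmorphM fmorphV /= !ratr_int subfieldM ?subfieldV.
Qed.

Lemma subfield_horner (g : {poly rat}) z : z \in L -> (pQtoC g).[z] \in L.
Proof.
move=> Lz; elim/poly_ind: g => [|g c IH]; first by rewrite rmorph0 horner0 subfield0.
rewrite rmorphD rmorphM /= map_polyX map_polyC hornerD hornerM hornerX hornerC.
by apply: subfieldD; [exact: subfieldM|exact: subfield_rat].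
Qed.

Lemma Qadj_sub z : z \in L -> {subset Qadj z <= L}.
Proof. by move=> Lz x /QadjP[g ->]; apply: subfield_horner. Qed.

End SubfieldClosure.

Section Points.

Variables (m : nat) (f : {mpoly int[m]}) (d : nat).
Hypothesis f_homog : f \is d.-homog.

Lemma meval_fC (x : 'I_m -> algC) (p : {mpoly int[m]}) : meval x (fC p) = mmap intC x p :> algC.
Proof. by rewrite mmap_meval. Qed.

Lemma meval_mderiv_fC i (x : 'I_m -> algC) : meval x (mderiv i (fC f)) = mmap intC x (mderiv i f).
Proof. by rewrite -meval_fC; congr (meval x _); rewrite [RHS](map_mpoly_mderiv intC). Qed.

Lemma root_scale c x : meval x (fC f) = 0 -> meval (fun i => c * x i) (fC f) = 0.
Proof. by rewrite !meval_fC (homog_scale _ _ _ f_homog) => ->; rewrite mulr0. Qed.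

Lemma nonsingular_scale c x : c != 0 -> nonsingular f x -> nonsingular f (fun i => c * x i).
Proof.
move=> c0 [i xi]; exists i; move: xi; rewrite !meval_mderiv_fC (homog_scale _ _ _ (mderiv_homog i f_homog)).
by move=> nz; rewrite mulf_neq0 ?expf_neq0.
Qed.

Lemma int_rmorph (nu : {rmorphism algC -> algC}) (x : 'I_m -> algC) (p : {mpoly int[m]}) : nu (mmap intC x p) = mmap intC (nu \o x) p.
Proof. by apply: mmap_morph => // c; rewrite rmorph_int. Qed.

Lemma root_conj (nu : {rmorphism algC -> algC}) x : meval x (fC f) = 0 -> meval (nu \o x) (fC f) = 0.
Proof. by rewrite !meval_fC -int_rmorph => ->; rewrite rmorph0. Qed.

Lemma nonsingular_conj (nu : {rmorphism algC -> algC}) x : nonsingular f x -> nonsingular f (nu \o x).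
Proof. by case=> i xi; exists i; move: xi; rewrite !meval_mderiv_fC -int_rmorph fmorph_eq0. Qed.

Lemma root_ext x y : x =1 y -> meval x (fC f) = 0 -> meval y (fC f) = 0.
Proof. by move=> E <-; apply: meval_eq => i; rewrite E. Qed.

Lemma nonsingular_ext x y : x =1 y -> nonsingular f x -> nonsingular f y.
Proof. by move=> E [i xi]; exists i; rewrite -(meval_eq _ E). Qed.

(** A canonical representative: projective equality becomes pointwise equality, and automorphisms
    preserve the normalisation. *)
Definition normalized (x : 'I_m -> algC) := exists2 k, x k = 1 & forall i : 'I_m, (i < k)%N -> x i = 0.

Lemma normalized_scale x y c : normalized x -> normalized y -> (forall i, x i = c * y i) -> x =1 y.
Proof.
move=> [k xk xlt] [l yl ylt] E; have [lt|lt|/val_inj kl] := ltngtP k l.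
- by have := oner_neq0 algC; rewrite -xk E ylt // mulr0 eqxx.
- have c0 : c = 0 by have := E l; rewrite xlt // yl mulr1.
  by have := oner_neq0 algC; rewrite -xk E c0 mul0r eqxx.
by have c1 : c = 1 by [rewrite -xk E kl yl mulr1]; move=> i; rewrite E c1 mul1r.
Qed.

Lemma normalize x : (exists i, x i != 0) -> exists2 k, x k != 0 & normalized (fun i => (x k)^-1 * x i).
Proof.
case=> i xi; pose k := [arg min_(l < i | x l != 0) (l : nat)].
exists k; rewrite /k; case: arg_minnP => // {}k xk kmin.
exists k => [|l lk]; first by rewrite mulVf.
have [->|xl] := eqVneq (x l) 0; first by rewrite mulr0.
by have := kmin _ xl; rewrite leqNgt lk.
Qed.

Definition galois_set a (xi : 'I_a -> 'I_m -> algC) :=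
  [/\ forall s, normalized (xi s),
      forall s s', xi s =1 xi s' -> s = s',
      forall (nu : {rmorphism algC -> algC}) s, exists s', forall i, nu (xi s i) = xi s' i &
      forall s, meval (xi s) (fC f) = 0 /\ nonsingular f (xi s)].

(** A primitive element [z] of the normalised coordinates generates [L], since the point is new. Its
    [a] conjugates give the [a] conjugate points. *)
Lemma closed_point a : D f a -> exists2 xi : 'I_a -> 'I_m -> algC, galois_set xi &
  forall s s', exists nu : {rmorphism algC -> algC}, forall i, nu (xi s i) = xi s' i.
Proof.
case=> L [[[Lsub _] [x [[x0 [xL xf]] [xns xnew]]]] La].
have [k xk nx] := normalize x0; set y : 'I_m -> algC := fun i => _ in nx.
have [z [c Dz] [ps Dps]] := algC_PET (codom y).
have yz i : exists g, y i = (pQtoC g).[z].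
  have : y i \in codom y by apply: codom_f.
  by rewrite Dps => /mapP[g _ ->]; exists g.
have yL i : y i \in L by apply: (subfieldM Lsub) => //; apply: (subfieldV Lsub).
have zL : z \in L.
  rewrite Dz; apply: (subfield_sum Lsub) => i; rewrite -mulr_natr; apply: (subfieldM Lsub).
    have : (codom y)`_i \in codom y by rewrite mem_nth.
    by case/codomP => l ->.
  by rewrite -(ratr_nat algC) (subfield_rat Lsub).
have KL : Qadj z =i L.
  apply: NNPP => nKL; apply: (xnew (Qadj z)) => //; first exact: Qadj_subfield.
    exact: Qadj_sub.
  exists (x k)^-1; rewrite invr_eq0; split=> // i.
  by apply/QadjP; apply: yz.
have [p [Dp mon_p] pz] := minCpolyP z.
have sz : size (minCpoly z) = a.+1.
  have sz1 : size (minCpoly z) = (size (minCpoly z)).-1.+1.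
    by rewrite prednK // size_poly_gt0 monic_neq0 ?minCpoly_monic.
  rewrite sz1; congr _.+1; apply: (@has_degree_uniq L) => //.
  exact: eq_has_degree KL (Qadj_degree sz1).
have [r Dr] := closed_field_poly_normal (minCpoly z).
rewrite (monicP (minCpoly_monic z)) scale1r in Dr.
have sr : size r = a by have := sz; rewrite Dr size_prod_XsubC => -[].
have ur : uniq r.
  by have := minCpoly_separable z; rewrite Dr separable_prod_XsubC.
have rP w : (w \in r) = root (minCpoly z) w by rewrite Dr root_prod_XsubC.
have /fin_all_exists[g yg] := yz.
pose xi (s : 'I_a) i := (pQtoC (g i)).[r`_s].
have nu_g (nu : {rmorphism algC -> algC}) i w : nu (pQtoC (g i)).[w] = (pQtoC (g i)).[nu w].
  exact: (horner_morph_nat ratC ratC nu).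
have rs (s : 'I_a) : r`_s \in r by rewrite mem_nth ?sr.
have conj_r (nu : {rmorphism algC -> algC}) w : w \in r -> nu w \in r.
  rewrite !rP !rootE Dp => /eqP w0; rewrite -(horner_morph_nat ratC ratC nu) w0.
  by rewrite rmorph0.
have from_z (s : 'I_a) : exists nu : {rmorphism algC -> algC}, nu z = r`_s.
  by apply: conj_aut; rewrite -rP.
have to_idx w : w \in r -> exists s : 'I_a, w = r`_s.
  move=> wr; have lt : (index w r < a)%N by rewrite -sr index_mem.
  by exists (Ordinal lt); rewrite nth_index.
have trans (s s' : 'I_a) : exists nu : {rmorphism algC -> algC}, nu r`_s = r`_s'.
  apply: conj_aut; suff -> : minCpoly r`_s = minCpoly z by rewrite -rP.
  by have [nu <-] := from_z s; apply: minCpoly_aut.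
have xi_conj (s : 'I_a) (nu : {rmorphism algC -> algC}) :
    nu z = r`_s -> forall i, xi s i = nu (y i).
  by move=> nuz i; rewrite /xi -nuz -nu_g -yg.
exists xi; last first.
  by move=> s s'; have [nu nus] := trans s s'; exists nu => i; rewrite /xi nu_g nus.
split.
- move=> s; have [nu /xi_conj E] := from_z s; case: nx => l yl ylt; exists l.
    by rewrite E /= yl rmorph1.
  by move=> i il; rewrite E /= ylt // rmorph0.
(* Conjugate points determine the conjugate of [z], because [z] is an integral combination of the
   coordinates. *)
- move=> s s' E; apply/val_inj/eqP; rewrite -(nth_uniq 0 _ _ ur) ?sr; try exact: ltn_ord.
  have [[nu nuz] [nu' nuz']] := (from_z s, from_z s').
  rewrite -nuz -nuz' Dz !rmorph_sum; apply/eqP/eq_bigr => i _; rewrite !rmorphMn.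
  have : (codom y)`_i \in codom y by rewrite mem_nth.
  by case/codomP => l ->; have := E l; rewrite (xi_conj _ _ nuz) (xi_conj _ _ nuz') /= => ->.
- move=> nu s; have [|s' E] := to_idx (nu r`_s); first exact/conj_r/rs.
  by exists s' => i; rewrite /xi nu_g E.
move=> s; have [nu /xi_conj E] := from_z s; split.
  by apply: (@root_ext (nu \o y)); [move=> i; rewrite E|apply/root_conj/root_scale].
apply: (@nonsingular_ext (nu \o y)); first by move=> i; rewrite E.
by apply/nonsingular_conj/nonsingular_scale; rewrite ?invr_eq0.
Qed.

(** A common point carries the whole orbit [xi] into the stable set [xi']. Applied in both
    directions, closed points of different degrees cannot meet. *)
Lemma disjoint_orbits a a' (xi : 'I_a -> 'I_m -> algC) (xi' : 'I_a' -> 'I_m -> algC) s s' :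
  galois_set xi -> galois_set xi' ->
  (forall s s', exists nu : {rmorphism algC -> algC}, forall i, nu (xi s i) = xi s' i) ->
  xi s =1 xi' s' -> (a <= a')%N.
Proof.
move=> [_ inj _ _] [_ _ stab _] trans E.
have /fin_all_exists[g gE] : forall t, exists t', xi t =1 xi' t'.
  move=> t; have [nu nut] := trans s t; have [t' tE] := stab nu s'.
  by exists t' => i; rewrite -nut E tE.
have g_inj : injective g by move=> t t' gt; apply: inj => i; rewrite !gE gt.
by have := leq_card g g_inj; rewrite !card_ord.
Qed.

Lemma galois_set_union a a' (xi : 'I_a -> 'I_m -> algC) (xi' : 'I_a' -> 'I_m -> algC) :
  galois_set xi -> galois_set xi' -> (forall s s', ~ xi s =1 xi' s') ->
  galois_set (fun s : 'I_(a + a') => match split s with inl t => xi t | inr t => xi' t end).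
Proof.
move=> [nrm inj stab pts] [nrm' inj' stab' pts'] dis.
split=> [s|s s'|nu s|s].
- by case: splitP.
- case: (split_ordP s) => t ->; case: (split_ordP s') => t' -> //.
  + by move=> /inj ->.
  + by move=> /dis.
  + by move=> E; case: (dis t' t) => i; rewrite E.
  + by move=> /inj' ->.
- case: (split_ordP s) => t _.
    have [t' E] := stab nu t; exists (lshift a' t') => i.
    by rewrite (unsplitK (inl _ : 'I_a + 'I_a')) E.
  have [t' E] := stab' nu t; exists (rshift a t') => i.
  by rewrite (unsplitK (inr _ : 'I_a + 'I_a')) E.
- by case: splitP.
Qed.

End Points.

(** * Generic coordinates *)

Lemma galois_poly (p : {poly algC}) :
  (forall nu : {rmorphism algC -> algC}, map_poly nu p = p) -> exists q, p = pQtoC q.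
Proof.
move=> fixp; apply: Crat_poly_lift => i; apply: fix_Crat => nu.
by rewrite -coef_map fixp.
Qed.

Section GaloisStable.

Variables (a : nat) (th : 'I_a -> algC).
Hypothesis th_inj : injective th.

Lemma galois_modulus : (forall (nu : {rmorphism algC -> algC}) s, exists s', nu (th s) = th s') ->
  exists A, pQtoC A = \prod_s ('X - (th s)%:P).
Proof.
move=> stab; have [|A DA] := @galois_poly (\prod_s ('X - (th s)%:P)); last by exists A.
move=> nu; have /fin_all_exists[g gE] := stab nu.
have g_inj : injective g by move=> s s' E; apply: th_inj; apply: (fmorph_inj nu); rewrite !gE E.
rewrite rmorph_prod [RHS](reindex_inj g_inj) /=; apply: eq_bigr => s _.
by rewrite rmorphB /= map_polyX map_polyC /= gE.
Qed.

(** An automorphism permutes the interpolation conditions, so by uniqueness it fixes the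
    interpolant, which is therefore rational. *)
Lemma galois_interpolation (ze : 'I_a -> algC) :
  (forall (nu : {rmorphism algC -> algC}) s, exists s', nu (th s) = th s' /\ nu (ze s) = ze s') ->
  exists2 c : {poly rat}, (size c <= a)%N & forall s, (pQtoC c).[th s] = ze s.
Proof.
move=> stab.
pose p := lagrange th ze; have sp : (size p <= a)%N := size_lagrange th ze.
have pE s : p.[th s] = ze s by apply: horner_lagrange.
have [nu|c Dc] := @galois_poly p; last first.
  by exists c => [|s]; rewrite -?Dc // -(size_map_poly ratC) -[map_poly _ _]Dc.
have /fin_all_exists[g gE] := stab nu.
have g_inj : injective g by move=> s s' E; apply: th_inj; apply: (fmorph_inj nu); rewrite !(gE _).1 E.
apply/eqP; rewrite -subr_eq0; apply/eqP.
apply: (@roots_geq_poly_eq0 _ _ [seq th (g s) | s <- enum 'I_a]).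
- apply/allP => _ /mapP[s _ ->]; rewrite rootE hornerD hornerN pE -(gE s).1 horner_map /= pE (gE s).2.
  by rewrite subrr.
- by rewrite map_inj_uniq ?enum_uniq // => s s' /th_inj /g_inj.
rewrite size_map size_enum_ord (leq_trans (size_polyD _ _)) // geq_max size_polyN sp andbT.
by rewrite (leq_trans (size_poly _ _)).
Qed.

End GaloisStable.

Lemma mpolyXU_neq0 m (R : nzRingType) (i : 'I_m) : ('X_i : {mpoly R[m]}) != 0.
Proof.
apply/eqP => /(congr1 (mcoeff U_(i))) /eqP; rewrite mcoeffX eqxx mcoeff0.
by rewrite oner_eq0.
Qed.

Section LinearForm.

Variable m : nat.

Definition linear_form (c : 'I_m -> algC) : {mpoly algC[m]} := \sum_i c i *: 'X_i.

Lemma meval_linear_form c w : (linear_form c).@[w] = \sum_i c i * w i.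
Proof. by rewrite rmorph_sum /=; apply: eq_bigr => i _; rewrite mevalZ mevalXU. Qed.

Lemma linear_form_neq0 c i : c i != 0 -> linear_form c != 0.
Proof.
apply: contraNneq => /(congr1 (meval (fun l => (l == i)%:R))).
rewrite meval_linear_form rmorph0 (bigD1 i) //= eqxx mulr1 big1 ?addr0 => [->//|l li].
by rewrite (negPf li) mulr0.
Qed.

End LinearForm.

Lemma annihilator m (x y : 'I_m -> algC) : (2 < m)%N -> exists l : 'I_m -> algC,
  (exists i, l i != 0) /\ \sum_i l i * x i = 0 /\ \sum_i l i * y i = 0.
Proof.
move=> m2; pose M : 'M[algC]_(m, 2) := \matrix_(i, j) if j == 0 then x i else y i.
have : kermx M != 0.
  by rewrite kermx_eq0 /row_free neq_ltn (leq_ltn_trans (rank_leq_col M)).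
case/rowV0Pn => v /sub_kermxP vM v0; exists (v 0).
have [i vi] : exists i, v 0 i != 0.
  apply/existsP; apply: contraNT v0; rewrite negb_exists => /forallP h; apply/eqP/rowP => i.
  by rewrite mxE; apply/eqP; rewrite -[_ == _]negbK h.
split; [by exists i|split].
- by have := congr1 (fun A : 'M_(1, 2) => A 0 0) vM; rewrite !mxE => E; rewrite -[RHS]E; apply: eq_bigr => l _; rewrite mxE.
- by have := congr1 (fun A : 'M_(1, 2) => A 0 1) vM; rewrite !mxE => E; rewrite -[RHS]E; apply: eq_bigr => l _; rewrite mxE.
Qed.

Section GenericChoice.

Variables (N : nat) (p : 'I_(2 + N)).
Local Notation m := (2 + N)%N.
Hypotheses (p0 : p != lshift N 0) (p1 : p != lshift N 1).
Variables (a : nat) (fQ : {mpoly rat[2 + N]}) (xi : 'I_a -> 'I_m -> algC).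
Hypothesis fQ_neq0 : fQ != 0.
Hypothesis xi_smooth : forall s, exists i, mmap ratC (xi s) (mderiv i fQ) != 0.
Hypothesis xi_neq0 : forall s, exists i, xi s i != 0.
Hypothesis xi_indep : forall s s' c, (forall i, xi s i = c * xi s' i) -> s = s'.

Lemma generic_direction : (0 < N)%N -> exists v : 'I_m -> rat,
  [/\ fQ.@[v] != 0, v p != 0,
      forall s, \sum_i mmap ratC (xi s) (mderiv i fQ) * ratC (v i) != 0 &
      forall s s' c c', ~ forall i, ratC (v i) = c * xi s i + c' * xi s' i].
Proof.
move=> N0; have m2 : (2 < m)%N by rewrite -addn1 leq_add2l.
have ann s s' := annihilator (xi s) (xi s') m2.
have /fin_all_exists[l lP] := fun ss : 'I_a * 'I_a => ann ss.1 ss.2.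
pose w (o : option (option ('I_a + 'I_a * 'I_a))) : {mpoly algC[m]} := match o with
  | None => map_mpoly ratC fQ
  | Some None => 'X_p
  | Some (Some (inl s)) => linear_form (fun i => mmap ratC (xi s) (mderiv i fQ))
  | Some (Some (inr ss)) => linear_form (l ss) end.
have [[[[s|ss]|]|]|b hb] := @mpoly_prod_nonroot m _ w.
- by have [i] := xi_smooth s; apply: linear_form_neq0.
- by have [[i li] _] := lP ss; apply: linear_form_neq0 li.
- exact: mpolyXU_neq0.
- by rewrite /= -(rmorph0 (map_mpoly ratC)) (inj_eq (map_mpoly_inj (fmorph_inj ratC))).
exists (fun i => (b i)%:R); split.
- have := hb None; rewrite /= -mmap_meval; apply: contraNneq => E.
  apply/eqP; transitivity (ratC fQ.@[fun i => (b i)%:R]); last by rewrite E rmorph0.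
  symmetry; apply: (@mmap_morph _ _ _ _ idfun ratC ratC) => // i.
  by rewrite /= ratr_nat.
- by have := hb (Some None); rewrite /= mevalXU -(ratr_nat algC) fmorph_eq0.
- move=> s; have := hb (Some (Some (inl s))); rewrite /= meval_linear_form.
  by apply: contraNneq => E; apply/eqP; rewrite -[RHS]E; apply: eq_bigr => i _; rewrite ratr_nat.
move=> s s' c c' E; have := hb (Some (Some (inr (s, s')))); rewrite /= meval_linear_form.
have [_ [/= l1 l2]] := lP (s, s').
rewrite (eq_bigr (fun i => c * (l (s, s') i * xi s i) + c' * (l (s, s') i * xi s' i))) => [|i _].
  by rewrite big_split -!mulr_sumr /= l1 l2 !mulr0 addr0 eqxx.
rewrite -(ratr_nat algC) E; ring.
Qed.

Variable v : 'I_m -> rat.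
Hypothesis v_p : v p != 0.
Hypothesis v_span : forall s s' c c', ~ forall i, ratC (v i) = c * xi s i + c' * xi s' i.

(* The linear form [x |-> w . (v_p x - x_p v)], which kills [v]. *)
Definition form (w : 'I_m -> rat) (i : 'I_m) : rat :=
  if i == p then - \sum_(l | l != p) w l * v l else v p * w i.

Lemma sum_form (S : comNzRingType) (j : {rmorphism rat -> S}) w x :
  \sum_i j (form w i) * x i = \sum_i (j (v p) * x i - j (v i) * x p) * j (w i).
Proof.
rewrite (bigD1 p) //= [RHS](bigD1 p) //= {1}/form eqxx subrr mul0r add0r.
rewrite rmorphN rmorph_sum mulNr mulr_suml -sumrN -big_split; apply: eq_bigr => i ip /=.
rewrite /form (negPf ip) !rmorphM; ring.
Qed.

Lemma form_kills w : \sum_i form w i * v i = 0.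
Proof.
by rewrite (@sum_form _ idfun) big1 // => i _; rewrite /= [v i * _]mulrC subrr mul0r.
Qed.

Lemma not_prop (x : 'I_m -> algC) : (exists i, x i != 0) ->
  (forall c, ~ forall i, ratC (v i) = c * x i) ->
  exists i, ratC (v p) * x i - ratC (v i) * x p != 0.
Proof.
move=> [i xi0] nprop; apply: NNPP => nex.
have {}nex l : ratC (v p) * x l = ratC (v l) * x p.
  by apply/eqP; rewrite -subr_eq0; apply/negPn/negP => h; apply: nex; exists l.
have vp : ratC (v p) != 0 by rewrite fmorph_eq0.
have [xp|xp] := eqVneq (x p) 0.
  by move/eqP: (nex i); rewrite xp mulr0 mulf_eq0 (negPf vp) (negPf xi0).
by apply: (nprop (ratC (v p) / x p)) => l; rewrite mulrAC nex mulfK.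
Qed.

(** Both forms vanish at [v], so [v] gets the coordinates [(0 : 0 : eta)]. The ratio [l1 / l0] is
    finite and injective on the points, hence can serve as the parameter [t]. The index [p] lies
    beyond the first two, which leaves the coefficients there free. *)
Lemma generic_forms : exists l0 l1 : 'I_m -> rat,
  [/\ \sum_i l0 i * v i = 0 /\ \sum_i l1 i * v i = 0,
      l0 (lshift N 0) * l1 (lshift N 1) != l0 (lshift N 1) * l1 (lshift N 0),
      forall s, \sum_i ratC (l0 i) * xi s i != 0 &
      forall s s', s != s' -> (\sum_i ratC (l1 i) * xi s i) * (\sum_i ratC (l0 i) * xi s' i) !=
        (\sum_i ratC (l1 i) * xi s' i) * (\sum_i ratC (l0 i) * xi s i)].
Proof.
pose k x i := ratC (v p) * x i - ratC (v i) * x p.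
pose W0 (o : option 'I_a) : {mpoly algC[m]} := match o with
  | None => 'X_(lshift N 0) | Some s => linear_form (k (xi s)) end.
have [[s|]|b0 hb0] := @mpoly_prod_nonroot m _ W0.
- have [|i] := not_prop (xi_neq0 s); last exact: linear_form_neq0.
  by move=> c E; apply: (@v_span s s c 0) => i; rewrite mul0r addr0.
- exact: mpolyXU_neq0.
pose l0 := form (fun i => (b0 i)%:R).
have l0E s : \sum_i ratC (l0 i) * xi s i != 0.
  have := hb0 (Some s); rewrite /= meval_linear_form sum_form.
  by apply: contraNneq => E; apply/eqP; rewrite -[RHS]E; apply: eq_bigr => i _; rewrite /= ratr_nat.
pose L0 s := \sum_i ratC (l0 i) * xi s i.
(* This combination of two points is killed by [l0], so [l1] separates their parameters if it is
   nonzero on it. It is not a multiple of [v] modulo which the forms work, because [v] is outside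
   the span. *)
pose W1 (o : option ('I_a * 'I_a)) : {mpoly algC[m]} := match o with
  | None => (b0 (lshift N 0))%:R *: 'X_(lshift N 1) - (b0 (lshift N 1))%:R *: 'X_(lshift N 0)
  | Some (s, s') => if s == s' then 1 else linear_form (k (fun i => L0 s' * xi s i - L0 s * xi s' i)) end.
have [[[s s']|]|b1 hb1] := @mpoly_prod_nonroot m _ W1.
- rewrite /=; have [_|/eqP ss'] := eqVneq s s'; first exact: oner_neq0.
  case: (@not_prop (fun i => L0 s' * xi s i - L0 s * xi s' i)) => [||i].
  + apply: NNPP => nex; apply: ss'; apply: (@xi_indep s s' (L0 s / L0 s')) => i.
    have /eqP : L0 s' * xi s i - L0 s * xi s' i = 0.
      by apply/eqP/negPn/negP => h; apply: nex; exists i.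
    rewrite subr_eq0 => /eqP E; rewrite mulrAC -E mulrAC mulfV ?mul1r //.
    exact: l0E.
  + move=> c E; apply: (@v_span s s' (c * L0 s') (- (c * L0 s))) => i; rewrite E; ring.
  + exact: linear_form_neq0.
- apply: contraTneq (hb0 None) => /(congr1 (meval (fun l => (l == lshift N 1)%:R))).
  rewrite /= rmorphB /= !mevalZ !mevalXU eqxx mulr1 (_ : (lshift N 0 == lshift N 1) = false) //.
  by rewrite mulr0 subr0 rmorph0 => ->; rewrite eqxx.
pose l1 := form (fun i => (b1 i)%:R); exists l0, l1; split => //.
- by split; apply: form_kills.
- rewrite /l0 /l1 /form ![_ == p]eq_sym (negPf p0) (negPf p1).
  have := hb1 None; rewrite /= rmorphB /= !mevalZ !mevalXU; apply: contraNneq => E.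
  have {}E : (b0 (lshift N 0))%:R * (b1 (lshift N 1))%:R = (b0 (lshift N 1))%:R * (b1 (lshift N 0))%:R :> rat.
    apply: (mulfI (mulf_neq0 v_p v_p)); rewrite mulrACA E; ring.
  by rewrite subr_eq0 -!natrM; move/eqP: E; rewrite -!natrM !eqr_nat.
move=> s s' ss'; have := hb1 (Some (s, s')); rewrite /= (negPf ss') meval_linear_form.
apply: contraNneq => E; apply/eqP.
transitivity (\sum_i ratC (l1 i) * (L0 s' * xi s i - L0 s * xi s' i)).
  by rewrite sum_form; apply: eq_bigr => i _; rewrite /= ratr_nat.
under eq_bigr => i _ do rewrite mulrBr ![_ * (L0 _ * _)]mulrCA.
rewrite sumrB -!mulr_sumr; apply/eqP.
by rewrite subr_eq0 mulrC [L0 s * _]mulrC; apply/eqP.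
Qed.

End GenericChoice.

(** * Values and gradients under linear changes of coordinates *)

Section Coordinates.

Variables (m : nat) (V W : 'M[rat]_m).
Hypotheses (VW : V *m W = 1%:M) (WV : W *m V = 1%:M).

Lemma coord_back (S : comNzRingType) (j : {rmorphism rat -> S}) (x : 'I_m -> S) i :
  \sum_r j (V r i) * (\sum_l j (W l r) * x l) = x i.
Proof.
transitivity (\sum_l j ((W *m V) l i) * x l).
  under eq_bigr => r _ do rewrite mulr_sumr.
  rewrite exchange_big; apply: eq_bigr => l _ /=.
  rewrite mxE rmorph_sum mulr_suml; apply: eq_bigr => r _.
  by rewrite rmorphM mulrA [_ * j (W l r)]mulrC.
rewrite WV (bigD1 i) //= mxE eqxx rmorph1 mul1r big1 ?addr0 // => l li.
by rewrite mxE (negPf li) rmorph0 mul0r.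
Qed.

Lemma coord_mmap (S : comNzRingType) (j : {rmorphism rat -> S}) (x : 'I_m -> S) p :
  mmap j (fun r => \sum_i j (W i r) * x i) (lsub V p) = mmap j x p.
Proof. by rewrite mmap_lsub; apply: mmap_eq => i; apply: coord_back. Qed.

Lemma mderiv_lsub r p : mderiv r (lsub V p) = \sum_i (V r i)%:MP * lsub V (mderiv i p).
Proof.
elim/mpoly_ring_ind: p => [c|k|p q IHp IHq|p q IHp IHq].
- by rewrite lsub_C mderivC big1 // => i _; rewrite mderivC rmorph0 mulr0.
- rewrite lsub_X raddf_sum /= (bigD1 r) //= mderivZ mderivXU eqxx mpolyC1.
  rewrite [X in _ + X]big1 ?addr0 => [|i ir]; last by rewrite mderivZ mderivXU (negPf ir) mpolyC0 scaler0.
  rewrite (bigD1 k) //= [X in _ + X]big1 ?addr0 => [|i ik].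
    by rewrite mderivXU eqxx mpolyC1 rmorph1 -mul_mpolyC.
  by rewrite mderivXU eq_sym (negPf ik) mpolyC0 rmorph0 mulr0.
- rewrite rmorphD mderivD IHp IHq -big_split; apply: eq_bigr => i _ /=.
  by rewrite mderivD rmorphD mulrDr.
rewrite rmorphM mderivM IHp IHq mulr_suml mulr_sumr -big_split.
apply: eq_bigr => i _ /=; rewrite mderivM rmorphD !rmorphM /=; ring.
Qed.

Lemma coord_mderiv (S : comNzRingType) (j : {rmorphism rat -> S}) (x : 'I_m -> S) r p :
  mmap j (fun r => \sum_i j (W i r) * x i) (mderiv r (lsub V p)) =
  \sum_i j (V r i) * mmap j x (mderiv i p).
Proof.
rewrite mderiv_lsub rmorph_sum; apply: eq_bigr => i _ /=.
by rewrite rmorphM /= mmapC coord_mmap.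
Qed.

(** The pairing of a gradient with a vector is independent of coordinates; this converts
    transversality of [v] into the condition [h_dir] on [eta]. *)
Lemma coord_gradient (S : comNzRingType) (j : {rmorphism rat -> S}) (x v : 'I_m -> S) p :
  \sum_r mmap j (fun r => \sum_i j (W i r) * x i) (mderiv r (lsub V p)) * (\sum_i j (W i r) * v i)
  = \sum_i mmap j x (mderiv i p) * v i.
Proof.
under eq_bigr => r _ do rewrite coord_mderiv mulr_suml.
rewrite exchange_big; apply: eq_bigr => i _ /=.
rewrite -(coord_back j v i) mulr_sumr; apply: eq_bigr => r _.
by rewrite mulrCA mulrA.
Qed.

End Coordinates.

(** With [l0], [l1] and unit vectors as columns, invertibility reduces to the two by two minor of
    the hypothesis. *)
Lemma frame N (l0 l1 : 'I_(2 + N) -> rat) :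
  l0 (lshift N 0) * l1 (lshift N 1) != l0 (lshift N 1) * l1 (lshift N 0) ->
  exists V W : 'M[rat]_(2 + N), [/\ V *m W = 1%:M, W *m V = 1%:M &
    forall i r, W i r = pt (l0 i) (l1 i) (fun k => (i == rshift 2 k)%:R) r].
Proof.
move=> det; pose W := \matrix_(i, r) pt (l0 i) (l1 i) (fun k => (i == rshift 2 k)%:R) r.
have Wu : W \in unitmx.
  rewrite -row_free_unit -kermx_eq0; apply/eqP/row_matrixP => s; rewrite row0.
  have : row s (kermx W) *m W = 0 by rewrite -row_mul mulmx_ker row0.
  move: (row s (kermx W)) => v vW.
  have E r : \sum_i v 0 i * W i r = 0 by have := congr1 (fun A : 'rV_(2 + N) => A 0 r) vW; rewrite !mxE.
  have vr k : v 0 (rshift 2 k) = 0.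
    rewrite -[RHS](E (rshift 2 k)) (bigD1 (rshift 2 k)) //= mxE ptr eqxx mulr1.
    by rewrite big1 ?addr0 // => i ik; rewrite mxE ptr (negPf ik) mulr0.
  have tail F : \sum_k v 0 (rshift 2 k) * F k = 0 by rewrite big1 // => k _; rewrite vr mul0r.
  have := E (lshift N 0); have := E (lshift N 1); rewrite !sum_pt !tail !addr0 !mxE !pt0 !pt1.
  move=> E1 E0.
  have solve (x y a b c e : rat) : a * e != b * c -> x * a + y * b = 0 -> x * c + y * e = 0 -> x = 0.
    move=> nz Eab Ece; apply: (mulIf (_ : a * e - b * c != 0)); rewrite ?subr_eq0 // mul0r.
    transitivity ((x * a + y * b) * e - (x * c + y * e) * b); first by ring.
    by rewrite Eab Ece !mul0r subr0.
  have v0 : v 0 (lshift N 0) = 0 := solve _ _ _ _ _ _ det E0 E1.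
  have v1 : v 0 (lshift N 1) = 0.
    by apply: (solve _ (v 0 (lshift N 0)) _ _ _ _ _ _ _); [| rewrite addrC; apply: E0
      | rewrite addrC; apply: E1]; rewrite eq_sym.
  by apply/rowP => i; rewrite [RHS]mxE; elim/pt_ind: i.
exists (invmx W), W; split; [exact: mulVmx|exact: mulmxV|by move=> i r; rewrite mxE].
Qed.

Lemma mmap_int_rat m (x : 'I_m -> algC) (f : {mpoly int[m]}) :
  mmap ratC x (map_mpoly intQ f) = mmap intC x f.
Proof.
rewrite !mmap_meval; congr (meval x _); apply/mpolyP => mm.
by rewrite !mcoeff_map_mpoly /= ratr_int.
Qed.

Lemma map_mpoly_homog m (R S : comNzRingType) (j : {rmorphism R -> S}) d (p : {mpoly R[m]}) :
  p \is d.-homog -> map_mpoly j p \is d.-homog.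
Proof.
move=> /dhomogP hp; apply/dhomogP => mm; rewrite mcoeff_msupp mcoeff_map_mpoly => nz.
by apply: hp; rewrite mcoeff_msupp; apply: contraNneq nz => ->; apply/eqP/rmorph0.
Qed.

(** The parameter [t] is a quotient of two rational linear forms in the coordinates, so it lies in
    every field of definition of the point; this is what will make the point new over [Qadj t]. *)
Lemma curve_point N a d (f : {mpoly int[2 + N]}) (xi : 'I_a -> 'I_(2 + N) -> algC) q gen :
  (0 < N)%N -> (0 < d)%N -> f \is d.-homog -> mirreducible f -> galois_set f xi -> (a.+2 <= q)%N ->
  exists t x, [/\ size (minCpoly t) = ((a + q) * d - a).+1,
    forall g : {poly rat}, t <> (pQtoC g).[gen],
    point_in f (Qadj t) x, nonsingular f x &
    forall K, is_subfield K -> defined_over K x -> t \in K].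
Proof.
move=> N0 d0 f_homog f_irr [nrm inj stab pts] aq.
pose fQ := map_mpoly intQ f.
have fQ_prime : prime_elt fQ := prime_elt_rat d0 f_homog (mirreducible_prime d0 f_homog f_irr).
have fQ_homog : fQ \is d.-homog := map_mpoly_homog intQ f_homog.
have fQ0 : fQ != 0 by case: fQ_prime => /eqP.
have rootQ x : mmap ratC x fQ = meval x (fC f) by rewrite mmap_int_rat meval_fC.
have derQ x i : mmap ratC x (mderiv i fQ) = meval x (mderiv i (fC f)).
  by rewrite -map_mpoly_mderiv mmap_int_rat meval_mderiv_fC.
pose p : 'I_(2 + N) := rshift 2 (Ordinal N0).
have p0 : p != lshift N 0 by rewrite eq_rlshift.
have p1 : p != lshift N 1 by rewrite eq_rlshift.
have xi_root s : mmap ratC (xi s) fQ = 0 by rewrite rootQ; case: (pts s).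
have xi_smooth s : exists i, mmap ratC (xi s) (mderiv i fQ) != 0.
  by case: (pts s) => _ [i xii]; exists i; rewrite derQ.
have xi_neq0 s : exists i, xi s i != 0.
  by case: (nrm s) => i xii _; exists i; rewrite xii oner_neq0.
have xi_indep s s' c : (forall i, xi s i = c * xi s' i) -> s = s'.
  by move=> E; apply/inj/(normalized_scale (nrm s) (nrm s') E).
have [v [v_f v_p v_der v_span]] := generic_direction p fQ0 xi_smooth N0.
have [l0 [l1 [[l0v l1v] det l0xi l1xi]]] := generic_forms p0 p1 xi_neq0 xi_indep v_p v_span.
have [V [W [VW WV WE]]] := frame det.
pose h := lsub V fQ.
have h_prime : prime_elt h := lsub_prime VW WV fQ_prime.
have h_homog : h \is d.-homog := lsub_homog V fQ_homog.
pose L0 s := \sum_i ratC (l0 i) * xi s i; pose L1 s := \sum_i ratC (l1 i) * xi s i.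
pose eta k := v (rshift 2 k).
pose th s := L1 s / L0 s; pose ze s k := xi s (rshift 2 k) / L0 s.
have coordE (S : comNzRingType) (j : {rmorphism rat -> S}) (x : 'I_(2 + N) -> S) r :
    \sum_i j (W i r) * x i =
    pt (\sum_i j (l0 i) * x i) (\sum_i j (l1 i) * x i) (fun k => x (rshift 2 k)) r.
  elim/pt_ind: r => [||k]; rewrite ?pt0 ?pt1 ?ptr.
  - by apply: eq_bigr => i _; rewrite WE pt0.
  - by apply: eq_bigr => i _; rewrite WE pt1.
  rewrite (bigD1 (rshift 2 k)) //= WE ptr eqxx rmorph1 mul1r big1 ?addr0 // => i ik.
  by rewrite WE ptr (negPf ik) rmorph0 mul0r.
have coord_v r : \sum_i W i r * v i = pt 0 0 eta r by have := coordE _ idfun v r; rewrite l0v l1v.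
have coord_xi s r : \sum_i ratC (W i r) * ((L0 s)^-1 * xi s i) = pt 1 (th s) (ze s) r.
  transitivity ((L0 s)^-1 * \sum_i ratC (W i r) * xi s i).
    by rewrite mulr_sumr; apply: eq_bigr => i _; rewrite mulrCA.
  rewrite coordE -/(L0 s) -/(L1 s).
  by elim/pt_ind: r => [||k]; rewrite ?pt0 ?pt1 ?ptr ?mulVf ?l0xi // mulrC.
have h_eta : h.@[pt 0 0 eta] != 0.
  rewrite -(meval_eq _ coord_v).
  by have := coord_mmap WV idfun v fQ; rewrite -/h => E; rewrite [meval _ _]E.
have th_inj : injective th.
  move=> s s' E; apply/eqP; apply: contraTT isT => /l1xi; rewrite -/(L0 s) -/(L1 s) -/(L0 s') -/(L1 s').
  by move: E => /eqP; rewrite /th eqr_div ?l0xi // => ->.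
have h_ze s : mmap ratr (pt 1 (th s) (ze s)) h = 0.
  rewrite -(mmap_eq _ _ (coord_xi s)) (coord_mmap WV ratC) (homog_scale _ _ _ fQ_homog) xi_root.
  by rewrite mulr0.
have h_dir s : \sum_k mmap ratr (pt 1 (th s) (ze s)) (mderiv (rshift 2 k) h) * ratr (eta k) != 0.
  have := coord_gradient WV ratC (fun i => (L0 s)^-1 * xi s i) (fun i => ratC (v i)) fQ.
  rewrite sum_pt -/h.
  have cv r : \sum_i ratC (W i r) * ratC (v i) = ratC (pt 0 0 eta r).
    by rewrite -coord_v rmorph_sum; apply: eq_bigr => i _; rewrite rmorphM.
  rewrite !cv pt0 pt1 rmorph0 !mulr0 !add0r => E.
  have -> : \sum_k mmap ratr (pt 1 (th s) (ze s)) (mderiv (rshift 2 k) h) * ratr (eta k) =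
      \sum_i mmap ratC (fun i => (L0 s)^-1 * xi s i) (mderiv i fQ) * ratC (v i).
    rewrite -E; apply: eq_bigr => k _; rewrite cv ptr; congr (_ * _).
    exact: mmap_eq _ _ (fun r => esym (coord_xi s r)).
  under eq_bigr => i _ do rewrite (homog_scale _ _ _ (mderiv_homog i fQ_homog)) -mulrA.
  by rewrite -mulr_sumr mulf_neq0 ?expf_neq0 ?invr_eq0 ?l0xi ?v_der.
have nuL (nu : {rmorphism algC -> algC}) s s' (l : 'I_(2 + N) -> rat) : (forall i, nu (xi s i) = xi s' i) ->
    nu (\sum_i ratC (l i) * xi s i) = \sum_i ratC (l i) * xi s' i.
  move=> E; rewrite rmorph_sum; apply: eq_bigr => i _.
  by rewrite rmorphM E; congr (_ * _); apply: (rat_rmorph_eq (nu \o ratC) ratC).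
have stab' (nu : {rmorphism algC -> algC}) s : exists s', nu (th s) = th s' /\ forall k, nu (ze s k) = ze s' k.
  have [s' E] := stab nu s; exists s'; split=> [|k].
    by rewrite fmorph_div !(nuL nu s s').
  by rewrite fmorph_div E !(nuL nu s s').
have [|A DA] := galois_modulus th_inj; first by move=> nu s; have [s' [E _]] := stab' nu s; exists s'.
have /fin_all_exists[c0 c0P] : forall k, exists c : {poly rat}, (size c <= a)%N /\
    forall s, (pQtoC c).[th s] = ze s k.
  move=> k; have [|c sc cE] := @galois_interpolation _ _ th_inj (fun s => ze s k); last by exists c.
  by move=> nu s; have [s' [E E']] := stab' nu s; exists s'.
have [t [w /= [st tg hx [r dr]]]] := curve_field d0 h_homog h_prime h_eta th_inj DA
  (fun k => (c0P k).1) (fun s k => (c0P k).2 s) h_ze h_dir aq gen.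
set y := pt 1 t _ in hx dr; pose x i := \sum_r ratC (V r i) * y r.
have xy l : \sum_i ratC (W i l) * x i = y l by apply: (@coord_back _ W V VW _ ratC).
have hxE : mmap ratC x fQ = 0 by rewrite -[RHS]hx -(coord_mmap WV ratC); apply: mmap_eq.
have tQ : t \in Qadj t by apply/QadjP; exists 'X; rewrite map_polyX hornerX.
have Qt := Qadj_subfield t.
exists t, x; split=> //.
- split; [|split].
  + apply: NNPP => nex; have := oner_neq0 algC.
    have -> : 1 = y (lshift N 0) by rewrite /y pt0.
    rewrite -xy big1 ?eqxx // => i _; have [->|xi0] := eqVneq (x i) 0; first by rewrite mulr0.
    by case: nex; exists i.
  + move=> i; apply: (subfield_sum Qt) => r'; apply: (subfieldM Qt); first exact: subfield_rat.
    rewrite /y; elim/pt_ind: r' => [||k]; rewrite ?pt0 ?pt1 ?ptr //; first by case: Qt.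
    by apply/QadjP; exists (w k).
  + by rewrite -rootQ.
- apply: NNPP => sing; case/negP: dr.
  rewrite -(mmap_eq _ _ xy) (coord_mderiv WV ratC) big1 // => i _.
  have [->|nz] := eqVneq (mmap ratC x (mderiv i fQ)) 0; first by rewrite mulr0.
  by case: sing; exists i; rewrite -derQ.
move=> K Ksub [lam [lam0 xK]].
have yK l : lam * y l \in K.
  rewrite -xy mulr_sumr; apply: (subfield_sum Ksub) => i.
  by rewrite mulrCA; apply: (subfieldM Ksub) => //; apply: subfield_rat.
have -> : t = lam * y (lshift N 1) / (lam * y (lshift N 0)).
  by rewrite /y pt0 pt1 mulr1 mulrAC mulfV ?mul1r.
by case: Ksub => _ _; apply.
Qed.

(** * Degrees of new points *)

(** A primitive element [z] of the generators found so far serves as [gen]; a generator outside its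
    field gives a field different from all earlier ones. *)
Lemma infinitely_many_Qadj (good : algC -> Prop) (P : pred algC -> Prop) :
  (forall gen, exists2 t, good t & forall g : {poly rat}, t <> (pQtoC g).[gen]) ->
  (forall t, good t -> P (Qadj t)) -> infinitely_many_fields P.
Proof.
move=> new goodP k.
suff [s [sk sgood sdis]] : exists s : seq algC, [/\ size s = k, forall t, t \in s -> good t &
    forall i j, (i < k)%N -> (j < k)%N -> i <> j -> ~ (Qadj s`_i =i Qadj s`_j)].
  exists (map Qadj s); rewrite size_map; split=> //; split=> [i ik|i j ik jk].
    by rewrite (nth_map 0) ?sk //; apply/goodP/sgood; rewrite mem_nth ?sk.
  by rewrite !(nth_map 0) ?sk //; apply: sdis.
elim: k => [|k [s [sk sgood sdis]]]; first by exists [::].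
have [z _ [ps Dps]] := algC_PET s.
have [t tgood tnew] := new z.
have t_out i : (i < k)%N -> ~ (Qadj t =i Qadj s`_i).
  move=> ik E; have : s`_i \in s by rewrite mem_nth ?sk.
  rewrite {2}Dps => /mapP[g _ Ei].
  have : t \in Qadj s`_i by rewrite -E; apply/QadjP; exists 'X; rewrite map_polyX hornerX.
  case/QadjP => g' Dt; apply: (tnew (g' \Po g)).
  by rewrite map_comp_poly horner_comp -Ei; apply: Dt.
exists (t :: s); split=> [|u|[|i] [|j] //= ik jk ij].
- by rewrite /= sk.
- by rewrite inE => /predU1P[->|/sgood].
- exact: t_out.
- by move=> E; apply: (t_out i) => // u; rewrite E.
- by apply: sdis => // E; apply: ij; rewrite E.
Qed.

(** * Residue classes of degrees modulo [d] *)

Section Arithmetic.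

Variables (d : nat) (D Dinf : nat -> Prop).
Hypothesis d_gt0 : (0 < d)%N.
Hypothesis Dinf_D : forall n, Dinf n -> D n.

Definition residue_in r := exists n0, forall n, (n0 <= n)%N -> n = r %[mod d] -> Dinf n.
Definition opposite_in a := exists n0, forall n, (n0 <= n)%N -> (d %| n + a)%N -> Dinf n.

Hypothesis opposite0 : opposite_in 0.
Hypothesis oppositeD : forall a, D a -> opposite_in a.
Hypothesis opposite_add : forall a a', D a -> D a' -> a <> a' -> opposite_in (a + a').

Lemma residue_eqmod r r' : r = r' %[mod d] -> residue_in r -> residue_in r'.
Proof. by move=> E [n0 h]; exists n0 => n nn0 En; apply: h; rewrite // En E. Qed.

Lemma opposite_element a b : opposite_in a -> exists n, [/\ D n, (b <= n)%N & (d %| n + a)%N].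
Proof.
case=> n0 h; pose n := ((n0 + b + a) * d - a)%N.
have le : (n0 + b + a <= (n0 + b + a) * d)%N by rewrite leq_pmulr.
have dn : (d %| n + a)%N by rewrite subnK ?dvdn_mull // (leq_trans _ le) // leq_addl.
exists n; split=> //; last by rewrite /n; lia.
by apply/Dinf_D/h => //; rewrite /n; lia.
Qed.

Lemma residue_element r b : residue_in r -> exists n, [/\ D n, (b <= n)%N & n = r %[mod d]].
Proof.
case=> n0 h; pose n := ((n0 + b) * d + r)%N.
have le : (n0 + b <= (n0 + b) * d)%N by rewrite leq_pmulr.
have En : n = r %[mod d] by rewrite modnMDl.
exists n; split=> //; last by rewrite /n; lia.
by apply/Dinf_D/h => //; rewrite /n; lia.
Qed.

(* Some large [n = -a] lies in [D], and every large [k = a = -n] is then obtained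
   from [n]. *)
Lemma opposite_residue a : opposite_in a -> residue_in a.
Proof.
move=> /(opposite_element 0)[n [Dn _ dn]]; have [n0 h] := oppositeD Dn.
exists n0 => k kn0 Ek; apply: h => //.
by rewrite /dvdn -modnDml Ek modnDml addnC -/(dvdn _ _).
Qed.

(** Both classes have elements in [D], and the second can be taken larger than the first. Their
    degrees then differ, so [opposite_add] applies, and [opposite_residue] removes the sign. *)
Lemma residue_add r r' : residue_in r -> residue_in r' -> residue_in (r + r').
Proof.
move=> /(residue_element 0)[n [Dn _ En]] /(residue_element n.+1)[n' [Dn' nn' En']].
apply: (@residue_eqmod (n + n')); first by rewrite -modnDm En En' modnDm.
by apply/opposite_residue/opposite_add => // E; rewrite E ltnn in nn'.
Qed.

Lemma residue_mul r k : residue_in r -> residue_in (k * r).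
Proof.
move=> hr; elim: k => [|k IH]; first exact: opposite_residue.
by rewrite mulSn; apply: residue_add.
Qed.

(** The classes form a subgroup modulo [d], generated by its least positive element [g]. It contains
    all of [D], so [g] divides [G]. *)
Lemma residue_gcd G : (forall e, (forall n, D n -> (e %| n)%N) -> (e %| G)%N) ->
  forall n, (G %| n)%N -> residue_in n.
Proof.
move=> Gmax; have [g [g0 gin gmin]] : exists g, [/\ (0 < g)%N, residue_in g &
    forall g', (0 < g')%N -> residue_in g' -> (g <= g')%N].
  have din : residue_in d by apply: residue_eqmod (opposite_residue opposite0); rewrite modnn mod0n.
  suff min k : forall g, (g <= k)%N -> (0 < g)%N -> residue_in g -> exists g, [/\ (0 < g)%N,
      residue_in g & forall g', (0 < g')%N -> residue_in g' -> (g <= g')%N].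
    exact: min (leqnn d) d_gt0 din.
  elim: k => [|k IH] g gk g0 gin.
    by move: g0; rewrite ltnNge gk.
  case: (classic (exists g', [/\ (0 < g')%N, residue_in g' & (g' < g)%N])) => [[g' [g'0 g'in lt]]|nex].
    by apply: (IH g') => //; rewrite -ltnS (leq_trans lt).
  exists g; split=> // g' g'0 g'in; rewrite leqNgt; apply/negP => lt.
  by apply: nex; exists g'.
have gdvd r : residue_in r -> (g %| r)%N.
  move=> rin; have sin : residue_in (r %% g).
    (* Only addition is available, so subtracting a multiple of [g] is replaced by adding it [d - 1]
       times. *)
    apply: (@residue_eqmod (r + (d.-1 * (r %/ g)) * g)).
      rewrite (_ : (r + _ = r %/ g * g * d + r %% g)%N) ?modnMDl // {1}(divn_eq r g).
      by rewrite -[in RHS](prednK d_gt0) mulnS addnAC -mulnA [(d.-1 * _)%N]mulnC.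
    by apply: residue_add => //; apply: residue_mul.
  rewrite /dvdn; apply/negPn/negP; rewrite -lt0n => s0.
  by have := gmin _ s0 sin; rewrite leqNgt ltn_mod g0.
move=> n Gn; have : (g %| n)%N.
  by apply: dvdn_trans Gn; apply: Gmax => a Da; apply/gdvd/opposite_residue/oppositeD.
by case/dvdnP => k ->; apply: residue_mul.
Qed.

(** There are [d] residue classes, so the maximum of their thresholds is a common one. *)
Lemma large_multiples G : (forall e, (forall n, D n -> (e %| n)%N) -> (e %| G)%N) ->
  exists n0, forall n, (n0 <= n)%N -> (G %| n)%N -> Dinf n.
Proof.
move=> Gmax.
have /fin_all_exists[b bP] : forall r : 'I_d, exists n0, forall n, (n0 <= n)%N -> (n %% d)%N = r ->
    (G %| n)%N -> Dinf n.
  move=> r; case: (classic (exists2 n1, (n1 %% d)%N = r & (G %| n1)%N)) => [[n1 En1 Gn1]|nex].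
    have [n0 h] := residue_gcd Gmax Gn1; exists n0 => n nn0 En _.
    by apply: h => //; rewrite En En1.
  by exists 0 => n _ En Gn; case: nex; exists n.
exists (\max_r b r) => n nn0 Gn.
apply: (bP (Ordinal (ltn_pmod n d_gt0))) => //.
by apply: leq_trans nn0; apply: leq_bigmax.
Qed.

End Arithmetic.

Section Degrees.

Variables (N d : nat) (f : {mpoly int[2 + N]}).
Hypotheses (N_gt0 : (0 < N)%N) (d_gt0 : (0 < d)%N) (f_homog : f \is d.-homog).
Hypothesis f_irr : mirreducible f.

Lemma galois_set_opposite a (xi : 'I_a -> 'I_(2 + N) -> algC) :
  galois_set f xi -> opposite_in d (Dinf f) a.
Proof.
(* With [n + a = e * d] the exponent is [q = e - a]; the threshold ensures [e >= a + a.+2], that is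
   [q >= a.+2]. *)
move=> xiP; exists ((a + a.+2) * d)%N => n nn0 /dvdnP[e De].
have le : ((a + a.+2) <= e)%N by rewrite -(leq_pmul2r d_gt0) -De (leq_trans nn0) // leq_addr.
have -> : n = ((a + (e - a)) * d - a)%N.
  by rewrite subnKC -?De ?addnK // (leq_trans _ le) // leq_addr.
have q_ge : (a.+2 <= e - a)%N by rewrite leq_subRL ?(leq_trans _ le) // leq_addr.
pose n' := ((a + (e - a)) * d - a)%N.
apply: (@infinitely_many_Qadj (fun t => size (minCpoly t) = n'.+1 /\ exists x,
    [/\ point_in f (Qadj t) x, nonsingular f x &
        forall K, is_subfield K -> defined_over K x -> t \in K])).
  move=> gen; have [t [x [st tg xp xns xK]]] := curve_point gen N_gt0 d_gt0 f_homog f_irr xiP q_ge.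
  by exists t => //; split=> //; exists x.
move=> t [st [x [xp xns xK]]]; have tn := Qadj_degree st.
have tsub := Qadj_subfield t.
split=> //; split; first by split=> //; exists n'.
exists x; split=> //; split=> // K Ksub KL nKL /(xK K Ksub) tK; apply: nKL => u.
apply/idP/idP; first exact: KL.
exact: Qadj_sub.
Qed.

Lemma Dinf_D n : Dinf f n -> D f n.
Proof. by move=> /(_ 1%N)[s [_ [h _]]]; exists (nth (fun _ => false) s 0); apply: h. Qed.

Lemma D_gt0 n : D f n -> (0 < n)%N.
Proof. by case=> L [[[Lsub _] _] Ln]; apply: has_degree_gt0 Lsub Ln. Qed.

(** The empty set is Galois-stable: this starts the induction on residues and shows that [D f] is
    not empty. *)
Lemma opposite0 : opposite_in d (Dinf f) 0.
Proof. by apply: (@galois_set_opposite 0 (fun _ _ => 0)); split=> [[]|[]|nu []|[]]. Qed.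

Lemma D_nonempty : exists n, D f n.
Proof. by have [n [Dn _ _]] := opposite_element d_gt0 Dinf_D 0 opposite0; exists n. Qed.

Lemma Dinf_large G : is_gcd_of (D f) G ->
  exists n0, forall n, (n0 <= n)%N -> (G %| n)%N -> Dinf f n.
Proof.
case=> _ Gmax; apply: (@large_multiples d (D f) (Dinf f)) => //.
- exact: Dinf_D.
- exact: opposite0.
- by move=> a /(closed_point f_homog)[xi xiP _]; apply: galois_set_opposite xiP.
move=> a a' Da Da' aa'.
have [xi xiP tr] := closed_point f_homog Da; have [xi' xiP' tr'] := closed_point f_homog Da'.
apply: (galois_set_opposite (galois_set_union xiP xiP' _)) => s s' E; apply: aa'.
apply/eqP; rewrite eqn_leq (disjoint_orbits xiP xiP' tr E) //=.
exact: disjoint_orbits xiP' xiP tr' (fun i => esym (E i)).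
Qed.

End Degrees.

Lemma filter_prop (P : nat -> Prop) n : exists E : seq nat, forall e, e \in E <-> (0 < e < n)%N /\ P e.
Proof.
elim: n => [|n [E hE]]; first by exists [::] => e; rewrite ltn0 andbF; split=> // -[].
case: (classic ((0 < n)%N /\ P n)) => [[n0 Pn]|nP]; [exists (n :: E)|exists E] => e.
  rewrite inE; split=> [/predU1P[->|/hE[/andP[e0 en] Pe]]|[/andP[e0 en] Pe]].
  - by rewrite n0 ltnSn.
  - by rewrite e0 (leq_trans en).
  move: en; rewrite ltnS leq_eqVlt => /predU1P[->|en]; first by rewrite eqxx.
  by apply/orP; right; apply/hE; rewrite e0 en.
split=> [/hE[/andP[e0 en] Pe]|[/andP[e0 en] Pe]]; first by rewrite e0 (leq_trans en).
move: en; rewrite ltnS leq_eqVlt => /predU1P[En|en]; first by case: nP; rewrite -En.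
by apply/hE; rewrite e0 en.
Qed.

Theorem theorem1p1 (m : nat) (f : {mpoly int[m]}) (d : nat) (G : nat) :
  (3 <= m)%N ->
  (0 < d)%N -> f \is d.-homog ->
  mirreducible f ->
  is_gcd_of (D f) G ->
  exists E : seq nat, (forall e, e \in E -> (0 < e)%N) /\
    forall n : nat, Dinf f n <-> ((exists k, (1 <= k)%N /\ n = (G * k)%N) /\ n \notin E).
Proof.
case: m f => [|[|[|N]]] // f _ d0 f_homog f_irr Gf.
have [n0 large] : exists n0, forall n, (n0 <= n)%N -> (G %| n)%N -> Dinf f n.
  exact: (@Dinf_large N.+1 d f).
(* Only positive exceptions are listed, below a threshold past which every multiple of [G] is a
   degree; multiples of [G] belong to the right-hand side only with a positive factor. *)
have [E hE] := filter_prop (fun n => ~ Dinf f n) n0.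
exists E; split=> [e /hE[/andP[]]//|n]; split=> [Dn|[[k [k0 Dn]] nE]].
  have n_gt0 := D_gt0 (Dinf_D Dn); have [/(_ n (Dinf_D Dn))/dvdnP[k Dk] _] := Gf.
  split; last by apply/negP => /hE[].
  exists k; rewrite mulnC; split=> //.
  by rewrite lt0n; apply: contraTneq n_gt0 => k0; rewrite Dk k0.
have Gn : (G %| n)%N by rewrite Dn dvdn_mulr.
have [le|lt] := leqP n0 n; first exact: large.
apply: NNPP => nD; case/negP: nE; apply/hE; split=> //; rewrite lt andbT Dn muln_gt0 k0 andbT.
(* [G] is positive because it divides a degree that occurs, and degrees are positive. *)
have [n1 Dn1] := @D_nonempty N.+1 d f isT d0 f_homog f_irr.
by rewrite lt0n; apply: contraTneq (D_gt0 Dn1) => G0; have := Gf.1 n1 Dn1; rewrite G0 dvd0n lt0n negbK.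
Qed.
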